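(* Let $X$ be a complex manifold of complex dimension $m\geq 2$ equipped with a nowhere vanishing holomorphic $(m,0)$-form $\Omega$. Assume that $t\mapsto\omega(t)$ is a (smooth) flow of Hermitian metrics on $X$ satisfying $$\partial_t\big(\|\Omega\|_{\omega}\,\omega^{m-1}\big)=i\partial\bar\partial\,\omega^{m-2}$$ and $d\big(\|\Omega\|_{\omega(t)}\,\omega(t)^{m-1}\big)=0$ for each $t$. For each $t$ set $$\eta(t)=\|\Omega\|_{\omega(t)}\,\omega(t).$$ Then the Hermitian metrics $\eta(t)$ satisfy the conformally balanced condition $d\big(\|\Omega\|_{\eta}^2\,\eta^{m-1}\big)=0$ for each $t$, and, writing $\eta=i g_{\bar kj}\,dz^j\wedge d\bar z^k$ in local holomorphic coordinates, they evolve according to $$\partial_t g_{\bar kj}=-\frac{1}{m-1}\Big(\tilde R_{\bar kj}(\eta)+\frac12 (T\circ\bar T)_{\bar kj}\Big),$$ where $\tilde R_{\bar kj}(\eta)$ and $(T\circ\bar T)_{\bar kj}$ are the Chern-Ricci tensor and the quadratic torsion term of $\eta$ defined in the context.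
   Context: A Hermitian metric is identified with its positive $(1,1)$-form. For a Hermitian metric $\omega$ and a holomorphic $(m,0)$-form $\Omega$, the norm $\|\Omega\|_\omega$ is defined by $i^{m^2}\,\Omega\wedge\bar\Omega=\|\Omega\|_\omega^2\,\frac{\omega^m}{m!}$. The power $\omega^0$ is the constant function $1$. For a Hermitian metric $\eta=i g_{\bar kj}\,dz^j\wedge d\bar z^k$ with inverse matrix $g^{j\bar k}$ (summation convention throughout): - The Chern-Ricci tensor is $\tilde R_{\bar kj}(\eta):=R^p{}_{p\bar kj}=-g^{p\bar q}g_{\bar kn}\,\partial_{\bar q}\big(g^{n\bar\ell}\,\partial_p g_{\bar\ell j}\big)$. - The torsion is $T=i\partial\eta=\frac12 T_{\bar kpq}\,dz^q\wedge dz^p\wedge d\bar z^k$, i.e. $T_{\bar kpq}=\partial_p g_{\bar kq}-\partial_q g_{\bar kp}$; and $\bar T_{j\bar p\bar q}:=\overline{T_{\bar jpq}}$. - $(T\circ\bar T)_{\bar kj}:=T_{\bar kpq}\,\bar T_j{}^{pq}=g^{p\bar r}g^{q\bar s}\,T_{\bar kpq}\,\bar T_{j\bar r\bar s}$. *)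

(* Defs.v *)
From HB Require Import structures.
From mathcomp Require Import all_boot all_order all_algebra.
From mathcomp Require Import complex.
From mathcomp Require Import all_classical all_reals all_analysis.
Import numFieldNormedType.Exports.
Import Order.TTheory GRing.Theory Num.Theory.

Set Implicit Arguments.
Unset Strict Implicit.
Unset Printing Implicit Defensive.

Local Open Scope classical_set_scope.
Local Open Scope ring_scope.
Local Open Scope complex_scope.

(* [R[i]^o] is R[i] with its topology; [Cn R m] is C^m. *)
Notation Cn R m := 'rV[R[i]^o]_m.

(* ------------------------------------------------------------------------ *)
(* Exterior algebra on dz^1, ..., dz^m, dzbar^1, ..., dzbar^m.  The (A, B)    *)
(* coefficient of a form is the one of  dz^A /\ dzbar^B,  where               *)
(* dz^A = dz^{a_1} /\ ... /\ dz^{a_p}  for  A = {a_1 < ... < a_p}.            *)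

Notation bideg m := ({set 'I_m} * {set 'I_m})%type.
Notation extalg R m := {ffun bideg m -> R[i]^o}.

Section ExteriorAlgebra.
Variables (R : realType) (m : nat).
Implicit Types (A B : {set 'I_m}) (a b : extalg R m).

Definition inversions A B : nat :=
  #|[pred ij : 'I_m * 'I_m | [&& ij.1 \in A, ij.2 \in B & (ij.2 < ij.1)%N]]|.

(* The term #|B| * #|A'| of the sign moves dz^A' to the left of dzbar^B in
   dz^A /\ dzbar^B /\ dz^A' /\ dzbar^B'. *)
Definition wedge a b : extalg R m :=
  [ffun P : bideg m => \sum_(A in powerset P.1) \sum_(B in powerset P.2)
     let A' := P.1 :\: A in let B' := P.2 :\: B in
     (-1) ^+ (inversions A A' + inversions B B' + #|B| * #|A'|)
       * a (A, B) * b (A', B')].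

Definition form1 : extalg R m := [ffun P : bideg m => (P == (finset.set0, finset.set0))%:R].
Definition dz (j : 'I_m) : extalg R m :=
  [ffun P : bideg m => (P == ([set j]%SET, finset.set0))%:R].
Definition dzbar (j : 'I_m) : extalg R m :=
  [ffun P : bideg m => (P == (finset.set0, [set j]%SET))%:R].

Definition wpow a (n : nat) : extalg R m := iter n (wedge a) form1.

(* The sign comes from  dzbar^B /\ dz^A = (-1)^{|A||B|} dz^A /\ dzbar^B. *)
Definition conjform a : extalg R m :=
  [ffun P : bideg m => (-1) ^+ (#|P.1| * #|P.2|) * (a (P.2, P.1))^*%C].

Definition has_type (p q : nat) a : Prop :=
  forall A B, a (A, B) != 0 -> #|A| = p /\ #|B| = q.

(* Pullback along a holomorphic map F with Jacobian J a j = d F^a / d z^j. *)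
Definition pullback (J : 'M[R[i]]_m) a : extalg R m :=
  \sum_(P : bideg m) a P *: wedge
    (\big[wedge/form1]_(k in P.1) \sum_j J k j *: dz j)
    (\big[wedge/form1]_(k in P.2) \sum_j (J k j)^*%C *: dzbar j).

(* The matrix g with  a = i g_{kbar j} dz^j /\ dzbar^k  when a is a
   (1,1)-form; row k, column j is g_{kbar j}, so that entry (j, k) of its
   inverse is g^{j kbar}. *)
Definition metric_mx a : 'M[R[i]]_m :=
  \matrix_(k, j) (- 'i * a ([set j]%SET, [set k]%SET)).

Definition hermitian_pos a : Prop :=
  [/\ has_type 1 1 a,
      forall k j, metric_mx a k j = (metric_mx a j k)^*%C
    & forall v : 'I_m -> R[i], (exists j, v j != 0) ->
        0 < \sum_k \sum_j metric_mx a k j * v j * (v k)^*%C].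

(* The number r >= 0 with  i^{m^2} Om /\ conj Om = r^2 om^m / m! ;
   it is unique whenever om^m is nonzero. *)
Definition form_norm (Om om : extalg R m) : R :=
  xget 0 [set r : R | 0 <= r /\
    'i ^+ (m ^ 2) *: wedge Om (conjform Om)
      = ((r ^+ 2)%:C / m`!%:R) *: wpow om m].

End ExteriorAlgebra.
Arguments form1 {R m}.
Arguments dz {R m}.
Arguments dzbar {R m}.

(* ------------------------------------------------------------------------ *)
Section Calculus.
Variables (R : realType) (m : nat).
Implicit Types (I : set R) (V : set (Cn R m)).

Definition diffquot (f : R -> R[i]) (t s : R) : R[i]^o :=
  ((s - t)%:C)^-1 * (f s - f t).

(* Derivatives along an interval I: one-sided at the end points of I. *)
Definition is_deriv_in I (f : R -> R[i]) (t : R) (l : R[i]) : Prop :=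
  diffquot f t s @[s --> within I t^'] --> (l : R[i]^o).
Definition derivable_in I (f : R -> R[i]) (t : R) : Prop :=
  exists l, is_deriv_in I f t l.
Definition deriv_in I (f : R -> R[i]) (t : R) : R[i] :=
  lim (diffquot f t s @[s --> within I t^']).

Definition on_line (f : Cn R m -> R[i]) (z v : Cn R m) (h : R) : R[i] :=
  f (z + h%:C *: v).
Definition rderivable (v : Cn R m) (f : Cn R m -> R[i]) (z : Cn R m) : Prop :=
  derivable_in setT (on_line f z v) 0.
Definition rderiv (v : Cn R m) (f : Cn R m -> R[i]) (z : Cn R m) : R[i] :=
  deriv_in setT (on_line f z v) 0.

(* Wirtinger derivatives d/dz^j and d/dzbar^j. *)
Definition pd (j : 'I_m) (f : Cn R m -> R[i]) (z : Cn R m) : R[i] :=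
  2^-1 * (rderiv (delta_mx 0 j) f z - 'i * rderiv ('i *: delta_mx 0 j) f z).
Definition pdbar (j : 'I_m) (f : Cn R m -> R[i]) (z : Cn R m) : R[i] :=
  2^-1 * (rderiv (delta_mx 0 j) f z + 'i * rderiv ('i *: delta_mx 0 j) f z).

(* C^n in (t, z) on I x V, in the real sense. *)
Fixpoint class_C (n : nat) I V (f : R -> Cn R m -> R[i]) : Prop :=
  {within I `*` V, continuous (fun p : R * Cn R m => f p.1 p.2 : R[i]^o)} /\
  if n is n'.+1 then
    [/\ forall t z, I t -> V z -> derivable_in I (f^~ z) t,
        class_C n' I V (fun t z => deriv_in I (f^~ z) t),
        forall v t z, I t -> V z -> rderivable v (f t) z
      & forall v, class_C n' I V (fun t => rderiv v (f t))]
  else True.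

Definition smooth_flow_on I V (f : R -> Cn R m -> R[i]) : Prop :=
  forall n, class_C n I V f.
Definition smooth_on V (f : Cn R m -> R[i]) : Prop :=
  smooth_flow_on setT V (fun _ => f).

Definition holomorphic_on V (F : Cn R m -> Cn R m) : Prop :=
  forall k, smooth_on V (fun z => F z 0 k) /\
    forall j z, V z -> pdbar j (fun w => F w 0 k) z = 0.

Definition del (a : Cn R m -> extalg R m) (z : Cn R m) : extalg R m :=
  \sum_j wedge (dz j) [ffun P : bideg m => pd j (fun w => a w P) z].
Definition delbar (a : Cn R m -> extalg R m) (z : Cn R m) : extalg R m :=
  \sum_j wedge (dzbar j) [ffun P : bideg m => pdbar j (fun w => a w P) z].
Definition ext_d (a : Cn R m -> extalg R m) (z : Cn R m) : extalg R m :=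
  del a z + delbar a z.

(* Below G z k j = g_{kbar j}(z)  and  invmx (G z) j k = g^{j kbar}(z). *)

Definition chern_ricci (G : Cn R m -> 'M[R[i]]_m) (z : Cn R m)
    (k j : 'I_m) : R[i] :=
  - \sum_p \sum_q \sum_n invmx (G z) p q * G z k n *
      pdbar q (fun w => \sum_l invmx (G w) n l * pd p (fun u => G u l j) w) z.

Definition torsion (G : Cn R m -> 'M[R[i]]_m) (z : Cn R m)
    (k p q : 'I_m) : R[i] :=
  pd p (fun w => G w k q) z - pd q (fun w => G w k p) z.

Definition torsion_sq (G : Cn R m -> 'M[R[i]]_m) (z : Cn R m)
    (k j : 'I_m) : R[i] :=
  \sum_p \sum_q \sum_r \sum_s invmx (G z) p r * invmx (G z) q s *
    torsion G z k p q * (torsion G z j r s)^*%C.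

End Calculus.

(* ------------------------------------------------------------------------ *)
(* [cparam] is the inverse of [coord] on [cdom]; both maps are total with
   irrelevant values elsewhere. *)
Record chart (R : realType) (m : nat) (X : topologicalType) := Chart {
  cdom : set X;
  coord : X -> Cn R m;
  cparam : Cn R m -> X }.

Section Manifold.
Variables (R : realType) (m : nat) (X : topologicalType).
Implicit Types (c : chart R m X) (A : set (chart R m X)).

Definition cimg c : set (Cn R m) := coord c @` cdom c.

Definition is_chart c : Prop :=
  [/\ open (cdom c), open (cimg c),
      forall x, cdom c x -> cparam c (coord c x) = x,
      {within cdom c, continuous (coord c)}
    & {within cimg c, continuous (cparam c)}].

Definition overlap c c' : set (Cn R m) := coord c @` (cdom c `&` cdom c').
Definition transition c c' : Cn R m -> Cn R m := coord c' \o cparam c.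

Definition compatible c c' : Prop :=
  holomorphic_on (overlap c c') (transition c c') /\
  holomorphic_on (overlap c' c) (transition c' c).

(* The maximal atlas A consists of all local holomorphic coordinates. *)
Definition complex_manifold A : Prop :=
  [/\ hausdorff_space X, @second_countable X &
   [/\ A `<=` is_chart,
      forall x, exists2 c, A c & cdom c x,
      forall c c', A c -> A c' -> compatible c c'
    & forall c, is_chart c -> (forall c', A c' -> compatible c c') -> A c]].

Definition jacobian c c' (z : Cn R m) : 'M[R[i]]_m :=
  \matrix_(k, j) pd j (fun w => transition c c' w 0 k) z.

(* A form on X is given by its expression in each chart; only the values on
   [cimg c] for c in the atlas are relevant. *)
Definition mform := chart R m X -> Cn R m -> extalg R m.

Definition is_form A (a : mform) : Prop :=
  forall c c' z, A c -> A c' -> overlap c c' z ->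
    a c z = pullback (jacobian c c' z) (a c' (transition c c' z)).

Definition nonvanishing_holomorphic_volume A (Om : mform) : Prop :=
  [/\ is_form A Om,
      forall c z, A c -> cimg c z -> has_type m 0 (Om c z),
      forall c P, A c -> smooth_on (cimg c) (fun z => Om c z P),
      forall c z, A c -> cimg c z -> delbar (Om c) z = 0
    & forall c z, A c -> cimg c z -> Om c z != 0].

Definition hermitian_metric_flow A (I : set R) (om : R -> mform) : Prop :=
  [/\ forall t, I t -> is_form A (om t),
      forall t c z, I t -> A c -> cimg c z -> hermitian_pos (om t c z)
    & forall c P, A c -> smooth_flow_on I (cimg c) (fun t z => om t c z P)].

Definition closed_form A (a : mform) : Prop :=
  forall c z, A c -> cimg c z -> ext_d (a c) z = 0.

(* Evolution equation  d/dt a = b,  coefficient by coefficient. *)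
Definition evolves_by A (I : set R) (a b : R -> mform) : Prop :=
  forall t c z P, I t -> A c -> cimg c z ->
    is_deriv_in I (fun s => a s c z P) t (b t c z P).

Definition norm_of (Om om : mform) c (z : Cn R m) : R :=
  form_norm (Om c z) (om c z).
Definition scale_form (f : chart R m X -> Cn R m -> R) (a : mform) : mform :=
  fun c z => (f c z)%:C *: a c z.
Definition pow_form (a : mform) (n : nat) : mform := fun c z => wpow (a c z) n.
Definition i_del_delbar (a : mform) : mform :=
  fun c z => 'i *: del (delbar (a c)) z.

End Manifold.

(* Main.v *)
Require Import Defs.
From HB Require Import structures.
From mathcomp Require Import all_boot all_order all_algebra.
From mathcomp Require Import complex.
From mathcomp Require Import all_classical all_reals all_analysis.
From mathcomp Require Import zify ring lra.
Import numFieldNormedType.Exports.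
Import Order.TTheory GRing.Theory Num.Theory.

Set Implicit Arguments.
Unset Strict Implicit.
Unset Printing Implicit Defensive.

Local Open Scope ring_scope.
Local Open Scope complex_scope.

(** Why the theorem holds.  In a chart write [Om = f dz^1 /\ ... /\ dz^m], let
    [F = |f|^2], [r = ||Om||_om], and let [H] be the inverse matrix of the
    metric [eta = r om].  Everything becomes simple when expressed through [H].

    By definition [r^2 om^m] is a constant multiple of [F] times the standard
    volume form.  Cofactors of the matrix of [om] are the coefficients of
    [om^(m-1)], and they are [om^m] times entries of the inverse; complementary
    minors of codimension two are the coefficients of [om^(m-2)], and they are
    [om^m] times 2 by 2 minors of the inverse (Jacobi).  The powers of [r] cancel
    exactly, so that up to constants ([rescaled_top1], [rescaled_top2])

      [r om^(m-1)  ~  F H^{ab}]  and  [om^(m-2)  ~  F (H^{ab} H^{pq} - H^{aq} H^{pb})],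

    with no determinant left.  The hypotheses now read

      [sum_p d_p (F H^{pb}) = 0],   [sum_q dbar_q (F H^{aq}) = 0]   and
      [(m-1) F d_t H^{ab} = sum_pq d_p dbar_q (F (H^{ab} H^{pq} - H^{aq} H^{pb}))].

    In the last right-hand side every term in which [F] is differentiated
    disappears: as [f] is holomorphic, the balanced equations also hold with [F]
    replaced by [f] or by its conjugate, and mixed derivatives commute.  What
    remains is ([ddbar_inverse_metric])

      [F (H^{pq} d_p dbar_q H^{ab} - d_p H^{aq} dbar_q H^{pb})].

    Lowering both indices by means of [dH = - H (dg) H] turns the bracket into
    the Chern-Ricci tensor plus half the quadratic torsion term
    ([evolution_algebra], [curvature_evolution]), and turns [d_t H] into
    [- d_t g] with lowered indices ([is_deriv_of_invmx]), which gives the factor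
    [-1/(m-1)] ([evolution_in_chart]).

    The conformally balanced condition is the hypothesis itself, since
    [||Om||_eta^2 eta^(m-1) = ||Om||_om om^(m-1)] by homogeneity of the norm
    ([rescaled_balanced_form]).

    Two further points need an argument for [eta] to be a flow of Hermitian metrics.
    The norm does not depend on the chart, because pullback is a morphism of
    algebras which commutes with conjugation ([form_norm_pullback]).  The
    function [r] exists and is positive because the top power of a positive
    (1,1)-form is a positive multiple of the standard one
    ([hermitian_pos_top], by the spectral theorem), and it is smooth as the
    positive square root of a smooth function ([class_C_sqr_root]).

    Exterior algebra is handled with a single tool: the wedge product makes
    forms into an associative algebra, and images of the generators that
    anticommute extend to an algebra endomorphism ([emorM]).  Substituting a
    frame in which a metric is standard reduces the identities on its powers to
    those of the standard form ([std_form_pow]). *)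

(** * The exterior algebra as a ring *)

Section Inversions.
Variable m : nat.
Implicit Types A B C : {set 'I_m}.

Lemma inversionsE A B : inversions A B = (\sum_(i in A) \sum_(j in B) (j < i))%N.
Proof.
rewrite /inversions pair_big_dep -sum1_card /=.
rewrite [RHS](bigID (fun p : 'I_m * 'I_m => (p.2 < p.1)%N)) /=.
rewrite [X in (_ + X)%N]big1 ?addn0; last by move=> p /andP[_ /negPf ->].
by apply: eq_big => [p|p /and3P[_ _ ->//]]; rewrite !inE /= andbA.
Qed.

Lemma inversionsUl A A' B : [disjoint A & A'] ->
  inversions (A :|: A') B = (inversions A B + inversions A' B)%N.
Proof.
move=> dA; rewrite !inversionsE -bigU //=; apply: eq_bigl => i; by rewrite !inE.
Qed.

Lemma inversionsUr A B B' : [disjoint B & B'] ->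
  inversions A (B :|: B') = (inversions A B + inversions A B')%N.
Proof.
move=> dB; rewrite !inversionsE -big_split /=; apply: eq_bigr => i _.
by rewrite -bigU //=; apply: eq_bigl => j; rewrite !inE.
Qed.

(** Each pair of distinct elements is an inversion in exactly one order: the
    sign rule for exchanging two monomials. *)
Lemma inversionsC A B : [disjoint A & B] ->
  (inversions A B + inversions B A = #|A| * #|B|)%N.
Proof.
move=> dAB; rewrite !inversionsE [X in (_ + X)%N]exchange_big -big_split /=.
rewrite -sum_nat_const; apply: eq_bigr => i iA.
rewrite -big_split -sum1_card /=; apply: eq_bigr => j jB.
have /negPf nij : i != j :> nat.
  by apply/eqP => /val_inj ij; rewrite -ij (disjointFr dAB iA) in jB.
by move: nij; case: ltngtP.
Qed.

Lemma inversions0l B : inversions finset.set0 B = 0%N.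
Proof. by rewrite inversionsE big_set0. Qed.

Lemma inversions0r A : inversions A finset.set0 = 0%N.
Proof. by rewrite inversionsE big1 // => i _; rewrite big_set0. Qed.

Lemma cardsU_disjoint A B : [disjoint A & B] -> #|A :|: B| = (#|A| + #|B|)%N.
Proof. by rewrite -setI_eq0 cardsU => /eqP->; rewrite cards0 subn0. Qed.

End Inversions.

Section Bidegrees.
Variables (R : realType) (m : nat).
Implicit Types P Q S U : bideg m.

Definition bdisj P Q := [disjoint P.1 & Q.1] && [disjoint P.2 & Q.2].
Definition bcup P Q : bideg m := (P.1 :|: Q.1, P.2 :|: Q.2).
Definition bdiff P Q : bideg m := (P.1 :\: Q.1, P.2 :\: Q.2).
Definition bexp P Q : nat :=
  (inversions P.1 Q.1 + inversions P.2 Q.2 + #|P.2| * #|Q.1|)%N.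

(** The structure constants of the basis monomials, [e_P e_Q = bsgn P Q e_(P u Q)]. *)
Definition bsgn P Q : R[i] := (bdisj P Q)%:R * (-1) ^+ bexp P Q.

(** A basis monomial [e_U] arises from [e_P e_Q] exactly when [Q] is the
    complement of [P] in [U]; this passes between sums over subsets and sums over
    pairs of monomials. *)
Lemma bcup_disjE P Q U :
  (bdisj P Q && (bcup P Q == U)) =
  [&& P.1 \subset U.1, P.2 \subset U.2 & Q == bdiff U P].
Proof.
case: P Q U => [A B] [A' B'] [U V]; rewrite /bdisj /bcup /bdiff /=.
rewrite -!pair_eqE /pair_eq /=.
have one (X Y Z : {set 'I_m}) :
    ([disjoint X & Y] && (X :|: Y == Z)) = (X \subset Z) && (Y == Z :\: X).
  apply/andP/andP => [[dXY /eqP<-]|[sXZ /eqP->]]; split.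
  - exact: finset.subsetUl.
  - rewrite finset.setDUl finset.setDv finset.set0U eq_sym.
    by apply/eqP/finset.setDidPl; rewrite disjoint_sym.
  - by rewrite -setI_eq0; apply/eqP/finset.setP => i; rewrite !inE; case: (i \in X).
  - by apply/eqP/finset.setP => i; rewrite !inE; case: (boolP (i \in X)) => //= /(fintype.subsetP sXZ) ->.
by have := one A A' U; have := one B B' V; do 4! case: (_ == _) => //=;
  do ! case: [disjoint _ & _] => //=; do ! case: (_ \subset _) => //=.
Qed.

(** The cocycle condition behind associativity.  The exponents are bilinear in
    disjoint unions, so both sides expand to the same terms. *)
Lemma bsgnA P Q S : bsgn P Q * bsgn (bcup P Q) S = bsgn Q S * bsgn P (bcup Q S).
Proof.
rewrite /bsgn.
case: P Q S => [A B] [A' B'] [A2 B2]; rewrite /bdisj /bcup /bexp /=.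
have dU (X Y Z : {set 'I_m}) : [disjoint X :|: Y & Z] = [disjoint X & Z] && [disjoint Y & Z].
  by rewrite -!setI_eq0 finset.setIUl finset.setU_eq0.
rewrite ![in RHS](disjoint_sym A) ![in RHS](disjoint_sym B) !dU.
rewrite (disjoint_sym A A') (disjoint_sym B B') (disjoint_sym A2) (disjoint_sym B2).
case dA : [disjoint A' & A] => /=; last by rewrite !(mul0r, mulr0).
case dB : [disjoint B' & B] => /=; last by rewrite !(mul0r, mulr0, andbF).
case dA2 : [disjoint A & A2] => /=; last by rewrite !(mul0r, mulr0, andbF).
case dB2 : [disjoint B & B2] => /=; last by rewrite !(mul0r, mulr0, andbF).
case dA3 : [disjoint A' & A2] => /=; last by rewrite !(mul0r, mulr0, andbF).
case dB3 : [disjoint B' & B2] => /=; last by rewrite !(mul0r, mulr0, andbF).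
rewrite !mul1r -!exprD; congr (_ ^+ _).
rewrite !inversionsUl ?inversionsUr // 1?disjoint_sym //.
rewrite !cardsU_disjoint // 1?disjoint_sym // mulnDl mulnDr.
have H x1 x2 x3 x4 x5 x6 y1 y2 y3 : (x1 + x2 + y1 + (x3 + x4 + (x5 + x6) + (y2 + y3)) =
    x4 + x6 + y3 + (x1 + x3 + (x2 + x5) + (y1 + y2)))%N by lia.
exact: H.
Qed.

End Bidegrees.

(** A separate name, because finite functions into a ring already carry the
    pointwise product. *)
Definition ext (R : realType) (m : nat) : Type := extalg R m.
HB.instance Definition _ R m := GRing.Zmodule.copy (ext R m) (extalg R m).

(** Both operations are sealed: unfolding them down to the arithmetic of R[i]
    makes unification diverge. *)
HB.lock Definition emul (R : realType) (m : nat) (a b : ext R m) : ext R m :=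
  wedge (a : extalg R m) (b : extalg R m).
HB.lock Definition escale (R : realType) (m : nat) (k : R[i]) (a : ext R m) : ext R m :=
  k *: (a : extalg R m).

Section Scaling.
Variables (R : realType) (m : nat).
Implicit Types (k : R[i]) (a b : ext R m).

Fact escaleA k l a : escale k (escale l a) = escale (k * l) a.
Proof. by rewrite escale.unlock; apply: scalerA. Qed.
Fact escale1 : left_id 1 (@escale R m).
Proof. by move=> a; rewrite escale.unlock; apply: scale1r. Qed.
Fact escaleDr : right_distributive (@escale R m) +%R.
Proof. by move=> k a b; rewrite escale.unlock; apply: scalerDr. Qed.
Fact escaleDl a : {morph (@escale R m)^~ a : k l / k + l}.
Proof. by move=> k l; rewrite escale.unlock; apply: scalerDl. Qed.

HB.instance Definition _ := GRing.Zmodule_isLmodule.Build R[i] (ext R m)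
  escaleA escale1 escaleDr escaleDl.

Lemma escaleE k a : k *: a = k *: (a : extalg R m) :> extalg R m.
Proof. by rewrite {1}/GRing.scale /= escale.unlock. Qed.

End Scaling.

Section Ring.
Variables (R : realType) (m : nat).
Implicit Types (P Q S U : bideg m) (a b c : ext R m).

Definition coef P a : R[i] := (a : extalg R m) P.
Definition mono P : ext R m := [ffun Q : bideg m => (Q == P)%:R] : extalg R m.

Lemma extP a b : (forall P, coef P a = coef P b) -> a = b.
Proof. by move=> ab; apply/ffunP => P; apply: ab. Qed.

Lemma coefD P a b : coef P (a + b) = coef P a + coef P b.
Proof. by rewrite /coef ffunE. Qed.

Lemma coefZ P k a : coef P (k *: a) = k * coef P a.
Proof. by rewrite /coef escaleE ffunE. Qed.

Lemma coef0 P : coef P 0 = 0.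
Proof. by rewrite /coef ffunE. Qed.

Lemma coef_sum (I : Type) (r : seq I) (D : pred I) (F : I -> ext R m) P :
  coef P (\sum_(i <- r | D i) F i) = \sum_(i <- r | D i) coef P (F i).
Proof. by elim/big_rec2: _ => [|i x y _ <-]; rewrite ?coef0 ?coefD. Qed.

Lemma coef_mono P Q : coef P (mono Q) = (P == Q)%:R.
Proof. by rewrite /coef ffunE. Qed.

Lemma ext_sum_mono a : a = \sum_P coef P a *: mono P.
Proof.
apply: extP => Q; rewrite coef_sum (bigD1 Q) //= coefZ coef_mono eqxx mulr1.
by rewrite big1 ?addr0 // => P PQ; rewrite coefZ coef_mono eq_sym (negPf PQ) mulr0.
Qed.

(** Summing over all pairs of monomials, with [bsgn] vanishing on overlaps,
    makes the bilinearity of the product visible. *)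
Lemma coef_emul a b U :
  coef U (emul a b) = \sum_(P : bideg m) \sum_(Q : bideg m) (bcup P Q == U)%:R * bsgn R P Q * (coef P a * coef Q b).
Proof.
have -> : coef U (emul a b) = \sum_(P : bideg m) ((P.1 \subset U.1) && (P.2 \subset U.2))%:R *
    ((-1) ^+ bexp P (bdiff U P) * (coef P a * coef (bdiff U P) b)).
  rewrite /coef emul.unlock ffunE pair_big_dep /= big_mkcond; apply: eq_bigr => P _.
  rewrite !powersetE; case: ifP => _; last by rewrite mul0r.
  by rewrite mul1r mulrA -surjective_pairing.
apply: eq_bigr => P _; rewrite (bigD1 (bdiff U P)) //= big1 ?addr0 => [|Q QP].
  have := bcup_disjE P (bdiff U P) U; rewrite eqxx andbT => <-.
  by rewrite /bsgn; case: bdisj => /=; rewrite ?(mul0r, mulr0) // mul1r mulrA.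
have := bcup_disjE P Q U; rewrite (negPf QP) !andbF => /negbT.
by rewrite /bsgn negb_and => /orP[]/negPf ->; rewrite !(mul0r, mulr0).
Qed.

Lemma emulDl : left_distributive (@emul R m) +%R.
Proof.
move=> a b c; apply: extP => U; rewrite coefD !coef_emul -big_split /=.
apply: eq_bigr => P _; rewrite -big_split /=; apply: eq_bigr => Q _.
by rewrite coefD mulrDl mulrDr.
Qed.

Lemma emulDr : right_distributive (@emul R m) +%R.
Proof.
move=> a b c; apply: extP => U; rewrite coefD !coef_emul -big_split /=.
apply: eq_bigr => P _; rewrite -big_split /=; apply: eq_bigr => Q _.
by rewrite coefD !mulrDr.
Qed.

Lemma emulZl k a b : k *: emul a b = emul (k *: a) b.
Proof.
apply: extP => U; rewrite coefZ !coef_emul mulr_sumr.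
apply: eq_bigr => P _; rewrite mulr_sumr; apply: eq_bigr => Q _.
by rewrite coefZ mulrCA !mulrA.
Qed.

Lemma emulZr k a b : k *: emul a b = emul a (k *: b).
Proof.
apply: extP => U; rewrite coefZ !coef_emul mulr_sumr.
apply: eq_bigr => P _; rewrite mulr_sumr; apply: eq_bigr => Q _.
by rewrite coefZ mulrCA [in RHS](mulrCA (coef P a)).
Qed.

Lemma emul_mono P Q : emul (mono P) (mono Q) = bsgn R P Q *: mono (bcup P Q).
Proof.
apply: extP => U; rewrite coef_emul coefZ coef_mono.
rewrite (bigD1 P) //= (bigD1 Q) //= !coef_mono !eqxx !mulr1.
rewrite big1 ?addr0 => [|Q' QQ]; last by rewrite !coef_mono (negPf QQ) !mulr0.
rewrite big1 ?addr0 => [|P' PP]; last first.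
  by apply: big1 => Q' _; rewrite !coef_mono (negPf PP) mul0r !mulr0.
by rewrite eq_sym mulrC.
Qed.

Lemma emul_suml (I : Type) (r : seq I) (F : I -> ext R m) b :
  emul (\sum_(i <- r) F i) b = \sum_(i <- r) emul (F i) b.
Proof.
elim: r => [|i r IH]; last by rewrite !big_cons emulDl IH.
by rewrite !big_nil -[in LHS](scale0r (0 : ext R m)) -emulZl scale0r.
Qed.

Lemma emul_sumr (I : Type) (r : seq I) (F : I -> ext R m) b :
  emul b (\sum_(i <- r) F i) = \sum_(i <- r) emul b (F i).
Proof.
elim: r => [|i r IH]; last by rewrite !big_cons emulDr IH.
by rewrite !big_nil -[in LHS](scale0r (0 : ext R m)) -emulZr scale0r.
Qed.

Lemma emulA : associative (@emul R m).
Proof.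
move=> a b c; rewrite (ext_sum_mono c) !emul_sumr; apply: eq_bigr => S _.
rewrite -!emulZr; congr (_ *: _).
rewrite (ext_sum_mono b) emul_suml !emul_sumr emul_suml; apply: eq_bigr => Q _.
rewrite -emulZl -!emulZr -emulZl; congr (_ *: _).
rewrite (ext_sum_mono a) !emul_suml; apply: eq_bigr => P _.
rewrite -!emulZl; congr (_ *: _).
rewrite !emul_mono -emulZl -emulZr !emul_mono !scalerA bsgnA.
by rewrite /bcup /= !finset.setUA.
Qed.

Lemma bsgn0l P : bsgn R (finset.set0, finset.set0) P = 1.
Proof.
by rewrite /bsgn /bdisj /bexp /= -!setI_eq0 !finset.set0I !eqxx !inversions0l cards0 mulr1.
Qed.

Lemma bsgn0r P : bsgn R P (finset.set0, finset.set0) = 1.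
Proof.
by rewrite /bsgn /bdisj /bexp /= -!setI_eq0 !finset.setI0 !eqxx !inversions0r cards0 muln0 mulr1.
Qed.

Lemma emul1l : left_id (mono (finset.set0, finset.set0)) (@emul R m).
Proof.
move=> a; rewrite [in LHS](ext_sum_mono a) emul_sumr [RHS]ext_sum_mono.
apply: eq_bigr => -[A B] _.
by rewrite -emulZr emul_mono bsgn0l scale1r /bcup /= !finset.set0U.
Qed.

Lemma emul1r : right_id (mono (finset.set0, finset.set0)) (@emul R m).
Proof.
move=> a; rewrite [in LHS](ext_sum_mono a) emul_suml [RHS]ext_sum_mono.
apply: eq_bigr => -[A B] _.
by rewrite -emulZl emul_mono bsgn0r scale1r /bcup /= !finset.setU0.
Qed.

Lemma mono_neq0 P : mono P != 0.
Proof.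
by apply/eqP => /(congr1 (coef P)) /eqP; rewrite coef_mono coef0 eqxx oner_eq0.
Qed.

HB.instance Definition _ := GRing.Zmodule_isNzRing.Build (ext R m)
  emulA emul1l emul1r emulDl emulDr (mono_neq0 _).
HB.instance Definition _ := GRing.Lmodule_isLalgebra.Build R[i] (ext R m) emulZl.
HB.instance Definition _ := GRing.Lalgebra_isAlgebra.Build R[i] (ext R m) emulZr.

Lemma wedgeE a b : wedge (a : extalg R m) (b : extalg R m) = a * b.
Proof. by rewrite {1}/GRing.mul /= emul.unlock. Qed.

Lemma wpowE a n : wpow (a : extalg R m) n = a ^+ n.
Proof. by elim: n => [|n IH] //=; rewrite exprS -IH -wedgeE. Qed.

Lemma mono_mul P Q : mono P * mono Q = bsgn R P Q *: mono (bcup P Q).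
Proof. exact: emul_mono. Qed.

End Ring.
Arguments mono {R m}.

(** * Morphisms of exterior algebras *)

Section OrderedProducts.
Variables (R : realType) (m : nat) (th : 'I_m -> ext R m).
Implicit Types (A B : {set 'I_m}) (j k : 'I_m).

Definition anticommuting := forall j k, th j * th k = - (th k * th j).

Hypothesis th_anti : anticommuting.

Lemma anticommuting_sqr j : th j * th j = 0.
Proof.
have dbl : th j * th j + th j * th j = 0 by rewrite {1}th_anti addNr.
have -> : th j * th j = (2^-1 : R[i]) *: (th j * th j + th j * th j).
  by rewrite scalerDr -scalerDl -div1r -splitr scale1r.
by rewrite dbl scaler0.
Qed.

(** The product is taken in increasing order of the indices, as in the
    definition of [dz^A]. *)
Definition wprod A : ext R m := \prod_(k in A) th k.

(** Inserting [th j] at its place in an ordered product costs one sign for each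
    factor it passes, and gives [0] if [th j] is already there. *)
Lemma prod_seq_mul1 (s : seq 'I_m) A j :
    sorted (fun i k : 'I_m => (i < k)%N) s -> j \in s ->
  th j * \prod_(k <- s | k \in A) th k =
  ((j \notin A)%:R * (-1) ^+ (\sum_(k <- s | k \in A) (k < j))%N : R[i])
     *: \prod_(k <- s | k \in j |: A) th k.
Proof.
have ltT : transitive (fun i k : 'I_m => (i < k)%N) by move=> a b c; apply: ltn_trans.
elim: s => [|x s IH] //= xs; have /allP min_x := order_path_min ltT xs.
rewrite inE !big_cons; case: (eqVneq j x) => [-> _|nxj /= js].
  have rest : \prod_(k <- s | k \in x |: A) th k = \prod_(k <- s | k \in A) th k.
    rewrite big_seq_cond [RHS]big_seq_cond; apply: eq_bigl => k.
    by case: (boolP (k \in s)) => //= /min_x xk; rewrite !inE -val_eqE /= gtn_eqF.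
  have e0 : (\sum_(k <- s | k \in A) (k < x) = 0)%N.
    rewrite big_seq_cond big1 // => k /andP[/min_x xk _].
    by rewrite ltnNge (ltnW xk).
  rewrite !inE eqxx /= rest; case: ifP => /= xA.
    by rewrite mulrA anticommuting_sqr mul0r mul0r scale0r.
  by rewrite e0 mul1r scale1r.
have xj : (x < j)%N by apply: min_x.
rewrite [in RHS]inE !inE eq_sym (negPf nxj) /=; case: ifP => xA; last first.
  exact: IH (path_sorted xs) js.
rewrite mulrA th_anti mulNr -mulrA (IH (path_sorted xs) js) xj exprD -scalerAr.
by rewrite expr1 mulN1r mulrN scaleNr.
Qed.

Lemma wprod_mul1 A j :
  th j * wprod A =
  ((j \notin A)%:R * (-1) ^+ inversions [set j] A : R[i]) *: wprod (j |: A).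
Proof.
have enumE : index_enum 'I_m = enum 'I_m by rewrite enumT [index_enum _]unlock.
rewrite /wprod inversionsE big_set1 prod_seq_mul1 ?mem_index_enum // enumE.
by rewrite -(@sorted_map _ _ (@nat_of_ord m) ltn) val_enum_ord iota_ltn_sorted.
Qed.

Lemma wprod0 : wprod finset.set0 = 1.
Proof. by rewrite /wprod big_set0. Qed.

End OrderedProducts.

Section Morphism.
Variables (R : realType) (m : nat) (th thb : 'I_m -> ext R m).
Implicit Types (P Q : bideg m) (A B : {set 'I_m}) (a b x : ext R m).

(** The algebra morphism sending [dz^k] to [th k] and [dzbar^k] to [thb k], when
    all these images anticommute. *)
Definition emor a : ext R m :=
  \sum_(P : bideg m) coef P a *: (wprod th P.1 * wprod thb P.2).

Lemma emorD a b : emor (a + b) = emor a + emor b.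
Proof.
by rewrite /emor -big_split; apply: eq_bigr => P _; rewrite coefD scalerDl.
Qed.

Lemma emorZ (k : R[i]) a : emor (k *: a) = k *: emor a.
Proof.
by rewrite /emor scaler_sumr; apply: eq_bigr => P _; rewrite coefZ scalerA.
Qed.

Lemma emor_sum (I : Type) (r : seq I) (F : I -> ext R m) :
  emor (\sum_(i <- r) F i) = \sum_(i <- r) emor (F i).
Proof.
elim: r => [|i r IH]; last by rewrite !big_cons emorD IH.
by rewrite !big_nil -[in LHS](scale0r (0 : ext R m)) emorZ scale0r.
Qed.

Lemma emor_mono P : emor (mono P) = wprod th P.1 * wprod thb P.2.
Proof.
rewrite /emor (bigD1 P) //= coef_mono eqxx scale1r big1 ?addr0 // => Q QP.
by rewrite coef_mono (negPf QP) scale0r.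
Qed.

Definition e_z j : ext R m := mono ([set j], finset.set0).
Definition e_zb j : ext R m := mono (finset.set0, [set j]).

Lemma e_z_mono j P : e_z j * mono P =
  ((j \notin P.1)%:R * (-1) ^+ inversions [set j] P.1) *: mono (j |: P.1, P.2).
Proof.
rewrite mono_mul /bsgn /bdisj /bexp /bcup /= -!setI_eq0 !finset.set0I eqxx andbT.
by rewrite setI_eq0 disjoints1 finset.set0U cards0 mul0n inversions0l !addn0.
Qed.

Lemma e_zb_mono j P : e_zb j * mono P =
  ((j \notin P.2)%:R * (-1) ^+ (inversions [set j] P.2 + #|P.1|)) *: mono (P.1, j |: P.2).
Proof.
rewrite mono_mul /bsgn /bdisj /bexp /bcup /= -!setI_eq0 !finset.set0I eqxx /=.
by rewrite setI_eq0 disjoints1 finset.set0U cards1 mul1n inversions0l.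
Qed.

(** Monomials are reached from [1] by left multiplication by generators, up to
    the sign of the insertion; [K] must therefore be stable under scaling. *)
Lemma mono_ind (K : ext R m -> Prop) :
    K 1 -> (forall k a, K a -> K (k *: a)) ->
    (forall j P, K (mono P) -> K (e_z j * mono P)) ->
    (forall j P, K (mono P) -> K (e_zb j * mono P)) ->
  forall P, K (mono P).
Proof.
move=> K1 KZ Kz Kzb [A B].
move: {2}(#|A|) (leqnn #|A|) => n; elim: n A => [|n IHn] A.
  rewrite leqn0 cards_eq0 => /eqP->.
  move: {2}(#|B|) (leqnn #|B|) => n; elim: n B => [|n IHn] B.
    by rewrite leqn0 cards_eq0 => /eqP->; apply: K1.
  case: (set_0Vmem B) => [-> _|[j jB] cB]; first exact: K1.
  have /Kzb : K (mono (finset.set0, B :\ j)).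
    by apply: IHn; rewrite (cardsD1 j) jB in cB.
  move=> /(_ j); rewrite e_zb_mono /= finset.setD1K // !inE eqxx /= mul1r.
  by move=> /(KZ ((-1) ^+ (inversions [set j] (B :\ j) + #|(finset.set0 : {set 'I_m})|)));
    rewrite scalerA -expr2 sqrr_sign scale1r.
case: (set_0Vmem A) => [-> _|[j jA] cA]; first by apply: IHn; rewrite cards0.
have /Kz : K (mono (A :\ j, B)) by apply: IHn; rewrite (cardsD1 j) jA in cA.
move=> /(_ j); rewrite e_z_mono /= finset.setD1K // !inE eqxx /= mul1r.
by move=> /(KZ ((-1) ^+ inversions [set j] (A :\ j))); rewrite scalerA -expr2 sqrr_sign scale1r.
Qed.

Hypothesis th_anti : anticommuting th.
Hypothesis thb_anti : anticommuting thb.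
Hypothesis th_thb : forall j k, thb j * th k = - (th k * thb j).

(** The sign for moving [thb j] past the factors of type (1,0), which is the term
    [#|P.1|] in [e_zb_mono]. *)
Lemma thb_wprod j A : thb j * wprod th A = ((-1) ^+ #|A| : R[i]) *: (wprod th A * thb j).
Proof.
set s := [seq k <- index_enum 'I_m | k \in A].
have -> : #|A| = size s by rewrite -sum1_card -sum1_size big_filter.
have -> : wprod th A = \prod_(k <- s) th k by rewrite big_filter.
elim: s => [|i s IH]; first by rewrite !big_nil mulr1 mul1r expr0 scale1r.
rewrite !big_cons mulrA th_thb mulNr -(mulrA (th i) (thb j)) IH exprS mulN1r scaleNr.
by rewrite -scalerAr !mulrA.
Qed.

Lemma emor_e_z j x : emor (e_z j * x) = th j * emor x.
Proof.
rewrite (ext_sum_mono x) mulr_sumr !emor_sum mulr_sumr; apply: eq_bigr => P _.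
rewrite -scalerAr !emorZ -scalerAr; congr (_ *: _).
by rewrite e_z_mono emorZ !emor_mono /= mulrA wprod_mul1 // -scalerAl.
Qed.

Lemma emor_e_zb j x : emor (e_zb j * x) = thb j * emor x.
Proof.
rewrite (ext_sum_mono x) mulr_sumr !emor_sum mulr_sumr; apply: eq_bigr => P _.
rewrite -scalerAr !emorZ -scalerAr; congr (_ *: _).
rewrite e_zb_mono emorZ !emor_mono /= mulrA thb_wprod -scalerAl -mulrA wprod_mul1 //.
by rewrite -scalerAr scalerA exprD mulrA mulrC.
Qed.

Lemma emor1 : emor 1 = 1.
Proof. by rewrite emor_mono /= !wprod0 mulr1. Qed.

(** Multiplicativity need only be checked against left multiplication by
    generators, where it is the reordering rule for ordered products. *)
Lemma emorM a b : emor (a * b) = emor a * emor b.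
Proof.
rewrite (ext_sum_mono a) mulr_suml !emor_sum mulr_suml; apply: eq_bigr => P _.
rewrite -scalerAl !emorZ -scalerAl; congr (_ *: _).
apply: (mono_ind (K := fun y => emor (y * b) = emor y * emor b)).
- by rewrite emor1 !mul1r.
- by move=> k y E; rewrite -scalerAl !emorZ E scalerAl.
- by move=> j Q E; rewrite -mulrA !emor_e_z E mulrA.
- by move=> j Q E; rewrite -mulrA !emor_e_zb E mulrA.
Qed.

Lemma emorX a n : emor (a ^+ n) = emor a ^+ n.
Proof. by elim: n => [|n IH]; rewrite ?emor1 // !exprS emorM IH. Qed.

Lemma emor_z j : emor (e_z j) = th j.
Proof. by rewrite -[e_z j]mulr1 emor_e_z emor1 mulr1. Qed.

Lemma emor_zb j : emor (e_zb j) = thb j.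
Proof. by rewrite -[e_zb j]mulr1 emor_e_zb emor1 mulr1. Qed.

End Morphism.
Arguments e_z {R m}.
Arguments e_zb {R m}.

(** * Bidegree and conjugation *)

Section Types.
Variables (R : realType) (m : nat).
Implicit Types (P Q U : bideg m) (A B : {set 'I_m}) (a b x : ext R m).

Lemma has_typeE p q a :
  has_type p q (a : extalg R m) <-> forall P, coef P a != 0 -> #|P.1| = p /\ #|P.2| = q.
Proof. by split=> [H [A B]|H A B]; [apply: H|apply: (H (A, B))]. Qed.

Lemma has_type_mono P : has_type #|P.1| #|P.2| (mono P : ext R m).
Proof.
by apply/has_typeE => Q; rewrite coef_mono; case: (Q =P P) => [->|_] //; rewrite eqxx.
Qed.
Arguments has_type_mono : clear implicits.

Lemma has_typeZ p q k a : has_type p q a -> has_type p q (k *: a : ext R m).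
Proof.
move=> /has_typeE H; apply/has_typeE => P; rewrite coefZ => nz; apply: H.
by apply: contraNneq nz => ->; rewrite mulr0.
Qed.

Lemma has_type_sum p q (I : Type) (r : seq I) (D : pred I) (F : I -> ext R m) :
  (forall i, D i -> has_type p q (F i)) -> has_type p q (\sum_(i <- r | D i) F i : ext R m).
Proof.
move=> H; apply/has_typeE => P; rewrite coef_sum => nz.
have [[i [Di nzi]]|none] := pselect (exists i, D i /\ coef P (F i) != 0).
  by have /has_typeE := H i Di; apply.
rewrite big1 ?eqxx // in nz => i Di.
by apply: contrapT => /eqP nzi; apply: none; exists i.
Qed.

Lemma has_typeM p q p' q' a b : has_type p q a -> has_type p' q' b ->
  has_type (p + p') (q + q') (a * b : ext R m).
Proof.
rewrite (ext_sum_mono a) (ext_sum_mono b) mulr_suml => /has_typeE Ha /has_typeE Hb.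
rewrite -(ext_sum_mono a) in Ha; rewrite -(ext_sum_mono b) in Hb.
apply: has_type_sum => P _; rewrite mulr_sumr; apply: has_type_sum => Q _.
rewrite -scalerAl -scalerAr mono_mul.
have [->|nzP] := eqVneq (coef P a) 0; first by rewrite scale0r => ? ?; rewrite !ffunE eqxx.
have [->|nzQ] := eqVneq (coef Q b) 0.
  by rewrite scale0r scaler0 => ? ?; rewrite !ffunE eqxx.
have [<- <-] := Ha _ nzP; have [<- <-] := Hb _ nzQ.
rewrite /bsgn; case: (boolP (bdisj P Q)) => [/andP[d1 d2]|_].
  by do 3!apply: has_typeZ; rewrite -!cardsU_disjoint //; apply: has_type_mono (bcup P Q).
by rewrite mul0r scale0r !scaler0 => ? ?; rewrite !ffunE eqxx.
Qed.

Lemma has_type1 : has_type 0 0 (1 : ext R m).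
Proof. by have := has_type_mono (finset.set0, finset.set0); rewrite /= !cards0. Qed.

Lemma has_typeX p q a n : has_type p q a -> has_type (n * p) (n * q) (a ^+ n : ext R m).
Proof.
move=> Ha; elim: n => [|n IH]; first exact: has_type1.
by rewrite exprS !mulSn; apply: has_typeM.
Qed.

(** A form lives on a single monomial when its bidegree admits only one. *)
Lemma has_type_unique p q P a :
    has_type p q a -> (forall Q, #|Q.1| = p -> #|Q.2| = q -> Q = P) ->
  a = coef P a *: mono P.
Proof.
move=> /has_typeE Ha uP; apply: extP => Q; rewrite coefZ coef_mono.
case: (eqVneq Q P) => [->|QP]; first by rewrite mulr1.
rewrite mulr0; apply: contraNeq QP => nz; apply/eqP.
by have [] := Ha _ nz; apply: uP.
Qed.

(** [bhol], [bahol] and [btop] index [dz^1 /\ ... /\ dz^m], its conjugate, and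
    their product in this order. *)
Definition btop : bideg m := (finset.setT, finset.setT).
Definition bhol : bideg m := (finset.setT, finset.set0).
Definition bahol : bideg m := (finset.set0, finset.setT).
Definition top a : R[i] := coef btop a.

Lemma card_full A : #|A| = m -> A = finset.setT.
Proof. by move=> cA; apply/eqP; rewrite finset.eqEcard finset.subsetT cardsT card_ord cA /=. Qed.

Lemma has_type_top a : has_type m m a -> a = top a *: mono btop.
Proof. by move=> Ha; apply: has_type_unique Ha _ => -[A B] /= /card_full -> /card_full ->. Qed.

Lemma has_type_hol a : has_type m 0 a -> a = coef bhol a *: mono bhol.
Proof.
move=> Ha; apply: has_type_unique Ha _ => -[A B] /= /card_full -> /eqP.
by rewrite cards_eq0 => /eqP ->.
Qed.

Lemma has_type_z j : has_type 1 0 (e_z j : ext R m).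
Proof. by have := has_type_mono ([set j], finset.set0); rewrite /= cards1 cards0. Qed.

Lemma has_type_zb j : has_type 0 1 (e_zb j : ext R m).
Proof. by have := has_type_mono (finset.set0, [set j]); rewrite /= cards1 cards0. Qed.

Lemma has_type_wprod p q (th : 'I_m -> ext R m) A :
  (forall j, has_type p q (th j)) -> has_type (#|A| * p) (#|A| * q) (wprod th A).
Proof.
move=> H; rewrite /wprod -sum1_card.
apply: (big_rec2 (fun n x => has_type (n * p) (n * q) (x : ext R m))).
  exact: has_type1.
by move=> i n x _ Hx; rewrite !mulnDl !mul1n; apply: has_typeM.
Qed.

Lemma topD a b : top (a + b) = top a + top b. Proof. exact: coefD. Qed.
Lemma topZ k a : top (k *: a) = k * top a. Proof. exact: coefZ. Qed.
Lemma top_sum (I : Type) (r : seq I) (D : pred I) (F : I -> ext R m) :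
  top (\sum_(i <- r | D i) F i) = \sum_(i <- r | D i) top (F i).
Proof. exact: coef_sum. Qed.

End Types.
Arguments btop {m}.
Arguments bhol {m}.
Arguments bahol {m}.

Section Conjugation.
Variables (R : realType) (m : nat).
Implicit Types (P Q : bideg m) (a b : ext R m).

Definition cj a : ext R m := conjform (a : extalg R m).
Definition bswap P : bideg m := (P.2, P.1).

Lemma coef_cj P a : coef P (cj a) = (-1) ^+ (#|P.1| * #|P.2|) * (coef (bswap P) a)^*%C.
Proof. by rewrite /coef /cj ffunE. Qed.

Lemma cjD a b : cj (a + b) = cj a + cj b.
Proof. by apply: extP => P; rewrite coefD !coef_cj coefD rmorphD mulrDr. Qed.

Lemma cjZ k a : cj (k *: a) = k^*%C *: cj a.
Proof. by apply: extP => P; rewrite coefZ !coef_cj coefZ rmorphM mulrCA. Qed.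

Lemma cj_sum (I : Type) (r : seq I) (F : I -> ext R m) :
  cj (\sum_(i <- r) F i) = \sum_(i <- r) cj (F i).
Proof.
elim: r => [|i r IH]; last by rewrite !big_cons cjD IH.
by rewrite !big_nil -[in LHS](scale0r (0 : ext R m)) cjZ rmorph0 scale0r.
Qed.

Lemma cj_mono P : cj (mono P) = ((-1) ^+ (#|P.1| * #|P.2|) : R[i]) *: mono (bswap P).
Proof.
apply: extP => Q; rewrite coef_cj coefZ !coef_mono.
have -> : (bswap Q == P) = (Q == bswap P) by case: P Q => [A B] [A' B']; rewrite /bswap -!pair_eqE /pair_eq /= andbC.
case: (Q =P _) => [->|_]; last by rewrite rmorph0 !mulr0.
by rewrite rmorph1 mulnC.
Qed.

(** The sign in the definition of conjugation is the one of moving [dzbar^B] past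
    [dz^A]; both sides differ from the naive product by the same parity. *)
Lemma cjM a b : cj (a * b) = cj a * cj b.
Proof.
rewrite (ext_sum_mono a) mulr_suml !cj_sum mulr_suml; apply: eq_bigr => P _.
rewrite -scalerAl !cjZ -scalerAl; congr (_ *: _).
rewrite (ext_sum_mono b) mulr_sumr !cj_sum mulr_sumr; apply: eq_bigr => Q _.
rewrite -scalerAr !cjZ -scalerAr; congr (_ *: _).
rewrite mono_mul cjZ !cj_mono -scalerAl -scalerAr mono_mul !scalerA; congr (_ *: _).
case: P Q => [A B] [A' B']; rewrite /bsgn /bdisj /bexp /bcup /bswap /= andbC.
rewrite rmorphM rmorph_nat rmorphXn rmorphN1.
case dB : [disjoint B & B']; last by rewrite /= !(mul0r, mulr0).
case dA : [disjoint A & A']; last by rewrite /= !(mul0r, mulr0).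
rewrite /= !mul1r -!exprD !cardsU_disjoint // -signr_odd -[RHS]signr_odd; congr (_ ^+ _).
by rewrite !mulnDl !mulnDr !oddD !oddM; do ! (case: (odd _) => //).
Qed.

Lemma cj_z j : cj (e_z j : ext R m) = e_zb j.
Proof. by rewrite cj_mono /= cards0 muln0 expr0 scale1r. Qed.

Lemma cj_zb j : cj (e_zb j : ext R m) = e_z j.
Proof. by rewrite cj_mono /= cards0 mul0n expr0 scale1r. Qed.

Lemma cj1 : cj (1 : ext R m) = 1.
Proof. by rewrite cj_mono /= cards0 mul0n expr0 scale1r. Qed.

End Conjugation.

Section LinearSubstitutions.
Variables (R : realType) (m : nat).
Implicit Types (J K G : 'M[R[i]]_m) (a b : ext R m) (A : {set 'I_m}).

Lemma z_anti : anticommuting (@e_z R m).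
Proof.
move=> j k; rewrite !e_z_mono /= !inE (eq_sym k) finset.setUC.
case: eqVneq => [->|jk] /=; first by rewrite mul0r scale0r oppr0.
have := @inversionsC _ [set j] [set k]; rewrite disjoints1 inE jk !cards1 => /(_ isT).
rewrite !mul1r -scaleNr; case: (inversions [set j] _) => [|[|?]]; rewrite ?addSn ?add0n.
- by move=> ->; rewrite expr1 opprK.
- by move=> [] ->; rewrite expr1 expr0.
- by [].
Qed.

Lemma zb_z j k : (e_zb j : ext R m) * e_z k = - (e_z k * e_zb j).
Proof.
rewrite e_zb_mono e_z_mono /= !inE /= !inversions0r cards1 !finset.setU0 !mul1r.
by rewrite scale1r expr1 scaleN1r.
Qed.

Lemma zb_anti : anticommuting (@e_zb R m).
Proof. by move=> j k; rewrite -!cj_z -!cjM z_anti -scaleN1r cjZ rmorphN1 scaleN1r. Qed.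

Definition lin_z J k : ext R m := \sum_j J k j *: e_z j.
Definition lin_zb K k : ext R m := \sum_j K k j *: e_zb j.

Lemma lin_anti (f g : 'I_m -> ext R m) (c d : 'I_m -> R[i]) :
    (forall j k, f j * g k = - (g k * f j)) ->
  (\sum_j c j *: f j) * (\sum_k d k *: g k) = - ((\sum_k d k *: g k) * (\sum_j c j *: f j)).
Proof.
move=> fg; rewrite mulr_suml [in RHS]mulr_sumr -sumrN; apply: eq_bigr => j _.
rewrite mulr_sumr mulr_suml -sumrN; apply: eq_bigr => k _.
by rewrite -!scalerAl -!scalerAr fg !scalerN !scalerA mulrC.
Qed.

End LinearSubstitutions.

(** * Linear substitutions and powers of (1,1)-forms *)

Section Substitution.
Variables (R : realType) (m : nat).
Implicit Types (J K G : 'M[R[i]]_m) (a b x : ext R m) (A : {set 'I_m}).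

Lemma lin_z_anti J : anticommuting (lin_z J).
Proof. by move=> j k; apply: lin_anti => ? ?; apply: z_anti. Qed.

Lemma lin_zb_anti K : anticommuting (lin_zb K).
Proof. by move=> j k; apply: lin_anti => ? ?; apply: zb_anti. Qed.

Lemma lin_zb_z J K j k : lin_zb K j * lin_z J k = - (lin_z J k * lin_zb K j).
Proof. by apply: lin_anti => ? ?; apply: zb_z. Qed.

(** [J] and [K] are independent: pullback is the case where [K] is the conjugate
    of [J], while [K = 1] is what moves an arbitrary invertible matrix to the
    standard one. *)
Definition subst J K a : ext R m := emor (lin_z J) (lin_zb K) a.

Lemma substZ J K (k : R[i]) a : subst J K (k *: a) = k *: subst J K a.
Proof. exact: emorZ. Qed.

Lemma subst_sum J K (I : Type) (r : seq I) (F : I -> ext R m) :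
  subst J K (\sum_(i <- r) F i) = \sum_(i <- r) subst J K (F i).
Proof. exact: emor_sum. Qed.

Lemma substM J K a b : subst J K (a * b) = subst J K a * subst J K b.
Proof. exact: emorM (lin_z_anti J) (lin_zb_anti K) (@lin_zb_z J K) a b. Qed.

Lemma substX J K a n : subst J K (a ^+ n) = subst J K a ^+ n.
Proof. exact: emorX (lin_z_anti J) (lin_zb_anti K) (@lin_zb_z J K) a n. Qed.

Lemma subst_z J K j : subst J K (e_z j) = lin_z J j.
Proof. exact: emor_z (lin_z_anti J) j. Qed.

Lemma subst_zb J K j : subst J K (e_zb j) = lin_zb K j.
Proof. exact: emor_zb (lin_zb_anti K) (@lin_zb_z J K) j. Qed.

Lemma lin_zb1 k : lin_zb (1%:M : 'M[R[i]]_m) k = e_zb k.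
Proof.
rewrite /lin_zb (bigD1 k) //= big1 ?addr0; first by rewrite mxE eqxx scale1r.
by move=> j jk; rewrite mxE eq_sym (negPf jk) scale0r.
Qed.

Lemma lin_z1 k : lin_z (1%:M : 'M[R[i]]_m) k = e_z k.
Proof.
rewrite /lin_z (bigD1 k) //= big1 ?addr0; first by rewrite mxE eqxx scale1r.
by move=> j jk; rewrite mxE eq_sym (negPf jk) scale0r.
Qed.

Lemma subst_lin_z J J' K k : subst J K (lin_z J' k) = lin_z (J' *m J) k.
Proof.
rewrite subst_sum; under eq_bigr do rewrite substZ subst_z scaler_sumr.
rewrite exchange_big /=; apply: eq_bigr => l _; rewrite mxE scaler_suml.
by apply: eq_bigr => j _; rewrite scalerA.
Qed.

Lemma has_type_lin_z J k : has_type 1 0 (lin_z J k).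
Proof. by apply: has_type_sum => j _; apply/has_typeZ/has_type_z. Qed.

Definition subst_det J K : R[i] := top (subst J K (mono btop)).

(** Forms of top degree are a line, so a substitution acts on them by a scalar;
    its value ([det J * det K]) never has to be computed. *)
Lemma top_subst J K a : has_type m m a -> top (subst J K a) = top a * subst_det J K.
Proof. by move=> /has_type_top {1}->; rewrite substZ topZ. Qed.

(** Rows of [G] carry the conjugate index, as in [metric_mx]. *)
Definition form11 G : ext R m := \sum_k \sum_j ('i * G k j) *: (e_z j * e_zb k).

Lemma e_z_zb j k : (e_z j : ext R m) * e_zb k = mono ([set j], [set k]).
Proof.
by rewrite e_z_mono /= inE inversions0r finset.setU0 mulr1 scale1r.
Qed.

Lemma metric_form11 a : has_type 1 1 a -> a = form11 (metric_mx (a : extalg R m)).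
Proof.
move=> /has_typeE Ha; apply: extP => -[A B]; rewrite /form11 coef_sum.
under eq_bigr do rewrite coef_sum.
have [[/eqP/cards1P[j ->] /eqP/cards1P[k ->]]|nAB] := pselect (#|A| = 1%N /\ #|B| = 1%N).
  rewrite (bigD1 k) //= (bigD1 j) //= e_z_zb coefZ coef_mono eqxx mulr1 mxE.
  rewrite mulrA mulrN -expr2 sqr_i opprK mul1r -/(coef _ _) big1 ?addr0; last first.
    by move=> j' jj; rewrite e_z_zb coefZ coef_mono xpair_eqE (inj_eq set1_inj) eq_sym (negPf jj) mulr0.
  rewrite big1 ?addr0 // => k' kk; rewrite big1 // => j' _.
  by rewrite e_z_zb coefZ coef_mono xpair_eqE !(inj_eq set1_inj) (eq_sym k) (negPf kk) andbF mulr0.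
have -> : coef (A, B) a = 0 by apply: contrapT => /eqP /Ha.
rewrite big1 // => k _; rewrite big1 // => j _; rewrite e_z_zb coefZ coef_mono.
case: eqP => [[-> ->]|_] in nAB *; last by rewrite mulr0.
by case: nAB; rewrite !cards1.
Qed.

Lemma has_type_form11 G : has_type 1 1 (form11 G).
Proof.
apply: has_type_sum => k _; apply: has_type_sum => j _; apply: has_typeZ.
by apply: (@has_typeM R m 1 0 0 1); [apply: has_type_z|apply: has_type_zb].
Qed.

(** Change of frame for a sesquilinear form. *)
Lemma subst_form11 J K : subst J K (form11 1%:M) = form11 (K^T *m J).
Proof.
have -> : form11 1%:M = \sum_k 'i *: (e_z k * e_zb k) :> ext R m.
  apply: eq_bigr => k _; rewrite (bigD1 k) //= big1 ?addr0; first by rewrite mxE eqxx mulr1.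
  by move=> j jk; rewrite mxE eq_sym (negPf jk) mulr0 scale0r.
rewrite subst_sum.
under eq_bigr => k _.
  rewrite substZ substM subst_z subst_zb.
  rewrite mulr_sumr scaler_sumr.
  under eq_bigr => l _ do rewrite mulr_suml scaler_sumr.
  over.
rewrite exchange_big /=; apply: eq_bigr => l _.
rewrite exchange_big /=; apply: eq_bigr => j _.
rewrite mxE mulr_sumr scaler_suml; apply: eq_bigr => k _.
by rewrite mxE -scalerAl -scalerAr !scalerA mulrA mulrAC.
Qed.

(** ** Powers of the standard form *)

Lemma diag_mono j A : mono ([set j], [set j]) * mono (A, A) =
  ((j \notin A)%:R * (-1) ^+ #|A|) *: mono (j |: A, j |: A) :> ext R m.
Proof.
rewrite mono_mul /bsgn /bdisj /bexp /= disjoints1 andbb cards1 mul1n; congr (_ *: _).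
by rewrite exprD addnn -muln2 exprM sqrr_sign mul1r.
Qed.

(** The exponent ['C(n, 2)] counts the transpositions that turn
    [dz^{a_1} /\ dzbar^{a_1} /\ ... /\ dz^{a_n} /\ dzbar^{a_n}] into
    [dz^A /\ dzbar^A], and [n!] counts the orderings of [A]. *)
Definition std_coef n : R[i] := 'i ^+ n * n`!%:R * (-1) ^+ 'C(n, 2).

Lemma std_coefS n : std_coef n.+1 = 'i * n.+1%:R * (-1) ^+ n * std_coef n.
Proof.
rewrite /std_coef exprS factS natrM binS bin1 exprD.
have H (a b c d e f : R[i]) : a * b * (c * d) * (e * f) = a * c * f * (b * d * e) by ring.
exact: H.
Qed.

(** By induction on the exponent: each [B] with [n+1] elements arises from
    [j |: A] in [n+1] ways, all with the same sign. *)
Lemma std_form_pow n :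
  form11 1%:M ^+ n = std_coef n *: \sum_(A : {set 'I_m} | #|A| == n) mono (A, A) :> ext R m.
Proof.
have -> : form11 1%:M = 'i *: \sum_j mono ([set j], [set j]) :> ext R m.
  rewrite scaler_sumr; apply: eq_bigr => k _.
  rewrite (bigD1 k) //= big1 ?addr0; first by rewrite mxE eqxx mulr1 e_z_zb.
  by move=> j jk; rewrite mxE eq_sym (negPf jk) mulr0 scale0r.
elim: n => [|n IH].
  rewrite expr0 (big_pred1 finset.set0) => [|A]; last by rewrite cards_eq0.
  by rewrite /std_coef !expr0 !mulr1 scale1r.
rewrite exprS IH std_coefS -scalerAl -scalerAr scalerA mulr_suml.
have -> : \sum_j mono ([set j], [set j]) * \sum_(A : {set 'I_m} | #|A| == n) mono (A, A) =
    (n.+1%:R * (-1) ^+ n : R[i]) *: \sum_(A : {set 'I_m} | #|A| == n.+1) mono (A, A) :> ext R m.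
  transitivity (\sum_j \sum_(B : {set 'I_m} | (#|B| == n.+1) && (j \in B))
      (-1) ^+ n *: (mono (B, B) : ext R m)).
    apply: eq_bigr => j _; rewrite mulr_sumr.
    under eq_bigr do rewrite diag_mono.
    rewrite (bigID (fun A : {set 'I_m} => j \in A)) /= big1 ?add0r; last first.
      by move=> A /andP[_ ->]; rewrite mul0r scale0r.
    rewrite [RHS](reindex_onto (fun A : {set 'I_m} => j |: A) (fun B => B :\ j)) /=.
      rewrite [RHS](eq_bigl (fun A : {set 'I_m} => (#|A| == n) && (j \notin A))).
        by apply: eq_bigr => A /andP[/eqP-> ->]; rewrite mul1r.
      move=> A; rewrite finset.setU11 andbT cardsU1; case: (boolP (j \in A)) => jA /=.
        rewrite andbF; apply/andP => -[_ /eqP E]; move: jA.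
        by rewrite -E !inE eqxx.
      by rewrite finset.setU1K // eqxx !andbT add1n eqSS.
    by move=> B /andP[_ jB]; rewrite finset.setD1K.
  rewrite (exchange_big_dep (fun B : {set 'I_m} => #|B| == n.+1)) /= ?scaler_sumr => [|? ? _ /andP[]//].
  under eq_bigr => B /eqP cB.
    rewrite (eq_bigl (fun j => j \in B)); last by move=> j; rewrite cB eqxx.
    rewrite sumr_const cB -scaler_nat scalerA.
    over.
  by [].
have H (a b c d : R[i]) : a * b * (c * d) = a * c * d * b by ring.
by rewrite scalerA; congr (_ *: _); apply: H.
Qed.

End Substitution.

(** * Complementary minors *)

Section Minors.
Variables (R : realType) (m : nat).
Implicit Types (J K G P : 'M[R[i]]_m) (x : ext R m) (A B : {set 'I_m}).
Implicit Types a b c d p q j k : 'I_m.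

(** Only the complementary diagonal monomial contributes to the top degree. *)
Lemma top_mul_diag A B n :
  top (mono (A, B) * \sum_(D : {set 'I_m} | #|D| == n) mono (D, D) : ext R m) =
  (((A == B) && (#|~: A| == n))%:R * (-1) ^+ (#|A| * n)) :> R[i].
Proof.
rewrite mulr_sumr top_sum.
under eq_bigr => D _ do rewrite mono_mul topZ /top coef_mono /bcup /btop xpair_eqE /=.
have compl (C D : {set 'I_m}) : [disjoint C & D] -> (finset.setT == C :|: D) = (D == ~: C).
  move=> dCD; apply/eqP/eqP => [E|->]; last by rewrite finset.setUCr.
  apply/finset.setP => i; have := congr1 (fun S : {set 'I_m} => i \in S) E.
  by rewrite /= !inE; case: (boolP (i \in C)) => //= iC _; rewrite (disjointFr dCD iC).
case: (boolP ((A == B) && (#|~: A| == n))) => [/andP[/eqP<- cA]|nAB].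
  rewrite (bigD1 (~: A)) //= big1 ?addr0 => [|D /andP[_ DA]].
    have dA : [disjoint A & ~: A] by rewrite -setI_eq0 finset.setICr.
    rewrite finset.setUCr eqxx mulr1 /bsgn /bdisj /bexp /= dA /= !mul1r (eqP cA).
    by rewrite exprD addnn -muln2 exprM sqrr_sign mul1r.
  rewrite /bsgn /bdisj /=; case: (boolP [disjoint A & D]) => dA; last by rewrite !mul0r.
  by rewrite compl // (negPf DA) mulr0.
rewrite mul0r big1 // => D /eqP cD; rewrite /bsgn /bdisj /=.
case: (boolP [disjoint A & D]) => dA; last by rewrite !mul0r.
case: (boolP [disjoint B & D]) => dB; last by rewrite !mul0r.
rewrite !compl //; case: eqP => [DA|_]; last by rewrite mulr0.
case: eqP => [DB|_]; last by rewrite mulr0.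
by case/negP: nAB; rewrite -(inj_eq (@finset.setC_inj _)) -DA -DB eqxx cD eqxx.
Qed.

Lemma top_std_pow : top (form11 1%:M ^+ m : ext R m) = std_coef R m.
Proof.
rewrite std_form_pow topZ -[X in top X]mul1r (top_mul_diag finset.set0 finset.set0).
by rewrite finset.setC0 cardsT card_ord !eqxx cards0 mul0n !mulr1.
Qed.

Lemma top_std_pow1 c b : (0 < m)%N ->
  ('i * m%:R) * top (e_z c * e_zb b * form11 1%:M ^+ (m - 1) : ext R m)
  = (c == b)%:R * std_coef R m.
Proof.
move=> m0; rewrite std_form_pow -scalerAr topZ e_z_zb top_mul_diag cards1 mul1n.
rewrite (inj_eq set1_inj) cardsC1 card_ord subn1 eqxx andbT.
have := std_coefS R m.-1; rewrite prednK // => ->.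
have H (x y z t : R[i]) : x * (y * (z * t)) = z * (x * t * y) by ring.
exact: H.
Qed.

Lemma top_scale2 (k l : R[i]) x (y : ext R m) :
  top (k *: x * (l *: y)) = k * (l * top (x * y)).
Proof. by rewrite -scalerAl -scalerAr !topZ. Qed.

Lemma std_coef2 : (1 < m)%N -> std_coef R m = m%:R * (m - 1)%:R * std_coef R (m - 2).
Proof.
move=> m1; have -> : m = (m - 2).+2 by lia.
set n := (m - 2)%N; have -> : (n.+2 - 2 = n)%N by lia. have -> : (n.+2 - 1 = n.+1)%N by lia.
rewrite !std_coefS exprS.
have H (x y z t u : R[i]) : x * x = -1 -> t * t = 1 ->
   x * y * (-1 * t) * (x * z * t * u) = y * z * u.
  move=> xx tt; transitivity (- (x * x) * (t * t) * (y * z * u)); first by ring.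
  by rewrite xx tt opprK !mul1r.
by apply: H; rewrite -expr2 ?sqr_i ?sqrr_sign.
Qed.

Lemma e_z_zb2 a b p q : a != p -> b != q ->
  (e_z a * e_zb b * (e_z p * e_zb q) : ext R m) =
  (((-1) ^+ (inversions [set a] [set p] + inversions [set b] [set q] + 1)) : R[i])
    *: mono ([set a; p], [set b; q]).
Proof.
move=> ap bq; rewrite !e_z_zb mono_mul /bsgn /bdisj /bexp /= !disjoints1 !inE.
by rewrite (negPf ap) (negPf bq) !cards1 mul1r.
Qed.

Lemma top_std_pow2 a b p q : (1 < m)%N ->
  m%:R * (m - 1)%:R * top (e_z a * e_zb b * (e_z p * e_zb q) * form11 1%:M ^+ (m - 2) : ext R m)
  = - (((a == b) && (p == q))%:R - ((a == q) && (p == b))%:R) * std_coef R m.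
Proof.
move=> m1.
have [<-|ap] := eqVneq a p.
  have -> : e_z a * e_zb b * (e_z a * e_zb q) = 0 :> ext R m.
    rewrite -mulrA (mulrA (e_zb b)) zb_z mulNr mulrN 2!(mulrA (e_z a)).
    by rewrite (anticommuting_sqr (@z_anti R m)) !mul0r oppr0.
  by rewrite mul0r /top coef0 mulr0 andbC subrr oppr0 mul0r.
have [<-|bq] := eqVneq b q.
  have -> : e_z a * e_zb b * (e_z p * e_zb b) = 0 :> ext R m.
    rewrite -mulrA (mulrA (e_zb b)) zb_z mulNr -(mulrA (e_z p)).
    by rewrite (anticommuting_sqr (@zb_anti R m)) mulr0 oppr0 mulr0.
  by rewrite mul0r /top coef0 mulr0 subrr oppr0 mul0r.
rewrite e_z_zb2 // std_form_pow top_scale2 top_mul_diag std_coef2 //.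
rewrite cards2 ap /= (_ : #|~: [set a; p]| = (m - 2)%N); last first.
  by have := finset.cardsC [set a; p]; rewrite cards2 ap card_ord /= => E; apply: (@addnI 2); rewrite E subnKC.
rewrite eqxx andbT exprM sqrrN expr1n expr1n.
have -> : [set a; p] == [set b; q] = (a == b) && (p == q) || (a == q) && (p == b).
  apply/eqP/orP => [E|[/andP[/eqP-> /eqP->] //|/andP[/eqP-> /eqP->]]]; last first.
    by rewrite finset.setUC.
  have := congr1 (fun S : {set 'I_m} => a \in S) E; rewrite /= !inE eqxx /=.
  have := congr1 (fun S : {set 'I_m} => p \in S) E; rewrite /= !inE eqxx orbT.
  move=> /esym/orP[]/eqP pE /esym/orP[]/eqP aE.
  - by rewrite aE pE eqxx in ap.
  - by right; rewrite aE pE !eqxx.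
  - by left; rewrite aE pE !eqxx.
  - by rewrite aE pE eqxx in ap.
have invC : (inversions [set a] [set p] + inversions [set p] [set a] = 1)%N.
  by rewrite inversionsC ?cards1 // disjoints1 inE.
have [<-|ab] /= := eqVneq a b.
  have -> : (p == a) = false by rewrite eq_sym (negPf ap).
  rewrite andbF orbF subr0; have [<-|pq] /= := eqVneq p q; last first.
    by rewrite oppr0 !(mul0r, mulr0).
  rewrite addnn -muln2 exprD exprM sqrr_sign expr1.
  by rewrite mul1r !mulr1 !mulN1r mulrN.
rewrite sub0r opprK; have [<-|aq] /= := eqVneq a q; last by rewrite !(mul0r, mulr0).
have [<-|pb] /= := eqVneq p b; last by rewrite !(mul0r, mulr0).
rewrite invC -signr_odd /= expr0.
by rewrite !mul1r !mulr1.
Qed.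

End Minors.

Section Metrics.
Variables (R : realType) (m : nat).
Implicit Types (J K G P : 'M[R[i]]_m) (x : ext R m) (A B : {set 'I_m}).
Implicit Types a b c d p q j k : 'I_m.

Lemma has_typeMe (u v u' v' s t : nat) x (y : ext R m) : has_type u v x -> has_type u' v' y ->
  (u + u')%N = s -> (v + v')%N = t -> has_type s t (x * y).
Proof. by move=> Hx Hy <- <-; apply: has_typeM. Qed.

Lemma has_type_z_zb (c : 'I_m -> R[i]) b : has_type 1 1 ((\sum_j c j *: e_z j) * e_zb b : ext R m).
Proof.
refine (@has_typeMe 1 0 0 1 1 1 _ _ _ _ erefl erefl); last exact: has_type_zb.
by apply: has_type_sum => j _; apply/has_typeZ/has_type_z.
Qed.

Lemma form11_subst G : form11 G = subst G 1%:M (form11 1%:M).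
Proof. by rewrite subst_form11 trmx1 mul1mx. Qed.

Lemma has_type_form11X G n : has_type n n (form11 G ^+ n).
Proof. by have := @has_typeX R m 1 1 _ n (@has_type_form11 R m G); rewrite muln1. Qed.

Lemma top_pow G : top (form11 G ^+ m) = std_coef R m * subst_det G 1%:M.
Proof.
by rewrite form11_subst -substX top_subst ?top_std_pow //; apply: has_type_form11X.
Qed.

Lemma e_z_subst G a : G \in unitmx ->
  e_z a = subst G 1%:M (\sum_c invmx G a c *: e_z c).
Proof.
move=> uG; rewrite -/(lin_z (invmx G) a) subst_lin_z mulVmx //.
by rewrite lin_z1.
Qed.

Lemma e_zb_subst G b : e_zb b = subst G 1%:M (e_zb b).
Proof. by rewrite subst_zb lin_zb1. Qed.

Lemma topZ2 (k : R[i]) x (y : ext R m) : top (k *: x * y) = k * top (x * y).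
Proof. by rewrite -scalerAl topZ. Qed.

Lemma topZ3 (k : R[i]) x (y z : ext R m) : top (k *: x * y * z) = k * top (x * y * z).
Proof. by rewrite -!scalerAl topZ. Qed.

(** The coefficients of [form11 G ^+ (m-1)] are the cofactors of [G].  The
    substitution [dz := G dz] carries the standard form to [form11 G] and
    [sum_c G^-1 a c dz^c] to [dz^a], so the identity reduces to the standard form;
    the determinant of the substitution appears on both sides. *)
Lemma top_pow1 G a b : (0 < m)%N -> G \in unitmx ->
  ('i * m%:R) * top (e_z a * e_zb b * form11 G ^+ (m - 1)) =
  invmx G a b * top (form11 G ^+ m).
Proof.
move=> m0 uG; rewrite top_pow (e_z_subst a uG) (e_zb_subst G b) form11_subst -substX -!substM.
rewrite top_subst; last first.
  by refine (has_typeMe (@has_type_z_zb _ b) (@has_type_form11X _ _) _ _); rewrite subnKC.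
rewrite !mulr_suml top_sum mulrA mulr_sumr (bigD1 b) //= big1 ?addr0 => [|c cb].
  rewrite topZ3 [in LHS]mulrCA top_std_pow1 // eqxx mul1r.
  by rewrite -mulrA.
by rewrite topZ3 [in LHS]mulrCA top_std_pow1 // (negPf cb) mul0r mulr0.
Qed.

(** Jacobi's complementary minor identity in codimension two, by the same change
    of frame as [top_pow1]. *)
Lemma top_pow2 G a b p q : (1 < m)%N -> G \in unitmx ->
  m%:R * (m - 1)%:R * top (e_z a * e_zb b * (e_z p * e_zb q) * form11 G ^+ (m - 2)) =
  - (invmx G a b * invmx G p q - invmx G a q * invmx G p b) * top (form11 G ^+ m).
Proof.
move=> m1 uG; rewrite top_pow (e_z_subst a uG) (e_z_subst p uG).
rewrite (e_zb_subst G b) (e_zb_subst G q) form11_subst -substX -!substM.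
rewrite top_subst; last first.
  have H2 := @has_typeM _ _ _ _ _ _ _ _ (@has_type_z_zb (invmx G a) b) (@has_type_z_zb (invmx G p) q).
  by refine (has_typeMe H2 (@has_type_form11X _ _) _ _); rewrite subnKC.
rewrite [LHS]mulrA [RHS]mulrA; congr (_ * _).
set H := invmx G.
transitivity (\sum_c \sum_d (H a c * H p d) *
    - (((c == b) && (d == q))%:R - ((c == q) && (d == b))%:R) * std_coef R m).
  rewrite !mulr_suml top_sum mulr_sumr; apply: eq_bigr => c _.
  rewrite !(mulr_suml, mulr_sumr) top_sum mulr_sumr; apply: eq_bigr => d _.
  rewrite -[RHS]mulrA -top_std_pow2 //.
  have H2 (u v : R[i]) (x y z w : ext R m) : u *: x * y * (v *: z * w) = (u * v) *: (x * y * (z * w)).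
    by rewrite -!(scalerAl, scalerAr) scalerA.
  by rewrite H2 topZ2 mulrCA.
under eq_bigr do rewrite -mulr_suml.
rewrite -mulr_suml; congr (_ * _).
transitivity (- (\sum_c \sum_d (H a c * H p d) * ((c == b) && (d == q))%:R -
   \sum_c \sum_d (H a c * H p d) * ((c == q) && (d == b))%:R)).
  rewrite -sumrB -sumrN; apply: eq_bigr => c _; rewrite -sumrB -sumrN; apply: eq_bigr => d _.
  by rewrite mulrN mulrBr.
have pick c' d' : \sum_c \sum_d (H a c * H p d) * ((c == c') && (d == d'))%:R = H a c' * H p d'.
  rewrite (bigD1 c') //= [X in _ + X]big1 ?addr0 => [|c cc]; last first.
    by rewrite big1 // => d _; rewrite (negPf cc) mulr0.
  rewrite (bigD1 d') //= [X in _ + X]big1 ?addr0 => [|d dd]; last by rewrite (negPf dd) andbF mulr0.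
  by rewrite !eqxx mulr1.
by rewrite !pick; ring.
Qed.

(** ** Positivity *)

(** By the spectral theorem [G = U^* D U] with [D] positive, and [P] is
    [sqrt D * U]. *)
Lemma hermitian_factor G :
    (forall k j, G k j = (G j k)^*%C) ->
    (forall v : 'I_m -> R[i], (exists j, v j != 0) ->
        0 < \sum_k \sum_j G k j * v j * (v k)^*%C) ->
  exists2 P, P \in unitmx & G = (map_mx (@conjc R) P)^T *m P.
Proof.
move=> herm pos.
have /hermitian_normalmx /orthomx_spectralP GE : G \is hermsymmx.
  apply/is_hermitianmxP; rewrite expr0 scale1r; apply/matrixP => k j.
  by rewrite !mxE herm.
set U := spectralmx G in GE; set d := spectral_diag G in GE.
have uU : U \is unitarymx by apply: spectral_unitarymx.
have UinvE : invmx U = (map_mx (@conjc R) U)^T by rewrite invmx_unitary // map_trmx.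
have dpos i : 0 < d 0 i.
  have -> : d 0 i = \sum_k \sum_j G k j * (U i j)^*%C * ((U i k)^*%C)^*%C.
    have /matrixP/(_ i i) : diag_mx d = U *m G *m invmx U.
      by rewrite GE !mulmxA mulmxV ?spectral_unit // mul1mx mulmxK ?spectral_unit.
    rewrite !mxE eqxx mulr1n => ->; rewrite UinvE exchange_big.
    apply: eq_bigr => j _; rewrite !mxE mulr_suml; apply: eq_bigr => k _.
    by rewrite conjcK [RHS]mulrC mulrA.
  apply: pos; apply: contrapT => /forallNP nz.
  have /unitarymxP/matrixP/(_ i i) := uU; rewrite !mxE eqxx big1 => [/eqP|j _].
    by rewrite eq_sym oner_eq0.
  have /negP := nz j; rewrite negbK conjc_eq0 => /eqP ->; by rewrite mul0r.
pose s : 'rV[R[i]]_m := \row_j (Num.sqrt (complex.Re (d 0 j)))%:C.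
have ss j : s 0 j * s 0 j = d 0 j.
  rewrite mxE -rmorphM /= -expr2 sqr_sqrtr; first by rewrite RRe_real // gtr0_real.
  by have := dpos j; rewrite ltcE /= => /andP[_ /ltW].
exists (diag_mx s *m U).
  rewrite unitmx_mul spectral_unit andbT unitmxE det_diag unitfE.
  by apply/prodf_neq0 => j _; have := lt0r_neq0 (dpos j); rewrite -ss mulf_eq0 negb_or => /andP[].
rewrite map_mxM trmx_mul -UinvE map_diag_mx tr_diag_mx {1}GE !mulmxA; congr (_ *m _).
rewrite -mulmxA; congr (_ *m _); apply/matrixP => j k.
rewrite mul_diag_mx !mxE; case: eqP => [->|_]; last by rewrite !mulr0n mulr0.
by rewrite !mulr1n -[LHS]ss mxE; congr (_ * _); symmetry; apply: conjc_real.
Qed.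

Lemma wprod_hol (th : 'I_m -> ext R m) : (forall j, has_type 1 0 (th j)) ->
  wprod th finset.setT = coef bhol (wprod th finset.setT) *: mono bhol.
Proof.
move=> H; apply: has_type_hol; have := @has_type_wprod R m 1 0 th finset.setT H.
by rewrite cardsT card_ord muln1 muln0.
Qed.

Lemma cj_wprod (th : 'I_m -> ext R m) A :
  cj (wprod th A) = wprod (fun j => cj (th j)) A.
Proof.
rewrite /wprod; apply: (big_rec2 (fun x y => cj x = y)); first exact: cj1.
by move=> j x y _ <-; rewrite cjM.
Qed.

Lemma emor_id x : emor e_z e_zb x = x.
Proof.
rewrite (ext_sum_mono x) emor_sum; apply: eq_bigr => P _; rewrite emorZ; congr (_ *: _).
apply: (mono_ind (K := fun y => emor e_z e_zb y = y)).
- exact: emor1.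
- by move=> k y E; rewrite emorZ E.
- by move=> j Q E; rewrite emor_e_z ?E //; [exact: z_anti].
- by move=> j Q E; rewrite emor_e_zb ?E //; [exact: zb_anti|exact: zb_z].
Qed.

(** The substitution by the identity fixes the top holomorphic monomial, which is
    therefore an ordered product of generators. *)
Lemma mono_bhol : mono bhol = wprod e_z finset.setT :> ext R m.
Proof. by rewrite -[LHS]emor_id emor_mono wprod0 mulr1. Qed.

Lemma subst_mono_bhol J K : subst J K (mono bhol) = wprod (lin_z J) finset.setT.
Proof. by rewrite /subst emor_mono wprod0 mulr1. Qed.

Lemma subst_wprod J J' K A :
  subst J K (wprod (lin_z J') A) = wprod (lin_z (J' *m J)) A.
Proof.
rewrite /wprod; apply: (big_rec2 (fun x y => subst J K x = y)).
  by rewrite /subst emor1.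
by move=> j x y _ <-; rewrite substM subst_lin_z.
Qed.

Lemma mono_bhol_bahol : mono bhol * mono bahol = mono btop :> ext R m.
Proof.
rewrite mono_mul /bsgn /bdisj /bexp /bcup /= inversions0l inversions0r cards0 finset.setU0 finset.set0U.
by rewrite -!setI_eq0 finset.setI0 finset.set0I eqxx expr0 mulr1 scale1r.
Qed.

(** With conjugate substitutions the determinant is [|al|^2], where [P] multiplies
    [dz^1 /\ ... /\ dz^m] by [al]; substituting the inverse shows [al != 0]. *)
Lemma subst_det_conj P : P \in unitmx -> 0 < subst_det P (map_mx (@conjc R) P).
Proof.
move=> uP; set K := map_mx _ P.
have lin_zbE : lin_zb K = fun j => cj (lin_z P j).
  apply/funext => k; rewrite /lin_zb /lin_z cj_sum; apply: eq_bigr => j _.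
  by rewrite cjZ cj_z mxE.
pose al := coef bhol (wprod (lin_z P) finset.setT : ext R m).
have alE : wprod (lin_z P) finset.setT = al *: mono bhol.
  by apply: wprod_hol => j; apply: has_type_lin_z.
have -> : subst_det P K = al * al^*%C.
  rewrite /subst_det /subst emor_mono lin_zbE -(cj_wprod (lin_z P)) alE cjZ cj_mono /=.
  rewrite cards0 muln0 expr0 scale1r -scalerAl -scalerAr scalerA topZ.
  by rewrite mono_bhol_bahol /top coef_mono eqxx mulr1.
suff al0 : al != 0 by rewrite lt_neqAle mulcJ_ge0 andbT eq_sym mulf_neq0 ?conjc_eq0.
have E : mono bhol = subst P K (wprod (lin_z (invmx P)) finset.setT) :> ext R m.
  by rewrite subst_wprod mulVmx // (funext (@lin_z1 R m)) -mono_bhol.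
have inv_hol : wprod (lin_z (invmx P)) finset.setT =
    coef bhol (wprod (lin_z (invmx P)) finset.setT) *: mono bhol :> ext R m.
  by apply: wprod_hol => j; apply: has_type_lin_z.
move: E; rewrite inv_hol substZ subst_mono_bhol alE scalerA.
move=> /(congr1 (coef bhol)) /eqP; rewrite coefZ coef_mono eqxx mulr1 => E.
by apply: contraTneq E => ->; rewrite mulr0 oner_eq0.
Qed.

(** [m^2 = m + 2 C(m,2)], and [i^2 = -1]: the standard form has the
    normalization of the norm. *)
Lemma std_coefE : std_coef R m = 'i ^+ (m ^ 2) * m`!%:R.
Proof.
rewrite /std_coef mulrAC; congr (_ * _).
have -> : (m ^ 2 = m + 2 * 'C(m, 2))%N.
  elim: m => [|n IH] //; rewrite binS bin1 mulnDr addnCA -addnA; lia.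
by rewrite exprD exprM sqr_i.
Qed.

(** A positive (1,1)-form is [P^* (std)] for an invertible [P], so its top power
    is a positive multiple of that of the standard form. *)
Lemma hermitian_pos_top (om : extalg R m) : hermitian_pos om ->
  metric_mx om \in unitmx /\
  exists2 D : R, 0 < D & top (wpow om m : ext R m) = 'i ^+ (m ^ 2) * m`!%:R * D%:C.
Proof.
move=> [om11 herm pos]; have [P uP GE] := hermitian_factor herm pos.
split.
  rewrite GE unitmx_mul uP andbT unitmx_tr map_unitmx; exact: uP.
have Dpos := subst_det_conj uP; exists (complex.Re (subst_det P (map_mx (@conjc R) P))).
  by move: Dpos; rewrite ltcE => /andP[].
rewrite RRe_real ?gtr0_real // -std_coefE.
rewrite (wpowE (om : ext R m)) (metric_form11 om11) GE -subst_form11 -substX.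
by rewrite top_subst ?top_std_pow //; apply: has_type_form11X.
Qed.

End Metrics.

(** * The norm of a volume form *)

Section Norm.
Variables (R : realType) (m : nat).
Implicit Types (J K G P : 'M[R[i]]_m) (Om om : extalg R m).
Local Notation conjmat := (map_mx (@conjc R)).

Lemma pullbackE J (a : extalg R m) : pullback J a = subst J (conjmat J) (a : ext R m).
Proof.
have bigE (F : 'I_m -> extalg R m) (A : {set 'I_m}) :
    \big[@wedge R m/form1]_(k in A) F k = wprod (F : 'I_m -> ext R m) A.
  rewrite /wprod; apply: (big_rec2 (fun x y => x = (y : ext R m))) => // j x y _ ->.
  by rewrite -wedgeE.
rewrite /pullback /subst /emor; apply: eq_bigr => P _.
rewrite escaleE; congr (_ *: _); rewrite -wedgeE !bigE; congr (wedge (wprod _ _) (wprod _ _)).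
  by apply/funext => k; apply: eq_bigr => j _; rewrite escaleE.
by apply/funext => k; apply: eq_bigr => j _; rewrite escaleE mxE.
Qed.

Lemma cj_lin_z J j : cj (lin_z J j) = lin_zb (conjmat J) j.
Proof. by rewrite /lin_z cj_sum; apply: eq_bigr => k _; rewrite cjZ cj_z mxE. Qed.

Lemma cj_lin_zb J j : cj (lin_zb (conjmat J) j) = lin_z J j.
Proof. by rewrite /lin_zb cj_sum; apply: eq_bigr => k _; rewrite cjZ cj_zb mxE conjcK. Qed.

(** On generators this exchanges [J] with its conjugate; both sides are
    multiplicative. *)
Lemma cj_subst J (a : ext R m) : cj (subst J (conjmat J) a) = subst J (conjmat J) (cj a).
Proof.
rewrite (ext_sum_mono a) subst_sum !cj_sum subst_sum; apply: eq_bigr => P _.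
rewrite substZ !cjZ substZ; congr (_ *: _).
apply: (mono_ind (K := fun y => cj (subst J (conjmat J) y) = subst J (conjmat J) (cj y))).
- by rewrite cj1 /subst emor1 cj1.
- by move=> k y E; rewrite substZ !cjZ substZ E.
- by move=> j Q E; rewrite substM !cjM substM E subst_z cj_lin_z cj_z subst_zb.
- by move=> j Q E; rewrite substM !cjM substM E subst_zb cj_lin_zb cj_zb subst_z.
Qed.

Definition hol_coef Om : R[i] := coef bhol (Om : ext R m).

Lemma volumeE Om : has_type m 0 Om ->
  wedge Om (conjform Om) = (hol_coef Om * (hol_coef Om)^*%C) *: (mono btop : ext R m).
Proof.
move=> /(@has_type_hol R m) OmE; rewrite (wedgeE (Om : ext R m)) -/(cj (Om : ext R m)).
rewrite {1 2}OmE cjZ cj_mono /= cards0 muln0 expr0 scale1r.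
by rewrite -scalerAl -scalerAr scalerA mono_bhol_bahol.
Qed.

Lemma hol_coef_neq0 Om : has_type m 0 Om -> Om != 0 -> hol_coef Om != 0.
Proof.
move=> /(@has_type_hol R m) OmE; apply: contra_neq => H0.
by move: OmE; rewrite -/(hol_coef Om) H0 scale0r.
Qed.

Lemma wpow_top om : has_type 1 1 om ->
  wpow om m = top (wpow om m : ext R m) *: (mono btop : ext R m).
Proof.
move=> om11; apply: has_type_top; rewrite (wpowE (om : ext R m)) (metric_form11 om11).
exact: has_type_form11X.
Qed.

Lemma i_exp_neq0 n : ('i ^+ n : R[i]) != 0.
Proof. by apply: expf_neq0; rewrite -[_ == _]negbK eq_complex /= oner_eq0 andbF. Qed.

Lemma fact_neq0 n : (n`!%:R : R[i]) != 0.
Proof. by rewrite pnatr_eq0 -lt0n fact_gt0. Qed.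

Definition norm_eq Om om (r : R) := 0 <= r /\
  'i ^+ (m ^ 2) *: wedge Om (conjform Om) = ((r ^+ 2)%:C / m`!%:R) *: wpow om m.

Section Positive.
Variables Om om : extalg R m.
Hypothesis Om_hol : has_type m 0 Om.
Hypothesis om_pos : hermitian_pos om.

(** Both sides of the defining equation have top degree, so only one coefficient
    has to be compared. *)
Lemma norm_eqE (r : R) : norm_eq Om om r <-> 0 <= r /\
  (r ^+ 2)%:C * top (wpow om m : ext R m) =
  'i ^+ (m ^ 2) * m`!%:R * (hol_coef Om * (hol_coef Om)^*%C).
Proof.
have [om11 _ _] := om_pos.
set V := _ * _^*%C; set T := top _.
have volE : 'i ^+ (m ^ 2) *: wedge Om (conjform Om) =
    ('i ^+ (m ^ 2) * V) *: (mono btop : ext R m) :> ext R m.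
  by rewrite volumeE // -escaleE scalerA.
have powE : ((r ^+ 2)%:C / m`!%:R) *: wpow om m =
    ((r ^+ 2)%:C / m`!%:R * T) *: (mono btop : ext R m) :> ext R m.
  by rewrite [in LHS]wpow_top // -escaleE scalerA.
rewrite /norm_eq; split=> -[r0 E]; split=> //.
  have : ('i ^+ (m ^ 2) * V) *: (mono btop : ext R m)
      = ((r ^+ 2)%:C / m`!%:R * T) *: (mono btop : ext R m).
    by rewrite -volE -powE.
  move=> /(congr1 (coef btop)); rewrite !coefZ coef_mono eqxx !mulr1 => E2.
  rewrite mulrAC E2 mulrAC divfK ?fact_neq0 //.
have E2 : 'i ^+ (m ^ 2) * V = (r ^+ 2)%:C / m`!%:R * T.
  by apply: (mulIf (fact_neq0 m)); rewrite mulrAC -E mulrAC divfK ?fact_neq0.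
have : ('i ^+ (m ^ 2) * V) *: (mono btop : ext R m)
      = ((r ^+ 2)%:C / m`!%:R * T) *: (mono btop : ext R m) by rewrite E2.
by rewrite -volE -powE.
Qed.

Lemma norm_eq_uniq (r s : R) : norm_eq Om om r -> norm_eq Om om s -> r = s.
Proof.
move=> /norm_eqE[r0 Er] /norm_eqE[s0 Es].
have [_ [D D0 TE]] := hermitian_pos_top om_pos.
have T0 : top (wpow om m : ext R m) != 0.
  rewrite TE !mulf_neq0 ?i_exp_neq0 ?fact_neq0 //.
  by rewrite (inj_eq (@complexI _) _ 0) lt0r_neq0.
have /complexI : (r ^+ 2)%:C = (s ^+ 2)%:C by apply: (mulIf T0); rewrite Er Es.
by move=> /eqP; rewrite eqrXn2 // => /eqP.
Qed.

Lemma form_normP : norm_eq Om om (form_norm Om om).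
Proof.
apply: (xgetPex 0); have [_ [D D0 TE]] := hermitian_pos_top om_pos.
pose F := complex.Re (hol_coef Om * (hol_coef Om)^*%C).
have F0 : 0 <= F by have := mulcJ_ge0 (hol_coef Om); rewrite lecE => /andP[].
exists (Num.sqrt (F / D)); apply/norm_eqE; split; first exact: sqrtr_ge0.
rewrite TE sqr_sqrtr ?divr_ge0 ?(ltW D0) //.
rewrite mulrCA -rmorphM /= divfK ?lt0r_neq0 // RRe_real //.
exact/ger0_real/mulcJ_ge0.
Qed.

Lemma form_norm_eq (r : R) : norm_eq Om om r -> form_norm Om om = r.
Proof. by move=> Hr; apply: norm_eq_uniq form_normP Hr. Qed.

Lemma form_norm_top : ((form_norm Om om) ^+ 2)%:C * top (wpow om m : ext R m) =
  'i ^+ (m ^ 2) * m`!%:R * (hol_coef Om * (hol_coef Om)^*%C).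
Proof. by have /norm_eqE[] := form_normP. Qed.

Hypothesis Om_neq0 : Om != 0.

Lemma form_norm_gt0 : 0 < form_norm Om om.
Proof.
have /norm_eqE[r0 E] := form_normP; rewrite lt_neqAle r0 andbT eq_sym.
apply: contra_eq_neq E => ->; rewrite expr0n mul0r eq_sym.
by rewrite !mulf_neq0 ?i_exp_neq0 ?fact_neq0 // ?conjc_eq0 hol_coef_neq0.
Qed.

Lemma scale_wedge (k l : R[i]) (a b : extalg R m) :
  wedge (k *: a) (l *: b) = (k * l) *: wedge a b.
Proof.
have E := @scalerAr R[i] (ext R m); rewrite -!escaleE !(wedgeE (_ : ext R m)).
by rewrite -scalerAl -scalerAr scalerA.
Qed.

Lemma wpowZ (k : R[i]) n (a : extalg R m) : wpow (k *: a) n = k ^+ n *: wpow a n.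
Proof.
elim: n => [|n IH]; first by rewrite expr0 scale1r.
by rewrite /= IH scale_wedge exprS.
Qed.

Lemma hermitian_posZ (c : R) : 0 < c -> hermitian_pos (c%:C *: om).
Proof.
have [om11 herm pos] := om_pos.
have gE : metric_mx (c%:C *: om) = c%:C *: metric_mx om.
  by apply/matrixP => k j; rewrite !mxE ffunE mulrCA.
move=> c0; split.
- by move=> A B; rewrite ffunE => nz; apply: om11; apply: contraNneq nz => ->; rewrite scaler0.
- move=> k j; rewrite gE [LHS]mxE [in RHS]mxE herm rmorphM; congr (_ * _).
  exact/esym/conjc_real.
move=> v nz; rewrite gE.
rewrite (_ : \sum_k _ = c%:C * \sum_k \sum_j metric_mx om k j * v j * (v k)^*%C).
  by rewrite mulr_gt0 ?pos // ltcR.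
rewrite mulr_sumr; apply: eq_bigr => k _; rewrite mulr_sumr; apply: eq_bigr => j _.
by rewrite mxE !mulrA.
Qed.

Lemma metric_mxZ (c : R[i]) (a : extalg R m) : metric_mx (c *: a) = c *: metric_mx a.
Proof. by apply/matrixP => k j; rewrite !mxE ffunE mulrCA. Qed.

End Positive.

(** The volume of [om] scales by [c^m], while the left-hand side of the equation
    defining the norm does not involve the metric. *)
Lemma form_norm_scale Om om (c : R) :
    has_type m 0 Om -> hermitian_pos om -> 0 < c ->
  form_norm Om (c%:C *: om) ^+ 2 * c ^+ m = form_norm Om om ^+ 2.
Proof.
move=> Om_hol om_pos c0; have cpos := hermitian_posZ om_pos c0.
have [_ [D D0 TE]] := hermitian_pos_top om_pos.
have T0 : top (wpow om m : ext R m) != 0.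
  rewrite TE !mulf_neq0 ?i_exp_neq0 ?fact_neq0 //.
  by rewrite (inj_eq (@complexI _) _ 0) lt0r_neq0.
apply: complexI; apply: (mulIf T0); rewrite (form_norm_top Om_hol om_pos).
rewrite -(form_norm_top Om_hol cpos) wpowZ rmorphM /= -mulrA; congr (_ * _).
by rewrite -escaleE topZ rmorphXn.
Qed.

Lemma pullbackM J (a b : extalg R m) : pullback J (wedge a b) = wedge (pullback J a) (pullback J b).
Proof. by rewrite !pullbackE (wedgeE (a : ext R m) b) substM -wedgeE. Qed.

Lemma pullbackZ J k (a : extalg R m) : pullback J (k *: a) = k *: pullback J a.
Proof. by rewrite !pullbackE -!escaleE substZ. Qed.

Lemma pullback_conj J (a : extalg R m) : pullback J (conjform a) = conjform (pullback J a).
Proof. by rewrite !pullbackE -(cj_subst J a). Qed.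

Lemma pullback_wpow J (a : extalg R m) n : pullback J (wpow a n) = wpow (pullback J a) n.
Proof.
elim: n => [|n IH]; last by rewrite /= pullbackM IH.
by rewrite pullbackE; apply: emor1.
Qed.

(** The equation characterizing the norm is preserved by pullback, which respects
    products, scalars and conjugation; its solution is unique. *)
Lemma form_norm_pullback J Om om :
    has_type m 0 Om -> hermitian_pos om ->
    has_type m 0 (pullback J Om) -> hermitian_pos (pullback J om) ->
  form_norm (pullback J Om) (pullback J om) = form_norm Om om.
Proof.
move=> Om_hol om_pos JOm_hol Jom_pos; apply: form_norm_eq => //.
case: (@form_normP Om om Om_hol om_pos) => r0 E; split=> //.
by rewrite -pullback_conj -pullbackM -pullback_wpow -!pullbackZ E.
Qed.

(** ** Powers of the rescaled metric *)

Section Rescaled.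
Variables Om om : extalg R m.
Hypothesis m2 : (2 <= m)%N.
Hypothesis Om_hol : has_type m 0 Om.
Hypothesis om_pos : hermitian_pos om.
Hypothesis Om_neq0 : Om != 0.
Let r := form_norm Om om.
Let F := hol_coef Om * (hol_coef Om)^*%C.
Let H := invmx (metric_mx (r%:C *: om)).

(** The factor [||Om||_om] turns the cofactors of [om] into the inverse of the
    conformally rescaled metric, with no determinant left: [om^m] is traded for
    [F / r^2], and [r * r^-2] is the factor in [H = r^-1 (metric of om)^-1]. *)
Lemma rescaled_top1 (a b : 'I_m) :
  ('i * m%:R) * (r%:C * top (e_z a * e_zb b * (wpow om (m - 1) : ext R m))) =
  'i ^+ (m ^ 2) * m`!%:R * (F * H a b).
Proof.
have [uG _] := hermitian_pos_top om_pos; have [om11 _ _] := om_pos.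
have r0 : 0 < r := form_norm_gt0 Om_hol om_pos Om_neq0.
have rC0 : r%:C != 0 by rewrite (inj_eq (@complexI _) _ 0) lt0r_neq0.
have m0 : (0 < m)%N by apply: leq_trans m2.
have HE : H = r%:C^-1 *: invmx (metric_mx om) by rewrite /H metric_mxZ invmxZ ?unitmxZ ?unitfE.
rewrite mulrCA (wpowE (om : ext R m)) (metric_form11 om11) top_pow1 // -(metric_form11 om11).
rewrite -(wpowE (om : ext R m)) [RHS]mulrA -(form_norm_top Om_hol om_pos) -/r HE mxE rmorphXn /=.
move: rC0; move: (r%:C) (invmx _ a b) (top _) => x y z x0.
by field.
Qed.

(** Here [r^-2] is the factor of a product of two entries of [H], so that
    [om^(m-2)] needs no rescaling. *)
Lemma rescaled_top2 (a b p q : 'I_m) :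
  m%:R * (m - 1)%:R * top (e_z a * e_zb b * (e_z p * e_zb q) * (wpow om (m - 2) : ext R m)) =
  - ('i ^+ (m ^ 2) * m`!%:R) * (F * (H a b * H p q - H a q * H p b)).
Proof.
have [uG _] := hermitian_pos_top om_pos; have [om11 _ _] := om_pos.
have r0 : 0 < r := form_norm_gt0 Om_hol om_pos Om_neq0.
have rC0 : r%:C != 0 by rewrite (inj_eq (@complexI _) _ 0) lt0r_neq0.
have HE : H = r%:C^-1 *: invmx (metric_mx om) by rewrite /H metric_mxZ invmxZ ?unitmxZ ?unitfE.
rewrite (wpowE (om : ext R m)) (metric_form11 om11) top_pow2 // -(metric_form11 om11).
rewrite -(wpowE (om : ext R m)) !mulNr [in RHS]mulrA -(form_norm_top Om_hol om_pos) -/r HE !mxE rmorphXn /=.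
move: rC0; move: (r%:C) (top _) => x z x0.
move: (invmx _ a b) (invmx _ p q) (invmx _ a q) (invmx _ p b) => y1 y2 y3 y4.
by field.
Qed.

End Rescaled.
End Norm.

Local Open Scope classical_set_scope.
Local Open Scope ring_scope.
Local Open Scope complex_scope.

(** * One-variable calculus *)

Section ComplexLimits.
Variables (R : realType) (T : Type) (F : set_system T) (FF : Filter F).
Local Notation C := R[i]^o.
Implicit Types (f g : T -> C) (a b : C).

Lemma gt0_real_complex (e : R[i]) : 0 < e -> exists2 d : R, 0 < d & e = d%:C.
Proof.
by case: e => x y; rewrite ltcE /= => /andP[/eqP-> x0]; exists x.
Qed.

Lemma normc_real (x : R) : `|x%:C| = `|x|%:C :> R[i].
Proof. by rewrite normc_def /= expr0n addr0 sqrtr_sqr. Qed.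

Lemma cvg_real_complex (h : T -> R) (x : R) :
  h @ F --> x -> (fun s => (h s)%:C : C) @ F --> (x%:C : C).
Proof.
move=> /cvgrPdist_lt hx; apply/cvgrPdist_lt => e /gt0_real_complex[d d0 ->].
have := hx _ d0; apply: filterS => s hs.
by rewrite -rmorphB normc_real ltcR.
Qed.

Lemma cvg_conjc f a : f @ F --> a -> (fun s => (f s)^*%C : C) @ F --> (a^*%C : C).
Proof.
move=> /cvgrPdist_lt fa; apply/cvgrPdist_lt => e e0.
have := fa _ e0; apply: filterS => s; rewrite -rmorphB normcJ; exact.
Qed.

Lemma cvg_Re f a : f @ F --> a -> (fun s => complex.Re (f s)) @ F --> complex.Re a.
Proof.
move=> /cvgrPdist_lt fa; apply/cvgrPdist_lt => d d0.
have dC0 : 0 < d%:C :> R[i] by rewrite ltcR.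
have := fa _ dC0; apply: filterS => s; rewrite -raddfB -ltcR; apply: le_lt_trans.
exact: normc_ge_Re.
Qed.

(** Convergence of positive square roots: [|r - r0| <= |r^2 - r0^2| / r0]. *)
Lemma cvg_sqr_root (r : T -> R) (r0 : R) : 0 < r0 ->
    (\forall s \near F, 0 < r s) ->
    (fun s => ((r s)%:C ^+ 2 : C)) @ F --> (r0%:C ^+ 2 : C) ->
  (fun s => (r s)%:C : C) @ F --> (r0%:C : C).
Proof.
move=> r00 rpos /cvgrPdist_lt rr; apply: cvg_real_complex; apply/cvgrPdist_lt => d d0.
have dC0 : 0 < (d * r0)%:C :> R[i] by rewrite ltcR mulr_gt0.
have := rr _ dC0; apply: filterS2 rpos => s rs.
rewrite -!rmorphXn -rmorphB normc_real ltcR subr_sqr normrM => H.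
rewrite -(ltr_pM2r r00); apply: le_lt_trans H; rewrite ler_wpM2l //.
by rewrite gtr0_norm ?addr_gt0 // lerDl ltW.
Qed.

End ComplexLimits.

Section DerivativeRules.
Variables (R : realType) (I : set R) (t : R).
Hypothesis Iproper : ProperFilter (within I t^').
Local Notation C := R[i]^o.
Local Notation F := (within I t^').
Implicit Types (f g : R -> R[i]) (l k : R[i]).

Lemma is_deriv_unique f l k : is_deriv_in I f t l -> is_deriv_in I f t k -> l = k.
Proof. exact: cvg_unique. Qed.

Lemma is_derivE f l : is_deriv_in I f t l -> deriv_in I f t = l.
Proof. by move=> fl; rewrite /deriv_in; apply: cvg_lim fl; exact: norm_hausdorff. Qed.

Lemma derivableP f : derivable_in I f t -> is_deriv_in I f t (deriv_in I f t).
Proof. by move=> [l fl]; rewrite (is_derivE fl). Qed.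

Lemma near_within : \forall s \near F, I s /\ s != t.
Proof.
rewrite /within /=; have : \forall s \near t^', s != t by apply: nbhs_dnbhs_neq.
by apply: filterS => s st Is.
Qed.

Lemma is_deriv_eq f g l : (\forall s \near F, f s = g s) -> f t = g t ->
  is_deriv_in I f t l -> is_deriv_in I g t l.
Proof.
move=> fg fgt; apply: cvg_trans; apply: near_eq_cvg.
by apply: filterS fg => s E; rewrite /diffquot E fgt.
Qed.

Lemma is_deriv_cvg f l : is_deriv_in I f t l -> (f : R -> C) @ F --> (f t : C).
Proof.
move=> fl.
have st : (fun s => (s - t)%:C : C) @ F --> (0%:C : C).
  apply: cvg_real_complex; rewrite -(subrr t); apply: cvgB; last exact: cvg_cst.
  by apply: cvg_within_filter; apply: cvg_within_filter; apply: cvg_id.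
have : (fun s => f t + (s - t)%:C * diffquot f t s : C) @ F --> (f t + 0%:C * l : C).
  by apply: cvgD; [exact: cvg_cst|exact: cvgM st fl].
rewrite mul0r addr0; apply: cvg_trans; apply: near_eq_cvg.
apply: filterS near_within => s [_ st0]; rewrite /diffquot mulrA divff ?mul1r.
  by rewrite addrC subrK.
by rewrite (inj_eq (@complexI _) _ 0) subr_eq0.
Qed.

Lemma is_deriv_cst l : is_deriv_in I (fun=> l) t 0.
Proof.
apply: (@cvg_trans _ (nbhs (0 : C))); last by [].
rewrite (_ : diffquot _ _ = fun=> 0); first exact: cvg_cst.
by apply/funext => s; rewrite /diffquot subrr mulr0.
Qed.

Lemma is_derivD f g l k : is_deriv_in I f t l -> is_deriv_in I g t k ->
  is_deriv_in I (fun s => f s + g s) t (l + k).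
Proof.
move=> fl gk; rewrite /is_deriv_in (_ : diffquot _ _ = fun s => diffquot f t s + diffquot g t s).
  exact: cvgD fl gk.
by apply/funext => s; rewrite /diffquot -mulrDr; congr (_ * _); ring.
Qed.

Lemma is_derivM f g l k : is_deriv_in I f t l -> is_deriv_in I g t k ->
  is_deriv_in I (fun s => f s * g s) t (l * g t + f t * k).
Proof.
move=> fl gk.
rewrite /is_deriv_in (_ : diffquot _ _ = fun s => diffquot f t s * g t + f s * diffquot g t s).
  apply: cvgD; first by apply: cvgM fl _; exact: cvg_cst.
  by apply: cvgM (is_deriv_cvg fl) gk.
by apply/funext => s; rewrite /diffquot; ring.
Qed.

Lemma is_deriv_conj f l : is_deriv_in I f t l ->
  is_deriv_in I (fun s => (f s)^*%C) t (l^*%C).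
Proof.
move=> fl; rewrite /is_deriv_in (_ : diffquot _ _ = fun s => (diffquot f t s)^*%C).
  exact: cvg_conjc.
apply/funext => s; rewrite /diffquot rmorphM; congr (_ * _); last by rewrite rmorphB.
apply/esym; apply: etrans (conjc_inv _) _; congr (_^-1); exact: conjc_real.
Qed.

Lemma is_derivV f l : (\forall s \near F, f s != 0) -> f t != 0 -> is_deriv_in I f t l ->
  is_deriv_in I (fun s => (f s)^-1) t (- l * ((f t)^-1 * (f t)^-1)).
Proof.
move=> fn0 ft0 fl.
have : (fun s => - diffquot f t s * ((f s)^-1 * (f t)^-1) : C) @ F
     --> (- l * ((f t)^-1 * (f t)^-1) : C).
  have fV : (fun s => (f s)^-1 * (f t)^-1 : C) @ F --> ((f t)^-1 * (f t)^-1 : C).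
    by apply: cvgM (cvgV ft0 (is_deriv_cvg fl)) _; exact: cvg_cst.
  exact: cvgM (cvgN fl) fV.
apply: cvg_trans; apply: near_eq_cvg; apply: filterS fn0 => s fs0.
by rewrite /diffquot; move: ((s - t)%:C^-1) (f s) (f t) fs0 ft0 => c x y x0 y0; field; rewrite x0 y0.
Qed.

(** The difference quotient of [r] is the one of [r^2] divided by
    [r s + r t]. *)
Lemma is_deriv_sqr_root (r : R -> R) l : (\forall s \near F, 0 < r s) -> 0 < r t ->
    is_deriv_in I (fun s => (r s)%:C ^+ 2) t l ->
  is_deriv_in I (fun s => (r s)%:C) t (2^-1 * l * (r t)%:C^-1).
Proof.
move=> rpos rt0 rl.
have rC (s : R) : 0 < r s -> (r s)%:C != 0 by move=> rs; rewrite (inj_eq (@complexI _) _ 0) lt0r_neq0.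
have rr : (fun s => (r s)%:C : C) @ F --> ((r t)%:C : C).
  exact: cvg_sqr_root rt0 rpos (is_deriv_cvg rl).
have : (fun s => diffquot (fun s => (r s)%:C ^+ 2) t s * ((r s)%:C + (r t)%:C)^-1 : C) @ F
     --> (l * ((r t)%:C + (r t)%:C)^-1 : C).
  have n0 : (r t)%:C + (r t)%:C != 0 by rewrite -rmorphD (inj_eq (@complexI _) _ 0) lt0r_neq0 // addr_gt0.
  have rr2 : (fun s => (r s)%:C + (r t)%:C : C) @ F --> ((r t)%:C + (r t)%:C : C).
    by apply: cvgD rr _; exact: cvg_cst.
  exact: cvgM rl (cvgV n0 rr2).
have -> : l * ((r t)%:C + (r t)%:C)^-1 = 2^-1 * l * (r t)%:C^-1.
  have := rC _ rt0; move: ((r t)%:C) => x x0; field.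
  by rewrite x0 -mulr2n mulrn_eq0 negb_or x0.
apply: cvg_trans; apply: near_eq_cvg; apply: filterS rpos => s rs.
rewrite /diffquot.
have : (r s)%:C + (r t)%:C != 0.
  by rewrite -rmorphD (inj_eq (@complexI _) _ 0) lt0r_neq0 // addr_gt0.
by move: ((s - t)%:C^-1) ((r s)%:C) ((r t)%:C) => c x y xy; field.
Qed.

End DerivativeRules.

Lemma proper_within_setT (R : realType) (t : R) : ProperFilter (within setT t^').
Proof. by rewrite withinET; apply: Proper_dnbhs_numFieldType. Qed.

(** Limits along the interval are unique because it contains points other than [t]
    arbitrarily close to [t]. *)
Lemma proper_within_interval (R : realType) (I : set R) (t : R) :
  is_interval I -> (exists a b, [/\ I a, I b & a < b]) -> I t ->
  ProperFilter (within I t^').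
Proof.
move=> itvI [a [b [Ia Ib ab]]] It.
apply: Build_ProperFilter_ex => A [e /= e0 eA].
(* a second point of the interval, moved towards t until it is close enough *)
have [u [Iu ut]] : exists u, I u /\ u != t.
  by case: (eqVneq a t) => [at_|]; [exists b; split=> //; rewrite -at_ gt_eqF|exists a].
have d0 : 0 < `|u - t| by rewrite normr_gt0 subr_eq0.
pose k : R := Num.min 1 (e / 2 / `|u - t|).
have k0 : 0 < k by rewrite lt_min ltr01 !divr_gt0.
have k1 : k <= 1 by rewrite ge_min lexx.
pose s := t + k * (u - t).
have st : s != t by rewrite /s -subr_eq0 addrAC subrr add0r mulf_neq0 ?subr_eq0 // lt0r_neq0.
exists s; apply: eA => //=.
- rewrite /s opprD addrA subrr add0r normrN normrM (gtr0_norm k0).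
  apply: (@le_lt_trans _ _ (e / 2)); last by rewrite ltr_pdivrMr // ltr_pMr // ltr1n.
  by rewrite -ler_pdivlMr // ge_min lexx orbT.
case: (ltgtP u t) => [ltu|gtu|E]; last by rewrite E eqxx in ut.
- apply: (itvI u t) => //; rewrite /s; apply/andP; split; nra.
- apply: (itvI t u) => //; rewrite /s; apply/andP; split; nra.
Qed.

(** * Functions of class C^n in time and space *)

Section Lines.
Variables (R : realType) (m : nat).
Implicit Types (z v w : Cn R m) (V : set (Cn R m)).

Lemma line_continuous z v : continuous (fun h : R => z + h%:C *: v : Cn R m).
Proof.
move=> h; apply: cvgD; first exact: cvg_cst.
by apply: cvgZr_tmp; apply: cvg_real_complex; apply: cvg_id.
Qed.

Lemma line0 z v : z + (0 : R)%:C *: v = z.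
Proof. by rewrite scale0r addr0. Qed.

Lemma near_line V z v : open V -> V z ->
  \forall h \near within setT (0 : R)^', V (z + h%:C *: v).
Proof.
move=> oV Vz; rewrite withinET; apply: nbhs_dnbhs.
apply: (@line_continuous z v 0); rewrite line0; exact: open_nbhs_nbhs.
Qed.

Lemma on_line0 (f : Cn R m -> R[i]) z v : on_line f z v 0 = f z.
Proof. by rewrite /on_line line0. Qed.

End Lines.

Section ClassC.
Variables (R : realType) (m : nat) (I : set R) (V : set (Cn R m)).
Hypothesis openV : open V.
Hypothesis properI : forall t, I t -> ProperFilter (within I t^').
Local Notation C := R[i]^o.
Implicit Types (f g : R -> Cn R m -> R[i]) (n : nat).

Let proper0 := @proper_within_setT R 0.

Definition flow_continuous f :=
  {within I `*` V, continuous (fun p : R * Cn R m => f p.1 p.2 : C)}.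

Lemma flow_continuousP f : flow_continuous f <-> forall t z, I t -> V z ->
  (fun p : R * Cn R m => f p.1 p.2 : C) @ within (I `*` V) (nbhs (t, z)) --> (f t z : C).
Proof.
rewrite /flow_continuous subspace_continuousP; split => [H t z It Vz|H [t z] [/= It Vz]].
  exact: (H (t, z)).
exact: H.
Qed.

Lemma flow_continuous_ext f g : (forall t z, I t -> V z -> f t z = g t z) ->
  flow_continuous f -> flow_continuous g.
Proof.
move=> fg; apply: subspace_eq_continuous => -[t z] /set_mem[/= It Vz]; exact: fg.
Qed.

Lemma flow_continuousD f g : flow_continuous f -> flow_continuous g ->
  flow_continuous (fun t z => f t z + g t z).
Proof.
move=> /flow_continuousP cf /flow_continuousP cg; apply/flow_continuousP => t z It Vz.
exact: cvgD (cf t z It Vz) (cg t z It Vz).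
Qed.

Lemma flow_continuousM f g : flow_continuous f -> flow_continuous g ->
  flow_continuous (fun t z => f t z * g t z).
Proof.
move=> /flow_continuousP cf /flow_continuousP cg; apply/flow_continuousP => t z It Vz.
exact: cvgM (cf t z It Vz) (cg t z It Vz).
Qed.

Lemma flow_continuous_conj f : flow_continuous f -> flow_continuous (fun t z => (f t z)^*%C).
Proof.
move=> /flow_continuousP cf; apply/flow_continuousP => t z It Vz.
exact: cvg_conjc (cf t z It Vz).
Qed.

Lemma is_deriv_ext f g t z l : (forall t z, I t -> V z -> f t z = g t z) ->
  I t -> V z -> is_deriv_in I (f^~ z) t l -> is_deriv_in I (g^~ z) t l.
Proof.
move=> fg It Vz; apply: is_deriv_eq; last exact: fg.
have := @near_within R I t; apply: filterS => s [Is _]; exact: fg.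
Qed.

Lemma is_rderiv_ext (f g : Cn R m -> R[i]) v z l : (forall z, V z -> f z = g z) -> V z ->
  is_deriv_in setT (on_line f z v) 0 l -> is_deriv_in setT (on_line g z v) 0 l.
Proof.
move=> fg Vz; apply: is_deriv_eq; last by rewrite !on_line0 fg.
apply: filterS (near_line v openV Vz) => h Vh; exact: fg.
Qed.

Lemma class_C_ext n f g : (forall t z, I t -> V z -> f t z = g t z) ->
  class_C n I V f -> class_C n I V g.
Proof.
elim: n f g => [|n IH] f g fg [cf].
  by move=> _; split; first exact: (flow_continuous_ext fg cf).
move=> [df cdf rf crf].
have dg t z : I t -> V z -> is_deriv_in I (g^~ z) t (deriv_in I (f^~ z) t).
  move=> It Vz; apply: (is_deriv_ext fg) => //.
  exact: (derivableP (properI It) (df t z It Vz)).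
have rg v t z : I t -> V z -> is_deriv_in setT (on_line (g t) z v) 0 (rderiv v (f t) z).
  move=> It Vz; apply: (@is_rderiv_ext (f t)) => // [y Vy|]; first exact: fg.
  exact: (derivableP proper0 (rf v t z It Vz)).
split; first exact: (flow_continuous_ext fg cf).
split.
- by move=> t z It Vz; exists (deriv_in I (f^~ z) t); apply: dg.
- by apply: IH cdf => t z It Vz; rewrite (is_derivE (properI It) (dg t z It Vz)).
- by move=> v t z It Vz; exists (rderiv v (f t) z); apply: rg.
- by move=> v; apply: IH (crf v) => t z It Vz; rewrite [RHS](is_derivE proper0 (rg v t z It Vz)).
Qed.

(** To be of class C^(n+1) is to have derivatives of class C^n; unlike the
    definition this lets one name the derivatives. *)
Lemma class_C_intro n f dt (dv : Cn R m -> R -> Cn R m -> R[i]) :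
    flow_continuous f ->
    (forall t z, I t -> V z -> is_deriv_in I (f^~ z) t (dt t z)) ->
    (forall v t z, I t -> V z -> is_deriv_in setT (on_line (f t) z v) 0 (dv v t z)) ->
    class_C n I V dt -> (forall v, class_C n I V (dv v)) ->
  class_C n.+1 I V f.
Proof.
move=> cf df rf cdt cdv; split=> //; split.
- by move=> t z It Vz; exists (dt t z); apply: df.
- by apply: class_C_ext cdt => t z It Vz; rewrite (is_derivE (properI It) (df t z It Vz)).
- by move=> v t z It Vz; exists (dv v t z); apply: rf.
- by move=> v; apply: class_C_ext (cdv v) => t z It Vz; rewrite [RHS](is_derivE proper0 (rf v t z It Vz)).
Qed.

Lemma class_C_cont n f : class_C n I V f -> flow_continuous f.
Proof. by case: n => [[]|n []]. Qed.

Lemma class_C_deriv n f t z : class_C n.+1 I V f -> I t -> V z ->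
  is_deriv_in I (f^~ z) t (deriv_in I (f^~ z) t).
Proof. by move=> [_ [df _ _ _]] It Vz; exact: (derivableP (properI It) (df t z It Vz)). Qed.

Lemma class_C_rderiv n f v t z : class_C n.+1 I V f -> I t -> V z ->
  is_deriv_in setT (on_line (f t) z v) 0 (rderiv v (f t) z).
Proof. by move=> [_ [_ _ rf _]] It Vz; exact: (derivableP proper0 (rf v t z It Vz)). Qed.

Arguments class_C_rderiv [n f] v [t z].

Lemma class_CW n f : class_C n.+1 I V f -> class_C n I V f.
Proof.
elim: n f => [|n IH] f.
  by move=> [cf _]; split; first exact: cf.
move=> [cf [df cdf rf crf]]; split; first exact: cf.
by split; [exact: df|exact: IH cdf|exact: rf|move=> v; exact: IH (crf v)].
Qed.

Lemma class_C_cst n (k : R[i]) : class_C n I V (fun _ _ => k).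
Proof.
have cst k' : flow_continuous (fun _ _ => k') by move=> p; apply: cvg_cst.
elim: n k => [|n IH] k; first by split; first exact: cst.
apply: (@class_C_intro n _ (fun _ _ => 0) (fun _ _ _ => 0)).
- exact: cst.
- by move=> t z It _; exact: is_deriv_cst.
- by move=> v t z _ _; exact: is_deriv_cst.
- exact: IH.
- by move=> v; exact: IH.
Qed.

Lemma class_CD n f g : class_C n I V f -> class_C n I V g ->
  class_C n I V (fun t z => f t z + g t z).
Proof.
elim: n f g => [|n IH] f g Cf Cg.
  split; last by [].
  exact: flow_continuousD (class_C_cont Cf) (class_C_cont Cg).
apply: (class_C_intro (dt := fun t z => deriv_in I (f^~ z) t + deriv_in I (g^~ z) t)
    (dv := fun v t z => rderiv v (f t) z + rderiv v (g t) z)).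
- exact: flow_continuousD (class_C_cont Cf) (class_C_cont Cg).
- move=> t z It Vz; exact: is_derivD (class_C_deriv Cf It Vz) (class_C_deriv Cg It Vz).
- move=> v t z It Vz; have H := is_derivD (class_C_rderiv v Cf It Vz) (class_C_rderiv v Cg It Vz); exact: H.
- by case: Cf Cg => _ [_ cf _ _] [_ [_ cg _ _]]; exact: IH cf cg.
- by case: Cf Cg => _ [_ _ _ cf] [_ [_ _ _ cg]] v; exact: IH (cf v) (cg v).
Qed.

Lemma class_CM n f g : class_C n I V f -> class_C n I V g ->
  class_C n I V (fun t z => f t z * g t z).
Proof.
elim: n f g => [|n IH] f g Cf Cg.
  split; last by [].
  exact: flow_continuousM (class_C_cont Cf) (class_C_cont Cg).
apply: (class_C_intro
    (dt := fun t z => deriv_in I (f^~ z) t * g t z + f t z * deriv_in I (g^~ z) t)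
    (dv := fun v t z => rderiv v (f t) z * g t z + f t z * rderiv v (g t) z)).
- exact: flow_continuousM (class_C_cont Cf) (class_C_cont Cg).
- move=> t z It Vz; exact: (is_derivM (class_C_deriv Cf It Vz) (class_C_deriv Cg It Vz)).
- move=> v t z It Vz.
  have := is_derivM (class_C_rderiv v Cf It Vz) (class_C_rderiv v Cg It Vz).
  by rewrite !on_line0.
- have [_ [_ cf _ _]] := Cf; have [_ [_ cg _ _]] := Cg.
  exact: class_CD (IH _ _ cf (class_CW Cg)) (IH _ _ (class_CW Cf) cg).
- have [_ [_ _ _ cf]] := Cf; have [_ [_ _ _ cg]] := Cg => v.
  exact: class_CD (IH _ _ (cf v) (class_CW Cg)) (IH _ _ (class_CW Cf) (cg v)).
Qed.

Lemma class_C_conj n f : class_C n I V f -> class_C n I V (fun t z => (f t z)^*%C).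
Proof.
elim: n f => [|n IH] f Cf.
  split; last by [].
  exact: flow_continuous_conj (class_C_cont Cf).
apply: (class_C_intro (dt := fun t z => (deriv_in I (f^~ z) t)^*%C)
    (dv := fun v t z => (rderiv v (f t) z)^*%C)).
- exact: flow_continuous_conj (class_C_cont Cf).
- move=> t z It Vz; exact: (is_deriv_conj (class_C_deriv Cf It Vz)).
- move=> v t z It Vz; have H := is_deriv_conj (class_C_rderiv v Cf It Vz); exact: H.
- by case: Cf => _ [_ cf _ _]; exact: IH cf.
- by case: Cf => _ [_ _ _ cf] v; exact: IH (cf v).
Qed.

Lemma class_C_sum n (J : Type) (r : seq J) (f : J -> R -> Cn R m -> R[i]) :
  (forall j, class_C n I V (f j)) -> class_C n I V (fun t z => \sum_(j <- r) f j t z).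
Proof.
move=> Cf; elim: r => [|j r IH].
  by apply: class_C_ext (class_C_cst n 0) => t z _ _; rewrite big_nil.
by apply: class_C_ext (class_CD (Cf j) IH) => t z _ _; rewrite big_cons.
Qed.

(** The derivative [- f' / f^2] involves [1 / f] itself, which is of the lower
    class by induction. *)
Lemma class_CV n f : (forall t z, I t -> V z -> f t z != 0) -> class_C n I V f ->
  class_C n I V (fun t z => (f t z)^-1).
Proof.
move=> fn0; have cV g : (forall t z, I t -> V z -> g t z != 0) -> flow_continuous g ->
    flow_continuous (fun t z => (g t z)^-1).
  move=> gn0 /flow_continuousP cg; apply/flow_continuousP => t z It Vz.
  exact: cvgV (gn0 t z It Vz) (cg t z It Vz).
elim: n => [|n IH] Cf; first by split; first exact/cV/(class_C_cont Cf).
have CW := class_CW Cf.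
apply: (class_C_intro (dt := fun t z => - deriv_in I (f^~ z) t * ((f t z)^-1 * (f t z)^-1))
    (dv := fun v t z => - rderiv v (f t) z * ((f t z)^-1 * (f t z)^-1))).
- exact/cV/(class_C_cont Cf).
- move=> t z It Vz; apply: (is_derivV); [|exact: fn0|exact: class_C_deriv Cf It Vz].
  have := @near_within R I t; apply: filterS => s [Is _]; exact: fn0.
- move=> v t z It Vz.
  have := is_derivV _ _ (class_C_rderiv v Cf It Vz); rewrite !on_line0; apply; last exact: fn0.
  by apply: filterS (near_line v openV Vz) => h Vh; apply: fn0.
- have [_ [_ cf _ _]] := Cf; apply: class_CM; last exact: class_CM (IH CW) (IH CW).
  by apply: class_C_ext (class_CM (class_C_cst n (-1)) cf) => t z _ _; rewrite mulN1r.
- have [_ [_ _ _ cf]] := Cf => v; apply: class_CM; last exact: class_CM (IH CW) (IH CW).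
  by apply: class_C_ext (class_CM (class_C_cst n (-1)) (cf v)) => t z _ _; rewrite mulN1r.
Qed.

(** Only continuity of [r] has to be proved directly; derivatives are then
    [(r^2)' / (2 r)], to which induction applies. *)
Lemma class_C_sqr_root n (r : R -> Cn R m -> R) :
    (forall t z, I t -> V z -> 0 < r t z) ->
    class_C n I V (fun t z => (r t z)%:C ^+ 2) ->
  class_C n I V (fun t z => (r t z)%:C).
Proof.
move=> rpos; set f := fun t z => _ => Cf.
have cr : flow_continuous (fun t z => (r t z)%:C).
  apply/flow_continuousP => t z It Vz; apply: cvg_sqr_root; first exact: rpos.
    by apply: filterS (@withinT _ _ _ _) => -[s y] [/= Is Vy]; apply: rpos.
  by have /flow_continuousP := class_C_cont Cf; apply.
elim: n Cf => [|n IH] Cf; first by split; first exact: cr.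
apply: (class_C_intro (dt := fun t z => 2^-1 * deriv_in I (f^~ z) t * (r t z)%:C^-1)
    (dv := fun v t z => 2^-1 * rderiv v (f t) z * (r t z)%:C^-1)); first exact: cr.
- move=> t z It Vz; apply: (is_deriv_sqr_root); [|exact: rpos|exact: class_C_deriv Cf It Vz].
  have := @near_within R I t; apply: filterS => s [Is _]; exact: rpos.
- move=> v t z It Vz.
  have := @is_deriv_sqr_root R setT 0 (fun h => r t (z + h%:C *: v)) _ _ _ (class_C_rderiv v Cf It Vz).
  rewrite line0; apply; last exact: rpos.
  by apply: filterS (near_line v openV Vz) => h Vh; apply: rpos.
all: have Cr : class_C n I V (fun t z => ((r t z)%:C)^-1)
  by apply: class_CV => [t z It Vz|]; [rewrite (inj_eq (@complexI _) _ 0) lt0r_neq0 ?rpos|exact: IH (class_CW Cf)].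
- have [_ [_ cf _ _]] := Cf; exact: class_CM (class_CM (class_C_cst n _) cf) Cr.
- have [_ [_ _ _ cf]] := Cf => v; exact: class_CM (class_CM (class_C_cst n _) (cf v)) Cr.
Qed.

End ClassC.

Section StoppedFlow.
Variables (R : realType) (m : nat) (V : set (Cn R m)).
Hypothesis openV : open V.

Lemma flow_continuous_stopped (I I' : set R) (f : R -> Cn R m -> R[i]) (t : R) :
  I t -> flow_continuous I V f -> flow_continuous I' V (fun _ => f t).
Proof.
move=> It /flow_continuousP cf; apply/flow_continuousP => s z Is Vz.
apply: (@cvg_comp _ _ _ (fun p : R * Cn R m => (t, p.2)) _ _ _ _ _ (cf t z It Vz)).
have ct : (fun p : R * Cn R m => (t, p.2)) @ nbhs (s, z) --> (t, z).
  have c1 : (fun _ : R * Cn R m => t) @ nbhs (s, z) --> t by exact: cvg_cst.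
  have c2 : (fun p : R * Cn R m => p.2) @ nbhs (s, z) --> z by exact: cvg_snd.
  exact: cvg_pair c1 c2.
move=> A WA; have B := ct _ WA.
apply: (@filterS _ (nbhs (s, z)) _ _ _ _ B) => -[s' y] /= Ay [_ Vy]; exact: Ay.
Qed.

(** Turns a flow into a time-independent function, to which the calculus in the
    space variables applies; conversely it views a function on space as a flow. *)
Lemma class_C_stopped n (I I' : set R) (f : R -> Cn R m -> R[i]) (t : R) :
    (forall t, I' t -> ProperFilter (within I' t^')) ->
    I t -> class_C n I V f -> class_C n I' V (fun _ => f t).
Proof.
move=> properI' It; elim: n f => [|n IH] f Cf.
  by split; first exact: flow_continuous_stopped It (class_C_cont Cf).
apply: (class_C_intro openV properI' (dt := fun _ _ => 0)
    (dv := fun v _ z => rderiv v (f t) z)).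
- exact: flow_continuous_stopped It (class_C_cont Cf).
- by move=> s z Is _; exact: is_deriv_cst.
- move=> v s z Is Vz; exact: class_C_rderiv Cf It Vz.
- exact: class_C_cst.
- by move=> v; case: Cf => _ [_ _ _ Cf]; exact: IH (Cf v).
Qed.

Let properT (t : R) (_ : [set: R] t) : ProperFilter (within setT t^') :=
  proper_within_setT t.

Lemma smooth_cst (k : R[i]) : smooth_on V (fun _ => k).
Proof. by move=> n; exact: class_C_cst. Qed.

Lemma smooth_ext (f g : Cn R m -> R[i]) : (forall z, V z -> f z = g z) ->
  smooth_on V f -> smooth_on V g.
Proof. by move=> fg Sf n; apply: (class_C_ext openV properT _ (Sf n)) => t z _; exact: fg. Qed.

Lemma smoothD (f g : Cn R m -> R[i]) : smooth_on V f -> smooth_on V g ->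
  smooth_on V (fun z => f z + g z).
Proof. by move=> Sf Sg n; exact: class_CD (Sf n) (Sg n). Qed.

Lemma smoothM (f g : Cn R m -> R[i]) : smooth_on V f -> smooth_on V g ->
  smooth_on V (fun z => f z * g z).
Proof. by move=> Sf Sg n; exact: class_CM (Sf n) (Sg n). Qed.

Lemma smooth_conj (f : Cn R m -> R[i]) : smooth_on V f -> smooth_on V (fun z => (f z)^*%C).
Proof. by move=> Sf n; exact: class_C_conj (Sf n). Qed.

Lemma smooth_sum (J : Type) (r : seq J) (f : J -> Cn R m -> R[i]) :
  (forall j, smooth_on V (f j)) -> smooth_on V (fun z => \sum_(j <- r) f j z).
Proof. by move=> Sf n; apply: class_C_sum => // j; exact: Sf. Qed.

Lemma smooth_rderiv v (f : Cn R m -> R[i]) : smooth_on V f -> smooth_on V (rderiv v f).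
Proof. by move=> Sf n; have [_ [_ _ _ Cf]] := Sf n.+1; exact: Cf. Qed.

Lemma smooth_cont (f : Cn R m -> R[i]) z : smooth_on V f -> V z ->
  (f : Cn R m -> R[i]^o) @ nbhs z --> (f z : R[i]^o).
Proof.
move=> Sf Vz; have /flow_continuousP/(_ 0 z I Vz) cf := class_C_cont (Sf 0%N).
apply: (@cvg_comp _ _ _ (fun y : Cn R m => (0 : R, y)) _ _ _ _ _ cf).
have c0 : (fun y : Cn R m => (0 : R, y)) @ nbhs z --> (0 : R, z).
  have c1 : (fun _ : Cn R m => 0 : R) @ nbhs z --> (0 : R) by exact: cvg_cst.
  have c2 : (fun y : Cn R m => y) @ nbhs z --> z by exact: cvg_id.
  exact: cvg_pair c1 c2.
move=> A /c0; have : nbhs z V by apply: open_nbhs_nbhs.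
by apply: filterS2 => y /= Vy; apply.
Qed.

(** ** Directional derivatives *)

Let proper0 := @proper_within_setT R 0.

Lemma smooth_is_rderiv (f : Cn R m -> R[i]) v z : smooth_on V f -> V z ->
  is_deriv_in setT (on_line f z v) 0 (rderiv v f z).
Proof.
move=> Sf Vz; have H := @class_C_rderiv R m setT V 0%N (fun _ => f) v (0 : R) z (Sf 1%N) I Vz.
exact: H.
Qed.

Arguments smooth_is_rderiv [f] v [z].

Lemma rderiv_ext (f g : Cn R m -> R[i]) v z : (forall z, V z -> f z = g z) ->
  smooth_on V f -> V z -> rderiv v g z = rderiv v f z.
Proof.
move=> fg Sf Vz; apply: (is_derivE proper0).
have H := @is_rderiv_ext R m V openV f g v z _ fg Vz (smooth_is_rderiv v Sf Vz); exact: H.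
Qed.

Lemma rderiv_cst (k : R[i]) (v z : Cn R m) : rderiv v (fun _ => k) z = 0.
Proof. by apply: (is_derivE proper0); exact: is_deriv_cst. Qed.

Lemma rderivD (f g : Cn R m -> R[i]) v z : smooth_on V f -> smooth_on V g -> V z ->
  rderiv v (fun z => f z + g z) z = rderiv v f z + rderiv v g z.
Proof.
move=> Sf Sg Vz; apply: (is_derivE proper0).
have H := is_derivD (smooth_is_rderiv v Sf Vz) (smooth_is_rderiv v Sg Vz); exact: H.
Qed.

Lemma rderivM (f g : Cn R m -> R[i]) v z : smooth_on V f -> smooth_on V g -> V z ->
  rderiv v (fun z => f z * g z) z = rderiv v f z * g z + f z * rderiv v g z.
Proof.
move=> Sf Sg Vz; apply: (is_derivE proper0).
have := is_derivM (smooth_is_rderiv v Sf Vz) (smooth_is_rderiv v Sg Vz).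
by rewrite !on_line0.
Qed.

Lemma rderiv_conj (f : Cn R m -> R[i]) v z : smooth_on V f -> V z ->
  rderiv v (fun z => (f z)^*%C) z = (rderiv v f z)^*%C.
Proof.
move=> Sf Vz; apply: (is_derivE proper0).
have H := is_deriv_conj (smooth_is_rderiv v Sf Vz); exact: H.
Qed.

End StoppedFlow.

Arguments smooth_is_rderiv [R m V f] v [z].
Arguments smooth_rderiv [R m V] v [f].
Arguments rderiv_ext [R m V] openV [f g] v [z].
Arguments rderivD [R m V f g] v [z].
Arguments rderivM [R m V f g] v [z].
Arguments rderiv_conj [R m V f] v [z].

(** ** Symmetry of second derivatives *)

Section Schwarz.
Variable R : realType.

Lemma mean_value (f df : R -> R) (h : R) : 0 < h ->
    (forall x, 0 <= x <= h -> is_derive x 1 f (df x)) ->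
  exists2 c, 0 < c < h & f h - f 0 = df c * h.
Proof.
move=> h0 fd.
have [||c] := @MVT R f df 0 h h0.
- by move=> x; rewrite in_itv /= => /andP[x0 xh]; apply: fd; rewrite !ltW.
- apply: derivable_within_continuous => x; rewrite in_itv /= => xh.
  by have fx := fd x xh; apply: ex_derive.
by rewrite in_itv /= subr0 => ch E; exists c.
Qed.

(** Both mixed derivatives are limits of the same second difference quotient
    over a small square, by the mean value theorem applied in either order. *)
Lemma schwarz_real (f fx fy fxy fyx : R -> R -> R) :
    (\forall p \near nbhs (0 : R, 0 : R), is_derive (p.1 : R) (1 : R) (f^~ p.2) (fx p.1 p.2)) ->
    (\forall p \near nbhs (0 : R, 0 : R), is_derive (p.2 : R) (1 : R) (f p.1) (fy p.1 p.2)) ->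
    (\forall p \near nbhs (0 : R, 0 : R), is_derive (p.2 : R) (1 : R) (fx p.1) (fxy p.1 p.2)) ->
    (\forall p \near nbhs (0 : R, 0 : R), is_derive (p.1 : R) (1 : R) (fy^~ p.2) (fyx p.1 p.2)) ->
    (fun p => fxy p.1 p.2) @ (0 : R, 0 : R) --> fxy 0 0 ->
    (fun p => fyx p.1 p.2) @ (0 : R, 0 : R) --> fyx 0 0 ->
  fxy 0 0 = fyx 0 0.
Proof.
move=> dx dy dxy dyx /cvgrPdist_lt cxy /cvgrPdist_lt cyx.
apply/eqP; rewrite -subr_eq0 -normr_le0; apply/ler_addgt0Pr => e e0; rewrite add0r.
have e2 : 0 < e / 2 by rewrite divr_gt0.
have : \forall p \near nbhs (0 : R, 0 : R), [/\ is_derive (p.1 : R) (1 : R) (f^~ p.2) (fx p.1 p.2),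
    is_derive (p.2 : R) (1 : R) (f p.1) (fy p.1 p.2), is_derive (p.2 : R) (1 : R) (fx p.1) (fxy p.1 p.2)
  & is_derive (p.1 : R) (1 : R) (fy^~ p.2) (fyx p.1 p.2)] /\
    (`|fxy 0 0 - fxy p.1 p.2| < e / 2 /\ `|fyx 0 0 - fyx p.1 p.2| < e / 2).
  near=> p; split; [split|split]; near: p => //.
  - exact: cxy.
  - exact: cyx.
move=> /nbhs_ballP[d /= d0 H].
pose h := d / 2; have h0 : 0 < h by rewrite divr_gt0.
have hd : h < d by rewrite /h ltr_pdivrMr // ltr_pMr // ltr1n.
have {}H x y : 0 <= x <= h -> 0 <= y <= h -> [/\ is_derive x 1 (f^~ y) (fx x y),
    is_derive y 1 (f x) (fy x y), is_derive y 1 (fx x) (fxy x y)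
  & is_derive x 1 (fy^~ y) (fyx x y)] /\
    (`|fxy 0 0 - fxy x y| < e / 2 /\ `|fyx 0 0 - fyx x y| < e / 2).
  move=> /andP[x0 xh] /andP[y0 yh]; apply: (H (x, y)).
  by split; rewrite /= /ball /= sub0r normrN ger0_norm //; apply: le_lt_trans hd.
have h00 : 0 <= (0 : R) <= h by rewrite lexx ltW.
have hh : 0 <= h <= h by rewrite lexx ltW.
have wk c : 0 < c < h -> 0 <= c <= h by move=> /andP[? ?]; rewrite !ltW.
have [c /wk ch E1] : exists2 c, 0 < c < h &
    (f h h - f h 0) - (f 0 h - f 0 0) = (fx c h - fx c 0) * h.
  apply: (@mean_value (fun x => f x h - f x 0) (fun x => fx x h - fx x 0)) => // x xh.
  have [[dh _ _ _] _] := H x h xh hh; have [[d0' _ _ _] _] := H x 0 xh h00.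
  exact: is_deriveB.
have [c' /wk ch' E2] : exists2 c', 0 < c' < h & fx c h - fx c 0 = fxy c c' * h.
  by apply: mean_value => // y yh; have [[_ _ ? _] _] := H c y ch yh.
have [k /wk kh E3] : exists2 k, 0 < k < h &
    (f h h - f 0 h) - (f h 0 - f 0 0) = (fy h k - fy 0 k) * h.
  apply: (@mean_value (fun y => f h y - f 0 y) (fun y => fy h y - fy 0 y)) => // y yh.
  have [[_ dh _ _] _] := H h y hh yh; have [[_ d0' _ _] _] := H 0 y h00 yh.
  exact: is_deriveB.
have [k' /wk kh' E4] : exists2 k', 0 < k' < h & fy h k - fy 0 k = fyx k' k * h.
  by apply: (@mean_value (fy^~ k) (fyx^~ k)) => // x xh; have [[_ _ _ ?] _] := H x k xh kh.
have E : fxy c c' = fyx k' k.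
  have hn0 := lt0r_neq0 h0; apply: (mulIf hn0); apply: (mulIf hn0).
  by rewrite -E2 -E4 -E1 -E3; ring.
have [_ [Hx _]] := H c c' ch ch'; have [_ [_ Hy]] := H k' k kh' kh.
rewrite -E in Hy; move: (fxy c c') Hx Hy => u Hx Hy.
rewrite (_ : fxy 0 0 - fyx 0 0 = (fxy 0 0 - u) - (fyx 0 0 - u)); last by ring.
by apply: le_trans (ler_normB _ _) _; rewrite (splitr e) lerD // ltW.
Unshelve. all: by end_near. Qed.

End Schwarz.

Section Wirtinger.
Variables (R : realType) (m : nat) (V : set (Cn R m)).
Hypothesis openV : open V.
Implicit Types (f g : Cn R m -> R[i]) (v w z : Cn R m).

(** Restricts complex valued derivatives along a line to real functions of one
    variable, for which the mean value theorem is available. *)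
Lemma is_derive_Re (psi : R -> R[i]) (x : R) (l : R[i]) :
  is_deriv_in setT (fun h => psi (x + h)) 0 l ->
  is_derive (x : R) (1 : R) (fun s => complex.Re (psi s)) (complex.Re l).
Proof.
move=> psil.
have : (fun h => complex.Re (diffquot (fun h => psi (x + h)) 0 h)) @ (0 : R)^' --> complex.Re l.
  by apply: cvg_Re; move: psil; rewrite /is_deriv_in withinET.
rewrite (_ : (fun h => _) = (fun h : R => h^-1 *:
    (((fun s => complex.Re (psi s)) \o shift x) (h *: (1 : R)) - complex.Re (psi x)))).
  by move=> H; split; [exact: cvgP H|exact: cvg_lim H].
apply/funext => h; rewrite /diffquot /= subr0 addr0 [h *: 1]mulr1 (addrC h).
have ReZ (k : R) (u : R[i]) : complex.Re (k%:C * u) = k * complex.Re u.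
  by case: u => a b /=; rewrite mul0r subr0.
have -> : h%:C^-1 = (h^-1)%:C :> R[i] by rewrite fmorphV.
rewrite ReZ; congr (_ * _).
by case: (psi _) => a b; case: (psi _) => c d.
Qed.

Lemma plane_continuous z v w : (fun p : R * R => z + p.1%:C *: v + p.2%:C *: w : Cn R m)
   @ (0 : R, 0 : R) --> z.
Proof.
have c1 : (fun p : R * R => p.1) @ (0 : R, 0 : R) --> (0 : R) by exact: cvg_fst.
have c2 : (fun p : R * R => p.2) @ (0 : R, 0 : R) --> (0 : R) by exact: cvg_snd.
have d1 : (fun p : R * R => z + p.1%:C *: v : Cn R m) @ (0 : R, 0 : R) --> z.
  rewrite -[X in _ --> X](line0 z v).
  exact: (@cvg_comp _ _ _ (fun p : R * R => p.1) _ _ _ _ c1 (@line_continuous R m z v 0)).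
have d2 : (fun p : R * R => (0 : Cn R m) + p.2%:C *: w : Cn R m) @ (0 : R, 0 : R) --> (0 : Cn R m).
  rewrite -[X in _ --> X](line0 0 w).
  exact: (@cvg_comp _ _ _ (fun p : R * R => p.2) _ _ _ _ c2 (@line_continuous R m 0 w 0)).
have -> : (fun p : R * R => z + p.1%:C *: v + p.2%:C *: w : Cn R m) =
    (fun p => (z + p.1%:C *: v) + (0 + p.2%:C *: w)).
  by apply/funext => p; rewrite add0r.
by rewrite -[X in _ --> X]addr0; exact: cvgD d1 d2.
Qed.

Lemma near_plane z v w : V z ->
  \forall p \near nbhs (0 : R, 0 : R), V (z + p.1%:C *: v + p.2%:C *: w).
Proof. by move=> Vz; apply: (@plane_continuous z v w V); apply: open_nbhs_nbhs. Qed.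

Lemma line_add z v (x h : R) : z + (x + h)%:C *: v = z + x%:C *: v + h%:C *: v.
Proof. by rewrite rmorphD scalerDl addrA. Qed.

(** The real version is applied to the restriction of [f] to the plane spanned by
    [v] and [w] at [z]. *)
Lemma rderiv_comm_Re f v w z : smooth_on V f -> V z ->
  complex.Re (rderiv w (rderiv v f) z) = complex.Re (rderiv v (rderiv w f) z).
Proof.
move=> Sf Vz.
pose pl x y : Cn R m := z + x%:C *: v + y%:C *: w.
pose F (g : Cn R m -> R[i]) x y := complex.Re (g (pl x y)).
have pl0 : pl 0 0 = z by rewrite /pl !line0.
have dx g : smooth_on V g ->
    \forall p \near nbhs (0 : R, 0 : R), is_derive (p.1 : R) (1 : R) ((F g)^~ p.2) (F (rderiv v g) p.1 p.2).
  move=> Sg; apply: filterS (near_plane v w Vz) => -[x y] /= Vp.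
  apply: (@is_derive_Re (fun s => g (pl s y))).
  have E : on_line g (z + x%:C *: v + y%:C *: w) v = fun h => g (pl (x + h) y).
    by apply/funext => h; rewrite /on_line /pl line_add addrAC.
  have H := smooth_is_rderiv v Sg Vp; rewrite E in H; exact: H.
have dy g : smooth_on V g ->
    \forall p \near nbhs (0 : R, 0 : R), is_derive (p.2 : R) (1 : R) (F g p.1) (F (rderiv w g) p.1 p.2).
  move=> Sg; apply: filterS (near_plane v w Vz) => -[x y] /= Vp.
  apply: (@is_derive_Re (fun s => g (pl x s))).
  have E : on_line g (z + x%:C *: v + y%:C *: w) w = fun h => g (pl x (y + h)).
    by apply/funext => h; rewrite /on_line /pl line_add.
  have H := smooth_is_rderiv w Sg Vp; rewrite E in H; exact: H.
have ct g : smooth_on V g -> (fun p => F g p.1 p.2) @ (0 : R, 0 : R) --> F g 0 0.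
  move=> Sg; rewrite /F pl0.
  have H := @cvg_comp _ _ _ (fun p : R * R => pl p.1 p.2) (g : Cn R m -> R[i]^o) _ _ _
    (@plane_continuous z v w) (smooth_cont openV Sg Vz).
  exact: cvg_Re H.
have Sv := smooth_rderiv v Sf; have Sw := smooth_rderiv w Sf.
have := schwarz_real (dx f Sf) (dy f Sf) (dy _ Sv) (dx _ Sw)
  (ct _ (smooth_rderiv w Sv)) (ct _ (smooth_rderiv v Sw)).
by rewrite /F pl0.
Qed.

Lemma rderivZ (k : R[i]) f v z : smooth_on V f -> V z ->
  rderiv v (fun z => k * f z) z = k * rderiv v f z.
Proof.
move=> Sf Vz; rewrite (rderivM v (smooth_cst openV k) Sf Vz) rderiv_cst //.
by rewrite mul0r add0r.
Qed.

Lemma smoothZ (k : R[i]) f : smooth_on V f -> smooth_on V (fun z => k * f z).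
Proof. by move=> Sf; have H := smoothM openV (smooth_cst openV k) Sf; exact: H. Qed.

Lemma eq_Re_Im (a b : R[i]) : complex.Re a = complex.Re b ->
  complex.Re (- 'i * a) = complex.Re (- 'i * b) -> a = b.
Proof. by case: a b => a b [c d] /= ->; rewrite oppr0 !mul0r !sub0r !mulN1r !opprK => ->. Qed.

Lemma rderiv_comm f v w z : smooth_on V f -> V z ->
  rderiv w (rderiv v f) z = rderiv v (rderiv w f) z.
Proof.
move=> Sf Vz; apply: eq_Re_Im; first exact: rderiv_comm_Re.
(* the imaginary part of f is the real part of -i f *)
have Zl u u' : - 'i * rderiv u' (rderiv u f) z = rderiv u' (rderiv u (fun z => - 'i * f z)) z.
  rewrite -(rderivZ (- 'i) u' (smooth_rderiv u Sf) Vz).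
  apply/esym/(rderiv_ext openV u' _ (smoothZ _ (smooth_rderiv u Sf)) Vz) => y Vy.
  by rewrite rderivZ.
have H := rderiv_comm_Re v w (smoothZ (- 'i) Sf) Vz.
exact (etrans (congr1 (@complex.Re R) (Zl v w))
  (etrans H (esym (congr1 (@complex.Re R) (Zl w v))))).
Qed.

(** [wirt s j] is [d/dz^j] for [s = -i] and [d/dzbar^j] for [s = i]. *)
Definition wirt (s : R[i]) (j : 'I_m) f z : R[i] :=
  2^-1 * (rderiv (delta_mx 0 j) f z + s * rderiv ('i *: delta_mx 0 j) f z).

Lemma pdE : @pd R m = wirt (- 'i).
Proof. by apply/funext => j; apply/funext => f; apply/funext => z; rewrite /wirt mulNr. Qed.

Lemma pdbarE : @pdbar R m = wirt 'i. Proof. by []. Qed.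

Variable s : R[i].
Implicit Types j : 'I_m.

Lemma smooth_wirt j f : smooth_on V f -> smooth_on V (wirt s j f).
Proof.
move=> Sf; apply: smoothZ.
have H := smoothD openV (smooth_rderiv (delta_mx 0 j) Sf)
  (smoothZ s (smooth_rderiv ('i *: delta_mx 0 j) Sf)); exact: H.
Qed.

Lemma wirt_ext j f g z : (forall z, V z -> f z = g z) -> smooth_on V f -> V z ->
  wirt s j g z = wirt s j f z.
Proof. by move=> fg Sf Vz; rewrite /wirt !(rderiv_ext openV _ fg Sf Vz). Qed.

Lemma wirt_cst j (k : R[i]) z : wirt s j (fun _ => k) z = 0.
Proof. by rewrite /wirt !rderiv_cst mulr0 addr0 mulr0. Qed.

Lemma wirtD j f g z : smooth_on V f -> smooth_on V g -> V z ->
  wirt s j (fun z => f z + g z) z = wirt s j f z + wirt s j g z.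
Proof.
move=> Sf Sg Vz; rewrite /wirt !(rderivD _ Sf Sg Vz).
have H (h a b c d : R[i]) : h * (a + b + s * (c + d)) = h * (a + s * c) + h * (b + s * d) by ring.
exact: H.
Qed.

Lemma wirtM j f g z : smooth_on V f -> smooth_on V g -> V z ->
  wirt s j (fun z => f z * g z) z = wirt s j f z * g z + f z * wirt s j g z.
Proof.
move=> Sf Sg Vz; rewrite /wirt !(rderivM _ Sf Sg Vz).
have H (h a b c d x y : R[i]) : h * (a * y + x * b + s * (c * y + x * d)) =
  h * (a + s * c) * y + x * (h * (b + s * d)) by ring.
exact: H.
Qed.

Lemma wirtZ j (k : R[i]) f z : smooth_on V f -> V z ->
  wirt s j (fun z => k * f z) z = k * wirt s j f z.
Proof.
move=> Sf Vz; rewrite /wirt !(rderivZ _ _ Sf Vz).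
have H (h a c : R[i]) : h * (k * a + s * (k * c)) = k * (h * (a + s * c)) by ring.
exact: H.
Qed.

Lemma wirt_sum j (J : Type) (r : seq J) (f : J -> Cn R m -> R[i]) z :
    (forall k, smooth_on V (f k)) -> V z ->
  wirt s j (fun z => \sum_(k <- r) f k z) z = \sum_(k <- r) wirt s j (f k) z.
Proof.
move=> Sf Vz; elim: r => [|k r IH].
  rewrite big_nil; apply: etrans (wirt_cst j 0 z); apply: wirt_ext Vz; last exact: smooth_cst.
  by move=> y _; rewrite big_nil.
have Sr := smooth_sum openV r Sf.
rewrite big_cons -IH -(wirtD j (Sf k) Sr Vz); apply: wirt_ext Vz.
  by move=> y _; rewrite big_cons.
have H := smoothD openV (Sf k) Sr; exact: H.
Qed.

End Wirtinger.

Section WirtingerPairs.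
Variables (R : realType) (m : nat) (V : set (Cn R m)).
Hypothesis openV : open V.
Implicit Types (f g : Cn R m -> R[i]) (z : Cn R m) (j k : 'I_m) (s : R[i]).

Lemma wirt_comm s s' j k f z : smooth_on V f -> V z ->
  wirt s j (wirt s' k f) z = wirt s' k (wirt s j f) z.
Proof.
move=> Sf Vz.
have S v := smooth_rderiv v Sf.
have E u l v : rderiv v (wirt u l f) z = 2^-1 * (rderiv v (rderiv (delta_mx 0 l) f) z
    + u * rderiv v (rderiv ('i *: delta_mx 0 l) f) z).
  rewrite (rderivZ openV _ _ _ Vz); last by have H := smoothD openV (S (delta_mx 0 l)) (smoothZ openV u (S ('i *: delta_mx 0 l))); exact: H.
  by rewrite (rderivD _ (S _) (smoothZ openV _ (S _)) Vz) (rderivZ openV _ _ (S _) Vz).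
have H (h p q p' q' a b c d a' b' c' d' : R[i]) :
    p = h * (a + s' * b) -> q = h * (c + s' * d) ->
    p' = h * (a' + s * c') -> q' = h * (b' + s * d') ->
    a = a' -> b = b' -> c = c' -> d = d' ->
  h * (p + s * q) = h * (p' + s' * q').
  by move=> -> -> -> -> -> -> -> ->; ring.
exact (H _ _ _ _ _ _ _ _ _ _ _ _ _ (E _ _ _) (E _ _ _) (E _ _ _) (E _ _ _)
  (rderiv_comm openV (delta_mx 0 k) (delta_mx 0 j) Sf Vz)
  (rderiv_comm openV ('i *: delta_mx 0 k) (delta_mx 0 j) Sf Vz)
  (rderiv_comm openV (delta_mx 0 k) ('i *: delta_mx 0 j) Sf Vz)
  (rderiv_comm openV ('i *: delta_mx 0 k) ('i *: delta_mx 0 j) Sf Vz)).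
Qed.

Lemma wirt_conj s j f z : smooth_on V f -> V z ->
  wirt s j (fun z => (f z)^*%C) z = (wirt (s^*%C) j f z)^*%C.
Proof.
move=> Sf Vz; rewrite /wirt !(rderiv_conj _ Sf Vz).
have H (h a b : R[i]) : h^*%C = h -> h * (a^*%C + s * b^*%C) = (h * (a + s^*%C * b))^*%C.
  move=> hh; rewrite rmorphM rmorphD rmorphM; congr (_ * (_ + _ * _)); first by [].
  exact/esym/conjcK.
by apply: H; apply: etrans (conjc_inv _) _; congr (_^-1); exact: conjc_nat.
Qed.

Lemma conj_i : ('i : R[i])^*%C = - 'i.
Proof. by apply/eqP; rewrite eq_complex /= oppr0 !eqxx. Qed.

Lemma conj_Ni : (- 'i : R[i])^*%C = 'i.
Proof. by apply/eqP; rewrite eq_complex /= oppr0 opprK !eqxx. Qed.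

Lemma pd_conj j f z : smooth_on V f -> V z -> pd j (fun z => (f z)^*%C) z = (pdbar j f z)^*%C.
Proof. by move=> Sf Vz; rewrite pdE wirt_conj // conj_Ni. Qed.

Lemma pdbar_conj j f z : smooth_on V f -> V z -> pdbar j (fun z => (f z)^*%C) z = (pd j f z)^*%C.
Proof. by move=> Sf Vz; rewrite pdE pdbarE wirt_conj // conj_i. Qed.

End WirtingerPairs.

(** * The flow equation for the inverse metric *)

Section InverseMetric.
Variables (R : realType) (m : nat) (V : set (Cn R m)).
Hypothesis openV : open V.
Variables (f : Cn R m -> R[i]) (H : 'I_m -> 'I_m -> Cn R m -> R[i]).
Hypothesis Sf : smooth_on V f.
Hypothesis SH : forall a b, smooth_on V (H a b).
Hypothesis f_neq0 : forall z, V z -> f z != 0.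
Hypothesis f_hol : forall q z, V z -> pdbar q f z = 0.

Let fb z := (f z)^*%C.
Let F z := f z * fb z.

Hypothesis bal_del : forall b z, V z -> \sum_p pd p (fun y => F y * H p b y) z = 0.
Hypothesis bal_delbar : forall a z, V z -> \sum_q pdbar q (fun y => F y * H a q y) z = 0.

Let Sfb : smooth_on V fb. Proof. exact: smooth_conj. Qed.
Let SF : smooth_on V F. Proof. by have S := smoothM openV Sf Sfb; exact: S. Qed.
Let SFH a b : smooth_on V (fun z => F z * H a b z).
Proof. by have S := smoothM openV SF (SH a b); exact: S. Qed.
Let Spd p g : smooth_on V g -> smooth_on V (pd p g).
Proof. by rewrite pdE => Sg; exact: smooth_wirt. Qed.
Let Spdbar p g : smooth_on V g -> smooth_on V (pdbar p g).
Proof. by rewrite pdbarE => Sg; exact: smooth_wirt. Qed.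

Let pdM j (g h : Cn R m -> R[i]) z : smooth_on V g -> smooth_on V h -> V z ->
  pd j (fun z => g z * h z) z = pd j g z * h z + g z * pd j h z.
Proof. by rewrite pdE; exact: wirtM. Qed.
Let pdbarM j (g h : Cn R m -> R[i]) z : smooth_on V g -> smooth_on V h -> V z ->
  pdbar j (fun z => g z * h z) z = pdbar j g z * h z + g z * pdbar j h z.
Proof. by rewrite pdbarE; exact: wirtM. Qed.
Let pd_ext j (g h : Cn R m -> R[i]) z : (forall z, V z -> g z = h z) -> smooth_on V g -> V z ->
  pd j h z = pd j g z.
Proof. by rewrite pdE; exact: wirt_ext. Qed.
Let pdbar_ext j (g h : Cn R m -> R[i]) z : (forall z, V z -> g z = h z) -> smooth_on V g -> V z ->
  pdbar j h z = pdbar j g z.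
Proof. by rewrite pdbarE; exact: wirt_ext. Qed.
Let pd_sum j (g : 'I_m -> Cn R m -> R[i]) z : (forall k, smooth_on V (g k)) -> V z ->
  pd j (fun z => \sum_k g k z) z = \sum_k pd j (g k) z.
Proof. by rewrite pdE; exact: wirt_sum. Qed.

Let pd_fb p z : V z -> pd p fb z = 0.
Proof. by move=> Vz; rewrite (pd_conj p Sf Vz) f_hol // conjc0. Qed.

(** Since [fb] is antiholomorphic it factors out of the balanced condition. *)
Let bal_hol b z : V z -> \sum_p pd p (fun y => f y * H p b y) z = 0.
Proof.
move=> Vz; have fb0 : fb z != 0 by rewrite conjc_eq0 f_neq0.
apply: (mulfI fb0); rewrite mulr0 -[RHS](bal_del b Vz) mulr_sumr; apply: eq_bigr => p _.
have SfH : smooth_on V (fun y => f y * H p b y) by have S := smoothM openV Sf (SH p b); exact: S.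
have SffH : smooth_on V (fun y => fb y * (f y * H p b y)) by have S := smoothM openV Sfb SfH; exact: S.
rewrite [RHS](@pd_ext p (fun y => fb y * (f y * H p b y)) _ z _ SffH Vz); last first.
  by move=> y _; rewrite /F [in RHS](mulrC (f y)) mulrA.
by rewrite (pdM p Sfb SfH Vz) pd_fb // mul0r add0r.
Qed.

Let Y p q b := pdbar q (H p b).
Let SY p q b : smooth_on V (Y p q b). Proof. exact: Spdbar. Qed.

(** Apply [dbar_q] to [bal_hol], using that [f] is holomorphic and that [dbar_q]
    commutes with [d_p]. *)
Let bal_hol_delbar q b z : V z -> \sum_p pd p (fun y => f y * Y p q b y) z = 0.
Proof.
move=> Vz.
have SfH p : smooth_on V (fun y => f y * H p b y) by have S := smoothM openV Sf (SH p b); exact: S.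
have E p : pd p (fun y => f y * Y p q b y) z = pdbar q (pd p (fun y => f y * H p b y)) z.
  rewrite [in RHS]pdE pdbarE (wirt_comm openV 'i (- 'i) q p (SfH p) Vz) -pdE -pdbarE.
  apply: (pd_ext p _ (Spdbar q (SfH p)) Vz) => y Vy.
  by rewrite (pdbarM q Sf (SH p b) Vy) f_hol // mul0r add0r.
under eq_bigr do rewrite E.
have Ssum := fun p => Spd p (SfH p).
rewrite pdbarE -(wirt_sum openV 'i q (index_enum 'I_m) Ssum Vz) -pdbarE.
have E0 := @pdbar_ext q (fun _ => 0) (fun z => \sum_p pd p (fun y => f y * H p b y) z) z.
rewrite E0 //; first by rewrite pdbarE wirt_cst.
  by move=> y Vy; rewrite bal_hol.
exact: smooth_cst.
Qed.

(** The two balanced conditions remove every term in which [F] is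
    differentiated.  After [dbar_q], by [bal_delbar], only the terms [A] and [B]
    below remain.  In [A] the derivative [d_p] of [F H^{pq}] vanishes by
    [bal_del]; in [B] the conjugate of [f] is grouped with [H^{aq}], where
    [d_p] ignores it, and [f] with [dbar_q H^{pb}], where [bal_hol_delbar]
    applies. *)
Lemma ddbar_inverse_metric a b z : V z ->
  \sum_p \sum_q pd p (pdbar q (fun y => F y * (H a b y * H p q y - H a q y * H p b y))) z =
  F z * (\sum_p \sum_q H p q z * pd p (pdbar q (H a b)) z
         - \sum_p \sum_q pd p (H a q) z * pdbar q (H p b) z).
Proof.
move=> Vz.
pose A p q y := (F y * H p q y) * Y a q b y.
pose B p q y := (fb y * H a q y) * (f y * Y p q b y).
have SA p q : smooth_on V (A p q) by have S := smoothM openV (SFH p q) (SY a q b); exact: S.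
have SfY p q : smooth_on V (fun y => f y * Y p q b y).
  by have S := smoothM openV Sf (SY p q b); exact: S.
have SfbH q : smooth_on V (fun y => fb y * H a q y).
  by have S := smoothM openV Sfb (SH a q); exact: S.
have SB p q : smooth_on V (B p q) by have S := smoothM openV (SfbH q) (SfY p q); exact: S.
have SD p q : smooth_on V (fun y => F y * (H a b y * H p q y - H a q y * H p b y)).
  have S1 := smoothM openV (SFH p q) (SH a b).
  have S2 := smoothZ openV (-1) (smoothM openV (SFH a q) (SH p b)).
  apply: (smooth_ext openV _ (smoothD openV S1 S2)) => y _ /=.
  have E (u v w x t : R[i]) : u * v * w + -1 * (u * x * t) = u * (w * v - x * t) by ring.
  exact: E.
have inner p y : V y ->
    \sum_q pdbar q (fun y => F y * (H a b y * H p q y - H a q y * H p b y)) y =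
    \sum_q A p q y - \sum_q B p q y.
  move=> Vy.
  have E q : pdbar q (fun y => F y * (H a b y * H p q y - H a q y * H p b y)) y =
      pdbar q (fun y => F y * H p q y) y * H a b y + A p q y
      - (pdbar q (fun y => F y * H a q y) y * H p b y + B p q y).
    have S1 := smoothM openV (SFH p q) (SH a b).
    have S2 := smoothM openV (SFH a q) (SH p b).
    have S3 := smoothZ openV (-1) S2.
    rewrite [LHS](@pdbar_ext q _ _ y _ (smoothD openV S1 S3) Vy); last first.
      move=> y' _ /=.
      have E (u v w x t : R[i]) : u * v * w + -1 * (u * x * t) = u * (w * v - x * t) by ring.
      exact: E.
    rewrite [LHS](wirtD 'i q S1 S3 Vy) (wirtZ openV 'i q (-1) S2 Vy) -!pdbarE.
    rewrite (pdbarM q (SFH p q) (SH a b) Vy) (pdbarM q (SFH a q) (SH p b) Vy) mulN1r.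
    congr (_ - (_ + _)); rewrite /B /F /Y.
    have E (u v w x : R[i]) : u * v * w * x = v * w * (u * x) by ring.
    exact: E.
  under eq_bigr do rewrite E.
  rewrite sumrB !big_split /= -!mulr_suml !bal_delbar // !mul0r !add0r.
  by [].
have SP p q : smooth_on V (pdbar q (fun y => F y * (H a b y * H p q y - H a q y * H p b y))).
  exact: Spdbar.
have outer p : \sum_q pd p (pdbar q (fun y => F y * (H a b y * H p q y - H a q y * H p b y))) z =
    \sum_q pd p (A p q) z - \sum_q pd p (B p q) z.
  rewrite -(pd_sum p (SP p) Vz).
  have SAs := smooth_sum openV (index_enum 'I_m) (SA p).
  have SBs := smooth_sum openV (index_enum 'I_m) (SB p).
  have SBn := smoothZ openV (-1) SBs.
  rewrite [LHS](@pd_ext p _ _ z _ (smoothD openV SAs SBn) Vz); last first.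
    by move=> y Vy /=; rewrite inner // mulN1r.
  rewrite pdE [LHS](wirtD (- 'i) p SAs SBn Vz) (wirtZ openV (- 'i) p (-1) SBs Vz) mulN1r.
  by rewrite -pdE (pd_sum p (SA p) Vz) (pd_sum p (SB p) Vz).
under eq_bigr do rewrite outer.
rewrite sumrB mulrBr; congr (_ - _).
  rewrite exchange_big [in RHS]exchange_big mulr_sumr; apply: eq_bigr => q _.
  have E p : pd p (A p q) z = pd p (fun y => F y * H p q y) z * Y a q b z
      + F z * (H p q z * pd p (pdbar q (H a b)) z).
    by rewrite (pdM p (SFH p q) (SY a q b) Vz) [F z * (_ * _)]mulrA.
  under eq_bigr do rewrite E.
  by rewrite big_split /= -mulr_suml bal_del // mul0r add0r -mulr_sumr.
rewrite exchange_big [in RHS]exchange_big mulr_sumr; apply: eq_bigr => q _.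
have E p : pd p (B p q) z = F z * (pd p (H a q) z * pdbar q (H p b) z)
    + fb z * H a q z * pd p (fun y => f y * Y p q b y) z.
  rewrite (pdM p (SfbH q) (SfY p q) Vz) (pdM p Sfb (SH a q) Vz) pd_fb // mul0r add0r /F /Y.
  congr (_ + _).
  have E (u v w x : R[i]) : u * v * (w * x) = w * u * (v * x) by ring.
  exact: E.
under eq_bigr do rewrite E.
by rewrite big_split /= -2!mulr_sumr bal_hol_delbar // mulr0 addr0.
Qed.

End InverseMetric.

(** * Curvature and torsion in terms of the inverse metric *)

(** At a point, [Gp], [Gb], [Hp], [Hb] stand for the first derivatives of a
    matrix [G] and of its inverse [H], and [HPQ p q] for [d_p dbar_q H]; the
    hypotheses are the derivatives of [H G = 1]. *)
Section PointAlgebra.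
Variables (K : fieldType) (m : nat).
Variables (G H : 'M[K]_m) (Gp Gb Hp Hb : 'I_m -> 'M[K]_m) (HPQ : 'I_m -> 'I_m -> 'M[K]_m).
Hypothesis GH : G *m H = 1%:M.
Hypothesis HpE : forall p, Hp p *m G + H *m Gp p = 0.
Hypothesis HbE : forall q, Hb q *m G + H *m Gb q = 0.
Hypothesis char2 : (2 : K) != 0.

Lemma GHp p : G *m Hp p = - (Gp p *m H).
Proof.
have E : Hp p *m G = - (H *m Gp p) by apply/eqP; rewrite -subr_eq0 opprK HpE.
transitivity (G *m (Hp p *m G) *m H); first by rewrite -!mulmxA GH mulmx1.
by rewrite E mulmxN mulNmx !mulmxA GH mul1mx.
Qed.

Lemma HbG q : Hb q *m G = - (H *m Gb q).
Proof. by apply/eqP; rewrite -subr_eq0 opprK HbE. Qed.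

Lemma swap_sum4 (Z : 'I_m -> 'I_m -> 'I_m -> 'I_m -> K) :
  \sum_p \sum_q \sum_r \sum_s Z q p s r = \sum_p \sum_q \sum_r \sum_s Z p q r s.
Proof.
rewrite exchange_big; apply: eq_bigr => p _; apply: eq_bigr => q _.
by rewrite exchange_big.
Qed.

Definition evolution_mx : 'M[K]_m := \matrix_(a, b)
  (\sum_p \sum_q H p q * HPQ p q a b - \sum_p \sum_q Hp p a q * Hb q p b).

(** The curvature term contains the contraction of [d_p g] and [dbar_q g] with
    [H^{pq}], the left-hand side that of [d_p H^{aq}] and [dbar_q H^{pb}]; half
    the square of the torsion is the difference of the two. *)
Lemma evolution_algebra k j :
  (G *m evolution_mx *m G) k j =
  \sum_p \sum_q \sum_n H p q * G k n * (HPQ p q *m G + Hp p *m Gb q) n j +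
  2^-1 * \sum_p \sum_q \sum_r \sum_s H p r * H q s *
     (Gp p k q - Gp q k p) * (Gb r s j - Gb s r j).
Proof.
pose C1 := \sum_p \sum_q H p q * (G *m HPQ p q *m G) k j.
pose C2 := \sum_p \sum_q H p q * (Gp p *m H *m Gb q) k j.
pose C3 := \sum_p \sum_s (Gp p *m H) k s * (H *m Gb s) p j.
(* the curvature term is [C1 - C2]; the four products in the squared torsion
   reduce to two by renaming indices, and their half is [C2 - C3] *)
transitivity (C1 - C3); last first.
  transitivity ((C1 - C2) + (C2 - C3)); first by rewrite addrA subrK.
  congr (_ + _).
    rewrite /C1 /C2 -sumrB; apply: eq_bigr => p _; rewrite -sumrB; apply: eq_bigr => q _.
    rewrite -mulrBr; transitivity (H p q * (G *m (HPQ p q *m G + Hp p *m Gb q)) k j).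
      congr (_ * _); rewrite mulmxDr mulmxA [G *m (Hp p *m _)]mulmxA GHp mulNmx.
      by rewrite !mxE.
    by rewrite mxE mulr_sumr; apply: eq_bigr => n _; rewrite mulrA.
  pose X p q r s := H p r * H q s * Gp p k q * Gb r s j.
  pose Y p q r s := H p r * H q s * Gp p k q * Gb s r j.
  have -> : C2 = \sum_p \sum_q \sum_r \sum_s X p q r s.
    apply: eq_bigr => p _; rewrite exchange_big; apply: eq_bigr => r _.
    rewrite -mulmxA mxE mulr_sumr; apply: eq_bigr => q _; rewrite mxE !mulr_sumr.
    by apply: eq_bigr => s _; rewrite /X; ring.
  have -> : C3 = \sum_p \sum_q \sum_r \sum_s Y p q r s.
    apply: eq_bigr => p _; rewrite [RHS]exchange_big /=.
    transitivity (\sum_s \sum_r \sum_q Y p q r s).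
      apply: eq_bigr => s _; rewrite !mxE mulr_sumr; apply: eq_bigr => r _.
      by rewrite mulr_suml; apply: eq_bigr => q _; rewrite /Y; ring.
    rewrite exchange_big; apply: eq_bigr => r _.
    by rewrite exchange_big.
  apply: (mulfI char2); rewrite mulrA divff // mul1r mulr_natl mulr2n.
  rewrite -{2}(swap_sum4 X) -{2}(swap_sum4 Y).
  rewrite -!sumrB -big_split; apply: eq_bigr => p _.
  rewrite -!sumrB -big_split; apply: eq_bigr => q _.
  rewrite -!sumrB -big_split; apply: eq_bigr => r _.
  rewrite -!sumrB -big_split; apply: eq_bigr => s _.
  by rewrite /X /Y /=; ring.
have -> : evolution_mx = \sum_p \sum_q H p q *: HPQ p q -
    \sum_p \sum_q (\matrix_(a, b) (Hp p a q * Hb q p b)).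
  apply/matrixP => a b; rewrite !mxE !summxE; congr (_ - _).
    by apply: eq_bigr => p _; rewrite summxE; apply: eq_bigr => q _; rewrite mxE.
  by apply: eq_bigr => p _; rewrite summxE; apply: eq_bigr => q _; rewrite mxE.
rewrite mulmxBr mulmxBl mxE [X in _ + X]mxE; congr (_ - _).
  rewrite mulmx_sumr mulmx_suml summxE; apply: eq_bigr => p _.
  rewrite mulmx_sumr mulmx_suml summxE; apply: eq_bigr => q _.
  by rewrite -scalemxAr -scalemxAl mxE.
rewrite mulmx_sumr mulmx_suml summxE; apply: eq_bigr => p _.
rewrite mulmx_sumr mulmx_suml summxE; apply: eq_bigr => q _.
have -> : \matrix_(a, b) (Hp p a q * Hb q p b) = col q (Hp p) *m row p (Hb q).
  by apply/matrixP => a b; rewrite !mxE big_ord1 !mxE.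
have -> : G *m (col q (Hp p) *m row p (Hb q)) *m G = col q (G *m Hp p) *m row p (Hb q *m G).
  rewrite row_mul !mulmxA; congr (_ *m _ *m _).
  by apply/matrixP => a b; rewrite !mxE; apply: eq_bigr => c _; rewrite mxE.
rewrite GHp HbG.
by rewrite !mxE big_ord1 !mxE mulrNN.
Qed.

End PointAlgebra.

Section Curvature.
Variables (R : realType) (m : nat) (V : set (Cn R m)).
Hypothesis openV : open V.
Variable G : Cn R m -> 'M[R[i]]_m.
Hypothesis SG : forall k j, smooth_on V (fun z => G z k j).
Hypothesis SH : forall a b, smooth_on V (fun z => invmx (G z) a b).
Hypothesis unitG : forall z, V z -> G z \in unitmx.
Hypothesis hermG : forall z k j, V z -> G z k j = (G z j k)^*%C.

Let h a b z := invmx (G z) a b.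
Let g k j z := G z k j.

Lemma wirt_invmx s p n j z : V z ->
  \sum_l (wirt s p (h n l) z * g l j z + h n l z * wirt s p (g l j) z) = 0.
Proof.
move=> Vz.
have S l : smooth_on V (fun z => h n l z * g l j z).
  by have S := smoothM openV (SH n l) (SG l j); exact: S.
have E := wirt_sum openV s p (index_enum 'I_m) S Vz.
rewrite -[RHS](wirt_cst s p ((n == j)%:R) z).
rewrite [RHS](@wirt_ext _ _ _ openV s p (fun z => \sum_l h n l z * g l j z) _ z); last exact: Vz.
- by rewrite E; apply: eq_bigr => l _; rewrite (wirtM s p (SH n l) (SG l j) Vz).
- move=> y Vy; have /matrixP/(_ n j) := mulVmx (unitG Vy).
  by rewrite !mxE.
- by have SS := smooth_sum openV (index_enum 'I_m) S; exact: SS.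
Qed.

(** The bracket is the right-hand side found in [ddbar_inverse_metric].  The
    metric being Hermitian, [dbar] of [g] is the conjugate of [d] of its transpose,
    which makes the second factor of [evolution_algebra] a conjugate torsion. *)
Lemma curvature_evolution k j z : V z ->
  \sum_a \sum_b G z k a * (\sum_p \sum_q h p q z * pd p (pdbar q (h a b)) z
      - \sum_p \sum_q pd p (h a q) z * pdbar q (h p b) z) * G z b j =
  chern_ricci G z k j + 2^-1 * torsion_sq G z k j.
Proof.
move=> Vz.
pose Gp p := \matrix_(k, j) pd p (g k j) z : 'M[R[i]]_m.
pose Gb q := \matrix_(k, j) pdbar q (g k j) z : 'M[R[i]]_m.
pose Hp p := \matrix_(a, b) pd p (h a b) z : 'M[R[i]]_m.
pose Hb q := \matrix_(a, b) pdbar q (h a b) z : 'M[R[i]]_m.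
pose HPQ p q := \matrix_(a, b) pd p (pdbar q (h a b)) z : 'M[R[i]]_m.
have uG := unitG Vz.
have HpE p : Hp p *m G z + invmx (G z) *m Gp p = 0.
  apply/matrixP => n l; rewrite !mxE -big_split /= -[RHS](wirt_invmx (- 'i) p n l Vz).
  by apply: eq_bigr => l' _; rewrite !mxE pdE.
have HbE q : Hb q *m G z + invmx (G z) *m Gb q = 0.
  apply/matrixP => n l; rewrite !mxE -big_split /= -[RHS](wirt_invmx 'i q n l Vz).
  by apply: eq_bigr => l' _; rewrite !mxE pdbarE.
have two : (2 : R[i]) != 0 by rewrite pnatr_eq0.
transitivity ((G z *m evolution_mx (invmx (G z)) Hp Hb HPQ *m G z) k j).
  rewrite exchange_big mxE; apply: eq_bigr => b _; rewrite mxE mulr_suml; apply: eq_bigr => a _.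
  congr (_ * _ * _); rewrite mxE; congr (_ - _); apply: eq_bigr => p _; apply: eq_bigr => q _.
    by rewrite !mxE.
  by rewrite !mxE.
rewrite (evolution_algebra HPQ (mulmxV uG) HpE HbE two); congr (_ + _ * _); last first.
  have E u v w : pdbar u (g v w) z = (pd u (g w v) z)^*%C.
    rewrite -(pdbar_conj u (SG w v) Vz) pdbarE.
    by apply: (wirt_ext openV 'i u _ (smooth_conj openV (SG w v)) Vz) => y Vy; rewrite -hermG.
  have GpE p u v : Gp p u v = pd p (g u v) z by exact: mxE.
  have GbE0 p u v : Gb p u v = pdbar p (g u v) z.
    by rewrite /Gb mxE.
  have GbE p u v := etrans (GbE0 p u v) (E p u v).
  have T1 p q : Gp p k q - Gp q k p = torsion G z k p q.
    exact (congr2 (fun x y => x - y) (GpE p k q) (GpE q k p)).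
  have T2 r s : Gb r s j - Gb s r j = (torsion G z j r s)^*%C.
    apply: etrans (congr2 (fun x y => x - y) (GbE r s j) (GbE s r j)) _.
    exact (esym (rmorphB (@conjc R) (pd r (g j s) z) (pd s (g j r) z))).
  apply: eq_bigr => p _; apply: eq_bigr => q _; apply: eq_bigr => r _; apply: eq_bigr => s _.
  by rewrite T1 T2.
rewrite /chern_ricci -sumrN; apply: eq_bigr => p _; rewrite -sumrN; apply: eq_bigr => q _.
rewrite -sumrN; apply: eq_bigr => n _; rewrite -mulrN; congr (_ * _).
have Spd l : smooth_on V (pd p (h n l)).
  by have S := smooth_wirt openV (- 'i) p (SH n l); rewrite pdE; exact: S.
pose N l y := pd p (h n l) y * g l j y.
have SN l : smooth_on V (N l) by have S := smoothM openV (Spd l) (SG l j); exact: S.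
have SNs := smooth_sum openV (index_enum 'I_m) SN.
have E0 : pdbar q (fun w => \sum_l invmx (G w) n l * pd p (fun u => G u l j) w) z =
    - pdbar q (fun w => \sum_l N l w) z.
  rewrite pdbarE -mulN1r -(wirtZ openV 'i q (-1) SNs Vz).
  apply: (wirt_ext openV 'i q _ (smoothZ openV (-1) SNs) Vz) => y Vy.
  rewrite mulN1r; apply/esym/eqP; rewrite -subr_eq0 opprK; apply/eqP.
  rewrite -big_split /= -[RHS](wirt_invmx (- 'i) p n j Vy); apply: eq_bigr => l _.
  by rewrite /N pdE addrC.
rewrite E0 opprK pdbarE (wirt_sum openV 'i q (index_enum 'I_m) SN Vz) -pdbarE !mxE -big_split.
apply: eq_bigr => l _; rewrite !mxE /N pdbarE (wirtM 'i q (Spd l) (SG l j) Vz) -pdbarE.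
congr (_ * _ + _).
rewrite [in RHS]pdE [in RHS]pdbarE (wirt_comm openV 'i (- 'i) q p (SH n l) Vz).
by rewrite pdE pdbarE.
Qed.

End Curvature.

(** * Time derivative of a metric from that of its inverse *)

Section TimeDerivative.
Variables (R : realType) (I : set R) (t : R).
Hypothesis It : I t.
Hypothesis Iproper : ProperFilter (within I t^').

Lemma is_deriv_in_ext (f g : R -> R[i]) l : (forall s, I s -> f s = g s) ->
  is_deriv_in I f t l -> is_deriv_in I g t l.
Proof.
move=> fg; apply: is_deriv_eq; last exact: fg.
have := @near_within R I t; apply: filterS => s [Is _]; exact: fg.
Qed.

Lemma is_derivZ (k : R[i]) (f : R -> R[i]) l : is_deriv_in I f t l ->
  is_deriv_in I (fun s => k * f s) t (k * l).
Proof.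
by move=> fl; have := is_derivM (is_deriv_cst I t k) fl; rewrite mul0r add0r.
Qed.

Lemma is_deriv_sum (J : Type) (r : seq J) (f : J -> R -> R[i]) (l : J -> R[i]) :
  (forall j, is_deriv_in I (f j) t (l j)) ->
  is_deriv_in I (fun s => \sum_(j <- r) f j s) t (\sum_(j <- r) l j).
Proof.
move=> fl; elim: r => [|j r IH].
  rewrite big_nil; apply: (is_deriv_in_ext (f := fun _ => 0)); last exact: is_deriv_cst.
  by move=> s _; rewrite big_nil.
rewrite big_cons; apply: (is_deriv_in_ext (f := fun s => f j s + \sum_(j <- r) f j s)).
  by move=> s _; rewrite big_cons.
exact: is_derivD (fl j) IH.
Qed.

(** Differentiate [G G^-1 = 1]. *)
Lemma is_deriv_of_invmx (m : nat) (G : R -> 'M[R[i]]_m) (Hd : 'M[R[i]]_m) k j :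
    (forall s, I s -> G s \in unitmx) ->
    (forall k j, derivable_in I (fun s => G s k j) t) ->
    (forall a b, is_deriv_in I (fun s => invmx (G s) a b) t (Hd a b)) ->
  is_deriv_in I (fun s => G s k j) t (- \sum_a \sum_b G t k a * Hd a b * G t b j).
Proof.
move=> uG dG dH.
pose Gd : 'M[R[i]]_m := \matrix_(k, j) deriv_in I (fun s => G s k j) t.
have GdE k' j' : is_deriv_in I (fun s => G s k' j') t (Gd k' j').
  by rewrite mxE; exact: (derivableP Iproper (dG k' j')).
have E : Gd *m invmx (G t) + G t *m Hd = 0.
  apply/matrixP => p q; rewrite !mxE -big_split /=.
  have D := is_deriv_sum (r := index_enum 'I_m) (fun b => is_derivM (GdE p b) (dH b q)).
  apply: (is_deriv_unique Iproper D).
  apply: (is_deriv_in_ext (f := fun _ => (p == q)%:R)); last exact: is_deriv_cst.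
  by move=> s Is; have /matrixP/(_ p q) := mulmxV (uG s Is); rewrite !mxE => ->.
have GdG : Gd = - (G t *m Hd *m G t).
  have uGt := uG t It; rewrite -[LHS]mulmx1 -(mulVmx uGt) mulmxA.
  by rewrite (eqP (_ : Gd *m invmx (G t) == - (G t *m Hd))) ?mulNmx // -subr_eq0 opprK E.
have -> : - (\sum_a \sum_b G t k a * Hd a b * G t b j) = Gd k j; last exact: GdE.
rewrite GdG !mxE exchange_big; congr (- _); apply: eq_bigr => b _.
by rewrite mxE mulr_suml.
Qed.

End TimeDerivative.
Arguments is_derivZ [R I t] k [f l].

(** * Differentiating forms coefficientwise *)

Section SmoothForms.
Variables (R : realType) (m : nat) (V : set (Cn R m)).
Hypothesis openV : open V.
Implicit Types (be : Cn R m -> extalg R m) (c x : ext R m) (U P : bideg m) (s : R[i]).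
Implicit Types (a b j p q : 'I_m).

Definition smooth_form be := forall P, smooth_on V (fun z => be z P).

Definition wirt_form s j be z : ext R m :=
  [ffun P : bideg m => wirt s j (fun w => be w P) z] : extalg R m.

(** Multiplication by a constant form is a linear combination of coefficients
    with constant weights, hence commutes with all derivatives. *)
Lemma coef_mulE c U x : coef U (c * x) = \sum_P coef U (c * mono P) * coef P x.
Proof.
rewrite {1}(ext_sum_mono x) mulr_sumr coef_sum; apply: eq_bigr => P _.
by rewrite -scalerAr coefZ mulrC.
Qed.

Lemma smooth_coef_mul c U be : smooth_form be ->
  smooth_on V (fun z => coef U (c * (be z : ext R m))).
Proof.
move=> Sbe.
have S P := smoothZ openV (coef U (c * mono P)) (Sbe P).
have SS := smooth_sum openV (index_enum (bideg m)) S.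
by apply: (smooth_ext openV _ SS) => z _; rewrite coef_mulE.
Qed.

Lemma wirt_coef_mul s j c U be z : smooth_form be -> V z ->
  wirt s j (fun w => coef U (c * (be w : ext R m))) z = coef U (c * wirt_form s j be z).
Proof.
move=> Sbe Vz.
have S P := smoothZ openV (coef U (c * mono P)) (Sbe P).
have SS := smooth_sum openV (index_enum (bideg m)) S.
rewrite (wirt_ext openV s j (f := fun z => \sum_P coef U (c * mono P) * be z P) _ SS Vz); last first.
  by move=> y _; rewrite [RHS]coef_mulE.
rewrite (wirt_sum openV s j (index_enum (bideg m)) S Vz) [RHS]coef_mulE; apply: eq_bigr => P _.
by rewrite (wirtZ openV s j _ (Sbe P) Vz); congr (_ * _); rewrite /coef ffunE.
Qed.

Lemma delE be z : del be z = \sum_j e_z j * wirt_form (- 'i) j be z :> ext R m.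
Proof.
by rewrite /del; apply: eq_bigr => j _; rewrite -wedgeE /wirt_form -pdE.
Qed.

Lemma delbarE be z : delbar be z = \sum_j e_zb j * wirt_form 'i j be z :> ext R m.
Proof.
by rewrite /delbar; apply: eq_bigr => j _; rewrite -wedgeE /wirt_form -pdbarE.
Qed.

Lemma wirt_form_ext s j be be' z : (forall y, V y -> be y = be' y) -> smooth_form be -> V z ->
  wirt_form s j be' z = wirt_form s j be z.
Proof.
move=> E Sbe Vz; apply/ffunP => P; rewrite !ffunE.
by apply: (wirt_ext openV s j _ (Sbe P) Vz) => y Vy; rewrite E.
Qed.

Lemma ext_d_ext be be' z : (forall y, V y -> be y = be' y) -> smooth_form be -> V z ->
  ext_d be' z = ext_d be z.
Proof.
move=> E Sbe Vz; rewrite /ext_d !delE !delbarE.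
by congr (_ + _); apply: eq_bigr => j _; rewrite (wirt_form_ext _ j E Sbe Vz).
Qed.

Lemma has_type_wirt_form (k l : nat) s j be z : (forall y, V y -> has_type k l (be y)) -> V z ->
  has_type k l (wirt_form s j be z).
Proof.
move=> Hbe Vz A B; rewrite ffunE => nz.
have [//|nAB] := pselect (#|A| = k /\ #|B| = l).
case/eqP: nz; rewrite -[RHS](wirt_cst s j 0 z).
apply: (wirt_ext openV s j _ (smooth_cst openV 0) Vz) => y Vy.
by apply/esym/eqP; apply: contrapT => /negP /(Hbe y Vy).
Qed.

Lemma top_eq0 (k l : nat) x : has_type k l x -> (k != m) || (l != m) -> top x = 0.
Proof.
move=> /has_typeE Hx kl; apply/eqP; apply: contrapT => /negP /Hx [/= kE lE].
by move: kl; rewrite -kE -lE !cardsT !card_ord eqxx.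
Qed.

Section Closed.
Variable be : Cn R m -> extalg R m.
Hypothesis Sbe : smooth_form be.
Hypothesis m_gt0 : (0 < m)%N.
Hypothesis be_type : forall y, V y -> has_type (m - 1) (m - 1) (be y).

Let m1 : (m - 1 != m)%N. Proof. by rewrite neq_ltn ltn_subrL m_gt0. Qed.

(** Multiplying [d be] by [dzbar^b] selects the part of type (m, m-1), that is
    [del be]. *)
Lemma closed_del b z : V z -> ext_d be z = 0 ->
  \sum_j pd j (fun w => top (e_z j * e_zb b * (be w : ext R m))) z = 0.
Proof.
move=> Vz closed.
have : top (e_zb b * (ext_d be z : ext R m)) = 0 by rewrite closed mulr0 /top coef0.
rewrite /ext_d delE delbarE mulrDr topD !mulr_sumr !top_sum.
rewrite [X in _ + X]big1 ?addr0 => [E|j _]; last first.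
  have Tb := @has_type_zb R m.
  have T := @has_typeM R m _ _ _ _ _ _ (Tb b) (@has_typeM R m _ _ _ _ _ _ (Tb j)
    (@has_type_wirt_form _ _ 'i j be z be_type Vz)).
  by apply: (top_eq0 T); rewrite !add0n m1.
transitivity (- \sum_j top (e_zb b * (e_z j * wirt_form (- 'i) j be z))).
  2: by rewrite E oppr0.
rewrite -sumrN; apply: eq_bigr => j _.
rewrite pdE (wirt_coef_mul (- 'i) j _ btop Sbe Vz) mulrA zb_z mulNr.
by rewrite -[X in - top X]scaleN1r topZ mulN1r opprK.
Qed.

(** Multiplying [d be] by [dz^a] selects [delbar be]. *)
Lemma closed_delbar a z : V z -> ext_d be z = 0 ->
  \sum_j pdbar j (fun w => top (e_z a * e_zb j * (be w : ext R m))) z = 0.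
Proof.
move=> Vz closed.
have : top (e_z a * (ext_d be z : ext R m)) = 0 by rewrite closed mulr0 /top coef0.
rewrite /ext_d delE delbarE mulrDr topD !mulr_sumr !top_sum.
rewrite [X in X + _]big1 ?add0r => [E|j _]; last first.
  have Tz := @has_type_z R m.
  have T := @has_typeM R m _ _ _ _ _ _ (Tz a) (@has_typeM R m _ _ _ _ _ _ (Tz j)
    (@has_type_wirt_form _ _ (- 'i) j be z be_type Vz)).
  by apply: (top_eq0 T); rewrite !add0n m1 orbT.
rewrite -[RHS]E; apply: eq_bigr => j _.
by rewrite pdbarE (wirt_coef_mul 'i j _ btop Sbe Vz) mulrA.
Qed.

End Closed.

Lemma smooth_delbar be : smooth_form be -> smooth_form (delbar be).
Proof.
move=> Sbe P.
have S j : smooth_on V (fun z => coef P (e_zb j * wirt_form 'i j be z)).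
  apply: smooth_coef_mul => Q.
  by apply: (smooth_ext openV _ (smooth_wirt openV 'i j (Sbe Q))) => y _; rewrite ffunE.
have SS := smooth_sum openV (index_enum 'I_m) S.
by apply: (smooth_ext openV _ SS) => y _; rewrite -coef_sum -delbarE.
Qed.

(** Derivatives commute with multiplication by constant forms, so the coefficients
    of [del delbar be] are second derivatives of those of [be]. *)
Lemma top_ddbar a b be z : smooth_form be -> V z ->
  top (e_z a * e_zb b * (del (delbar be) z : ext R m)) =
  \sum_p \sum_q pd p (pdbar q (fun w =>
    top (e_z a * e_zb b * (e_z p * e_zb q) * (be w : ext R m)))) z.
Proof.
move=> Sbe Vz; rewrite delE mulr_sumr top_sum; apply: eq_bigr => p _.
have Sdb := smooth_delbar Sbe.
transitivity (pd p (fun w => top (e_z a * e_zb b * e_z p * (delbar be w : ext R m))) z).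
  by rewrite pdE (wirt_coef_mul (- 'i) p _ btop Sdb Vz) mulrA.
have S q : smooth_on V (pdbar q (fun w =>
    top (e_z a * e_zb b * (e_z p * e_zb q) * (be w : ext R m)))).
  by have S := smooth_wirt openV 'i q (smooth_coef_mul (e_z a * e_zb b * (e_z p * e_zb q)) btop Sbe); exact: S.
have SS := smooth_sum openV (index_enum 'I_m) S.
rewrite pdE -(wirt_sum openV (- 'i) p (index_enum 'I_m) S Vz).
apply: (wirt_ext openV (- 'i) p _ SS Vz) => y Vy.
rewrite delbarE mulr_sumr top_sum; apply: eq_bigr => q _.
by rewrite pdbarE [LHS](wirt_coef_mul 'i q _ btop Sbe Vy) !mulrA.
Qed.

End SmoothForms.

(** * The flow in a chart *)

Section Local.
Variables (R : realType) (m : nat) (I : set R) (V : set (Cn R m)).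
Hypothesis openV : open V.
Hypothesis properI : forall t, I t -> ProperFilter (within I t^').
Hypothesis m2 : (2 <= m)%N.
Implicit Types (P Q U : bideg m) (a b j k p q : 'I_m).

Section WedgePowers.
Variable n : nat.
Definition class_C_form (be : R -> Cn R m -> extalg R m) :=
  forall P, class_C n I V (fun t z => be t z P).

Lemma class_C_wedge be ga : class_C_form be -> class_C_form ga ->
  class_C_form (fun t z => wedge (be t z) (ga t z)).
Proof.
move=> Cbe Cga U.
have C P Q := class_CM openV properI (class_C_cst openV properI n ((bcup P Q == U)%:R * bsgn R P Q)) (class_CM openV properI (Cbe P) (Cga Q)).
have C1 P := class_C_sum openV properI (index_enum (bideg m)) (C P).
have C2 := class_C_sum openV properI (index_enum (bideg m)) C1.
apply: (class_C_ext openV properI _ C2) => t z _ _.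
by rewrite (wedgeE (be t z : ext R m)) -[RHS]/(coef U _) {1}/GRing.mul /= coef_emul.
Qed.

Lemma class_C_wpow be l : class_C_form be -> class_C_form (fun t z => wpow (be t z) l).
Proof.
move=> Cbe; elim: l => [|l IH].
  by move=> P; exact: (class_C_cst openV properI n).
exact: class_C_wedge Cbe IH.
Qed.

End WedgePowers.

Variables (Om : Cn R m -> extalg R m) (om : R -> Cn R m -> extalg R m).
Hypothesis Om_type : forall z, V z -> has_type m 0 (Om z).
Hypothesis Om_smooth : forall P, smooth_on V (fun z => Om z P).
Hypothesis Om_hol : forall z, V z -> delbar Om z = 0.
Hypothesis Om_neq0 : forall z, V z -> Om z != 0.
Hypothesis om_pos : forall t z, I t -> V z -> hermitian_pos (om t z).
Hypothesis om_smooth : forall P, smooth_flow_on I V (fun t z => om t z P).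

Let r t z := form_norm (Om z) (om t z).
Let f z := hol_coef (Om z).
Let F z := f z * (f z)^*%C.
Let kappa : R[i] := 'i ^+ (m ^ 2) * m`!%:R.

Let r_gt0 t z (It : I t) (Vz : V z) : 0 < r t z :=
  form_norm_gt0 (Om_type Vz) (om_pos It Vz) (Om_neq0 Vz).

Let Sf : smooth_on V f. Proof. exact: Om_smooth. Qed.

Let f_neq0 z : V z -> f z != 0.
Proof. by move=> Vz; exact: hol_coef_neq0 (Om_type Vz) (Om_neq0 Vz). Qed.

Let kappa_neq0 : kappa != 0.
Proof. by rewrite mulf_neq0 ?i_exp_neq0 ?fact_neq0. Qed.

(** Read off from the coefficient of [dz^1 /\ ... /\ dz^m /\ dzbar^q] in
    [delbar Om]. *)
Let f_hol q z : V z -> pdbar q f z = 0.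
Proof.
move=> Vz.
have : coef (finset.setT, [set q]%SET) (delbar Om z : ext R m) = 0 by rewrite Om_hol // coef0.
rewrite delbarE coef_sum (bigD1 q) //= big1 ?addr0; last first.
  move=> j jq; have /(@has_type_hol R m) -> := @has_type_wirt_form _ _ _ openV _ _ 'i j Om z Om_type Vz.
  rewrite -scalerAr coefZ e_zb_mono coefZ coef_mono xpair_eqE finset.setU0.
  by rewrite (inj_eq set1_inj) (eq_sym q) (negPf jq) andbF !mulr0.
have /(@has_type_hol R m) -> := @has_type_wirt_form _ _ _ openV _ _ 'i q Om z Om_type Vz.
rewrite -scalerAr coefZ e_zb_mono coefZ coef_mono finset.setU0 eqxx mulr1 inE /= mul1r.
move=> /eqP; rewrite mulf_eq0 signr_eq0 orbF => /eqP E; rewrite -E.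
by rewrite /coef ffunE pdbarE.
Qed.

Let class_C_f n : class_C n I V (fun _ => f).
Proof. exact: (class_C_stopped openV properI (Logic.I : setT (0 : R)) (Sf n)). Qed.

(** [r^2] is a quotient of smooth functions by [form_norm_top]. *)
Lemma class_C_norm n : class_C n I V (fun t z => (r t z)%:C).
Proof.
apply: (class_C_sqr_root openV properI r_gt0).
have om_n : class_C_form n om by move=> P; exact: om_smooth.
have CT : class_C n I V (fun t z => top (wpow (om t z) m : ext R m)).
  exact: (class_C_wpow m om_n btop).
have T0 t z : I t -> V z -> top (wpow (om t z) m : ext R m) != 0.
  move=> It Vz; have [_ [D D0 ->]] := hermitian_pos_top (om_pos It Vz).
  by rewrite mulf_neq0 ?kappa_neq0 // (inj_eq (@complexI _) _ 0) lt0r_neq0.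
have CF := class_CM openV properI (class_C_f n) (class_C_conj openV properI (class_C_f n)).
have C := class_CM openV properI (class_CM openV properI (class_C_cst openV properI n kappa) CF) (class_CV openV properI T0 CT).
apply: (class_C_ext openV properI _ C) => t z It Vz.
have E := form_norm_top (Om_type Vz) (om_pos It Vz).
by rewrite -/kappa in E; rewrite -E mulfK ?T0 // -rmorphXn.
Qed.

Let eta t z := (r t z)%:C *: om t z.

Lemma class_C_rescaled n : class_C_form n eta.
Proof.
move=> P; apply: (class_C_ext openV properI _ (class_CM openV properI (class_C_norm n) (om_smooth P n))) => t z _ _.
by rewrite ffunE.
Qed.

Lemma rescaled_pos t z : I t -> V z -> hermitian_pos (eta t z).
Proof. by move=> It Vz; have H := hermitian_posZ (om_pos It Vz) (r_gt0 It Vz); exact: H. Qed.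

(** With [eta = r om], homogeneity gives [||Om||_eta^2 = r^2 r^-m], and
    [r^2 r^-m r^(m-1) = r]. *)
Lemma rescaled_balanced_form t z : I t -> V z ->
  (form_norm (Om z) (eta t z) ^+ 2)%:C *: wpow (eta t z) (m - 1) =
  (r t z)%:C *: wpow (om t z) (m - 1).
Proof.
move=> It Vz; rewrite wpowZ scalerA -rmorphXn -rmorphM; congr (_%:C *: _).
have r0 := r_gt0 It Vz; have E := form_norm_scale (Om_type Vz) (om_pos It Vz) r0.
apply: (mulIf (lt0r_neq0 r0)); rewrite -mulrA -exprSr.
have -> : (m - 1).+1 = m by lia.
by rewrite E expr2.
Qed.

Section FixedTime.
Variable t : R.
Hypothesis It : I t.

Let al s z := (r s z)%:C *: wpow (om s z) (m - 1).

Lemma smooth_balanced_form : smooth_form V (al t).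
Proof.
move=> P n.
have om_n : class_C_form n om by move=> Q; exact: om_smooth.
have C := class_CM openV properI (class_C_norm n) (class_C_wpow (m - 1) om_n P).
apply: (class_C_ext openV (fun t _ => proper_within_setT t) _
  (class_C_stopped openV (fun t _ => proper_within_setT t) It C)) => s z _ _.
by rewrite ffunE.
Qed.

Let g s z := metric_mx (eta s z).
Let h s a b z := invmx (g s z) a b.

(* the constants of [rescaled_top1] and, further below, [rescaled_top2] *)
Let k1 : R[i] := kappa^-1 * ('i * m%:R).

(** [F H] is linear in the evolving form [r om^(m-1)], which is why the flow
    equation gives the time derivative of [H] directly. *)
Let F_h s a b z : I s -> V z -> F z * h s a b z = k1 * top (e_z a * e_zb b * (al s z : ext R m)).
Proof.
move=> Is Vz.
have E := rescaled_top1 m2 (Om_type Vz) (om_pos Is Vz) (Om_neq0 Vz) a b.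
have T : top (e_z a * e_zb b * (al s z : ext R m)) =
    (r s z)%:C * top (e_z a * e_zb b * (wpow (om s z) (m - 1) : ext R m)).
  by rewrite /al -escaleE -scalerAr topZ.
apply: (mulfI kappa_neq0); rewrite T -[LHS]E /k1.
have Hk (x y u : R[i]) : u != 0 -> x * y = u * (u^-1 * x * y) by move=> u0; field.
exact (Hk _ _ _ kappa_neq0).
Qed.

Let F_neq0 z : V z -> F z != 0.
Proof. by move=> Vz; rewrite mulf_neq0 ?conjc_eq0 ?f_neq0. Qed.

Let hE s a b z : I s -> V z ->
  h s a b z = (F z)^-1 * (k1 * top (e_z a * e_zb b * (al s z : ext R m))).
Proof. by move=> Is Vz; rewrite -F_h // mulKf ?F_neq0. Qed.

Let SF : smooth_on V F.
Proof. by have S := smoothM openV Sf (smooth_conj openV Sf); exact: S. Qed.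

Let Sh a b : smooth_on V (h t a b).
Proof.
have SFV : smooth_on V (fun z => (F z)^-1).
  move=> n; apply: (class_CV openV (fun t _ => proper_within_setT t)); last exact: SF.
  by move=> _ z _; exact: F_neq0.
have S := smoothM openV SFV (smoothZ openV k1 (smooth_coef_mul openV (e_z a * e_zb b) btop smooth_balanced_form)).
by apply: (smooth_ext openV _ S) => z Vz; rewrite hE.
Qed.

Let unit_g s z : I s -> V z -> g s z \in unitmx.
Proof. by move=> Is Vz; have [] := hermitian_pos_top (rescaled_pos Is Vz). Qed.

Let Sg k j : smooth_on V (fun z => g t z k j).
Proof.
move=> n.
have C := class_CM openV properI (class_C_cst openV properI n (- 'i)) (class_C_rescaled n ([set j]%SET, [set k]%SET)).
apply: (class_C_ext openV (fun t _ => proper_within_setT t) _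
  (class_C_stopped openV (fun t _ => proper_within_setT t) It C)) => s z _ _.
by rewrite mxE.
Qed.

Hypothesis balanced : forall z, V z -> ext_d (al t) z = 0.

Let al_type z : V z -> has_type (m - 1) (m - 1) (al t z).
Proof.
move=> Vz; rewrite /al -escaleE; apply: has_typeZ.
have [om11 _ _] := om_pos It Vz.
by rewrite (wpowE (om t z : ext R m)) (metric_form11 om11); exact: has_type_form11X.
Qed.

Let m_gt0 : (0 < m)%N. Proof. exact: leq_trans m2. Qed.

Let S_top a b : smooth_on V (fun z => top (e_z a * e_zb b * (al t z : ext R m))).
Proof.
have S := smooth_coef_mul openV (e_z a * e_zb b) btop smooth_balanced_form.
exact: S.
Qed.

Let bal_del b z : V z -> \sum_p pd p (fun y => F y * h t p b y) z = 0.
Proof.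
move=> Vz; have E := closed_del openV smooth_balanced_form m_gt0 al_type b Vz (balanced Vz).
rewrite -[RHS](mulr0 k1) -[X in _ = _ * X]E mulr_sumr; apply: eq_bigr => p _; rewrite pdE.
rewrite -(wirtZ openV (- 'i) p k1 (S_top p b) Vz).
by apply: (wirt_ext openV _ p _ (smoothZ openV k1 (S_top p b)) Vz) => y Vy; rewrite F_h.
Qed.

Let bal_delbar a z : V z -> \sum_q pdbar q (fun y => F y * h t a q y) z = 0.
Proof.
move=> Vz; have E := closed_delbar openV smooth_balanced_form m_gt0 al_type a Vz (balanced Vz).
rewrite -[RHS](mulr0 k1) -[X in _ = _ * X]E mulr_sumr; apply: eq_bigr => q _; rewrite pdbarE.
rewrite -(wirtZ openV 'i q k1 (S_top a q) Vz).
by apply: (wirt_ext openV _ q _ (smoothZ openV k1 (S_top a q)) Vz) => y Vy; rewrite F_h.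
Qed.

Let be z := wpow (om t z) (m - 2).

Let Sbe : smooth_form V be.
Proof.
move=> P n; have om_n : class_C_form n om by move=> Q; exact: om_smooth.
have C := class_C_stopped openV (fun t _ => proper_within_setT t) It (class_C_wpow (m - 2) om_n P).
exact: C.
Qed.

Let D a b z := \sum_p \sum_q h t p q z * pd p (pdbar q (h t a b)) z
  - \sum_p \sum_q pd p (h t a q) z * pdbar q (h t p b) z.

Let k2 : R[i] := - kappa / (m%:R * (m - 1)%:R).

Let top_ddbar_be a b z : V z ->
  top (e_z a * e_zb b * (del (delbar be) z : ext R m)) = k2 * (F z * D a b z).
Proof.
move=> Vz; rewrite (top_ddbar openV a b Sbe Vz).
rewrite -(ddbar_inverse_metric openV Sf Sh f_neq0 f_hol bal_del bal_delbar a b Vz).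
rewrite mulr_sumr; apply: eq_bigr => p _; rewrite mulr_sumr; apply: eq_bigr => q _.
have S : smooth_on V (fun y => F y * (h t a b y * h t p q y - h t a q y * h t p b y)).
  have S1 := smoothM openV (Sh a b) (Sh p q).
  have S2 := smoothZ openV (-1) (smoothM openV (Sh a q) (Sh p b)).
  apply: (smooth_ext openV _ (smoothM openV SF (smoothD openV S1 S2))) => y _ /=.
  by rewrite mulN1r.
have Sb := smooth_wirt openV 'i q S.
rewrite pdE pdbarE -(wirtZ openV (- 'i) p k2 Sb Vz).
apply: (wirt_ext openV _ p _ (smoothZ openV k2 Sb) Vz) => y Vy.
rewrite -(wirtZ openV 'i q k2 S Vy); apply/esym.
apply: (wirt_ext openV _ q _ (smoothZ openV k2 S) Vy) => x Vx.
have E := rescaled_top2 m2 (Om_type Vx) (om_pos It Vx) (Om_neq0 Vx) a b p q.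
have n0 : (m%:R * (m - 1)%:R : R[i]) != 0 by rewrite mulf_neq0 // pnatr_eq0; lia.
apply: (mulfI n0); rewrite [RHS]E /k2.
have Hk (x' y' u : R[i]) : u != 0 -> u * (x' / u * y') = x' * y' by move=> u0; field.
exact (Hk _ _ _ n0).
Qed.

(** [F] is independent of time, so by [F_h] the flow equation is an evolution
    equation for the inverse metric; [ddbar_inverse_metric] computes its right-hand
    side and [is_deriv_of_invmx] passes to the metric. *)
Lemma evolution_in_chart z k j : V z ->
    (forall P, is_deriv_in I (fun s => al s z P) t (('i *: del (delbar be) z) P)) ->
  is_deriv_in I (fun s => g s z k j) t
    (- (m - 1)%:R^-1 * (chern_ricci (g t) z k j + 2^-1 * torsion_sq (g t) z k j)).
Proof.
move=> Vz flow; have Ip := properI It.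
have m1n0 : ((m - 1)%:R : R[i]) != 0 by rewrite pnatr_eq0; lia.
pose Hd : 'M[R[i]]_m := \matrix_(a, b) ((m - 1)%:R^-1 * D a b z).
have dh a b : is_deriv_in I (fun s => invmx (g s z) a b) t (Hd a b).
  have fl P : is_deriv_in I (fun s => al s z P) t (coef P ('i *: (del (delbar be) z : ext R m))).
    by rewrite /coef escaleE; exact: flow.
  have d1 P := is_derivZ (coef btop (e_z a * e_zb b * mono P)) (fl P).
  have d2 := is_deriv_sum It (r := index_enum (bideg m)) d1.
  have d3 := is_derivZ (F z)^-1 (is_derivZ k1 d2).
  have E : (F z)^-1 * (k1 * \sum_P coef btop (e_z a * e_zb b * mono P) *
      coef P ('i *: (del (delbar be) z : ext R m))) = Hd a b.
    have := coef_mulE (e_z a * e_zb b) btop ('i *: (del (delbar be) z : ext R m)).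
    rewrite -scalerAr coefZ -/(top _) top_ddbar_be // => EE.
    rewrite mxE -EE /k1 /k2.
    have m0 : (m%:R : R[i]) != 0 by rewrite pnatr_eq0; lia.
    have ii : 'i * 'i = -1 :> R[i] by rewrite -expr2 sqr_i.
    have H (x i kp n n1 y : R[i]) : x != 0 -> kp != 0 -> n != 0 -> n1 != 0 -> i * i = -1 ->
      x^-1 * (kp^-1 * (i * n) * (i * (- kp / (n * n1) * (x * y)))) = n1^-1 * y.
      move=> x0 kp0 n0 n10 i2; transitivity (- (i * i) * (n1^-1 * y)); last by rewrite i2 opprK mul1r.
      by field; rewrite x0 kp0 n0 n10.
    exact (H _ _ _ _ _ _ (F_neq0 Vz) kappa_neq0 m0 m1n0 ii).
  rewrite -E; apply: (is_deriv_in_ext It _ d3) => s Is.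
  by rewrite -[RHS]/(h s a b z) hE // /top coef_mulE.
have dg k' j' : derivable_in I (fun s => g s z k' j') t.
  have C := class_C_rescaled 1 ([set j']%SET, [set k']%SET).
  have d := is_derivZ (- 'i) (class_C_deriv properI C It Vz).
  by eexists; apply: (is_deriv_in_ext It _ d) => s Is; rewrite mxE.
have ug s : I s -> g s z \in unitmx by move=> Is; exact: unit_g.
have dG := is_deriv_of_invmx It Ip (k := k) (j := j) ug dg dh.
have -> : - (m - 1)%:R^-1 * (chern_ricci (g t) z k j + 2^-1 * torsion_sq (g t) z k j) =
    - \sum_a \sum_b g t z k a * Hd a b * g t z b j; last exact: dG.
have unit_gt y : V y -> g t y \in unitmx by exact: unit_g.
have herm y k' j' : V y -> g t y k' j' = (g t y j' k')^*%C.
  by move=> Vy; have [_ herm _] := rescaled_pos It Vy; exact: herm.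
rewrite -(curvature_evolution openV Sg Sh unit_gt herm k j Vz) mulNr mulr_sumr; congr (- _).
apply: eq_bigr => a _; rewrite mulr_sumr; apply: eq_bigr => b _.
have HdE : Hd a b = (m - 1)%:R^-1 * D a b z by exact: mxE.
rewrite HdE; have H (x y u v : R[i]) : x * (u * y * v) = u * (x * y) * v by ring.
exact (H _ _ _ _).
Qed.

End FixedTime.
End Local.

(** * From charts to the manifold *)

Section Charts.
Variables (R : realType) (m : nat) (X : topologicalType) (A : set (chart R m X)).
Hypothesis hX : complex_manifold A.

Lemma overlap_cimg c c' z : A c -> overlap c c' z ->
  cimg c z /\ cimg c' (transition c c' z).
Proof.
have [_ _ [charts _ _ _]] := hX => Ac [x [cx c'x] <-]; split; first by exists x.
by exists x => //; rewrite /transition /=; have [_ _ -> //] := charts c Ac.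
Qed.

Lemma open_cimg c : A c -> open (cimg c).
Proof. by have [_ _ [charts _ _ _]] := hX => /charts[]. Qed.

End Charts.

Theorem theorem1 (R : realType) (m : nat) (X : topologicalType)
    (A : set (chart R m X)) (Om : mform R m X)
    (I : set R) (om : R -> mform R m X)
    (hm : (2 <= m)%N)
    (hX : complex_manifold A)
    (hOm : nonvanishing_holomorphic_volume A Om)
    (hI : is_interval I) (hI2 : exists a b, [/\ I a, I b & a < b])
    (hom : hermitian_metric_flow A I om)
    (hflow : evolves_by A I
       (fun t => scale_form (norm_of Om (om t)) (pow_form (om t) (m - 1)))
       (fun t => i_del_delbar (pow_form (om t) (m - 2))))
    (hbal : forall t, I t ->
       closed_form A (scale_form (norm_of Om (om t)) (pow_form (om t) (m - 1)))) :
  let eta := fun t => scale_form (norm_of Om (om t)) (om t) in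
  let g := fun t c z => metric_mx (eta t c z) in
  [/\ hermitian_metric_flow A I eta,
      forall t, I t ->
        closed_form A (scale_form (fun c z => norm_of Om (eta t) c z ^+ 2)
                                  (pow_form (eta t) (m - 1)))
    & forall t c z (k j : 'I_m), I t -> A c -> cimg c z ->
        is_deriv_in I (fun s => g s c z k j) t
          (- (m - 1)%:R^-1 *
             (chern_ricci (g t c) z k j + 2^-1 * torsion_sq (g t c) z k j))].
Proof.
move=> eta g.
have properI t : I t -> ProperFilter (within I t^') by exact: proper_within_interval.
have [Om_form Om_type Om_smooth Om_hol Om_neq0] := hOm.
have [om_form om_pos om_smooth] := hom.
have oc c : A c -> open (cimg c) := @open_cimg _ _ _ _ hX c.
split.
- split.
  + move=> t It c c' z Ac Ac' ov; have [cz c'z] := overlap_cimg hX Ac ov.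
    have E1 := Om_form c c' z Ac Ac' ov; have E2 := om_form t It c c' z Ac Ac' ov.
    have c'_hol := Om_type c' _ Ac' c'z; have c'_pos := om_pos t c' _ It Ac' c'z.
    have J_hol := Om_type c z Ac cz; rewrite E1 in J_hol.
    have J_pos := om_pos t c z It Ac cz; rewrite E2 in J_pos.
    have N : form_norm (Om c z) (om t c z) =
        form_norm (Om c' (transition c c' z)) (om t c' (transition c c' z)).
      by rewrite E1 E2; exact: form_norm_pullback c'_hol c'_pos J_hol J_pos.
    have E3 := esym (pullbackZ (Defs.jacobian c c' z)
      (form_norm (Om c' (transition c c' z)) (om t c' (transition c c' z)))%:C
      (om t c' (transition c c' z))).
    exact: etrans (congr2 (fun (x : R) (y : extalg R m) => x%:C *: y) N E2) E3.
  + move=> t c z It Ac cz.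
    have H := rescaled_pos (fun z => Om_type c z Ac) (fun z => Om_neq0 c z Ac)
      (fun t z It => om_pos t c z It Ac) It cz.
    exact: H.
  + move=> c P Ac n.
    have H := class_C_rescaled (oc c Ac) properI (fun z => Om_type c z Ac)
      (fun P => Om_smooth c P Ac) (fun z => Om_neq0 c z Ac)
      (fun t z It => om_pos t c z It Ac) (fun P => om_smooth c P Ac) n P.
    exact: H.
- move=> t It c z Ac cz; rewrite -[RHS](hbal t It c z Ac cz).
  have S := smooth_balanced_form (oc c Ac) properI (fun z => Om_type c z Ac)
      (fun P => Om_smooth c P Ac) (fun z => Om_neq0 c z Ac)
      (fun t z It => om_pos t c z It Ac) (fun P => om_smooth c P Ac) It.
  apply: (ext_d_ext (oc c Ac) _ S cz) => y cy.
  have H := rescaled_balanced_form hm (fun z => Om_type c z Ac) (fun z => Om_neq0 c z Ac)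
      (fun t z It => om_pos t c z It Ac) It cy.
  exact: esym H.
- move=> t c z k j It Ac cz.
  have H := evolution_in_chart (oc c Ac) properI hm (fun z => Om_type c z Ac)
      (fun P => Om_smooth c P Ac) (fun z => Om_hol c z Ac) (fun z => Om_neq0 c z Ac)
      (fun t z It => om_pos t c z It Ac) (fun P => om_smooth c P Ac) It
      (fun z => hbal t It c z Ac) (k := k) (j := j) cz (fun P => hflow t c z P It Ac cz).
  exact: H.
Qed.
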